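(* Let $0<\sigma_1\le\sigma_2$ and $\mathsf E>0$. Consider the two-user optical intensity broadcast channel $Y_k=X+Z_k$, $Z_k\sim\mathcal N(0,\sigma_k^2)$, $k\in\{1,2\}$, with nonnegative input subject only to the average-intensity constraint $\mathbb E[X]\le\mathsf E$. For each $\rho\in[0,1]$ the rate pair $(R_1^{\mathrm{in}}(\rho),R_2^{\mathrm{in}}(\rho))$ given by $$R_1^{\mathrm{in}}(\rho)=\frac12\log\Big(1+\frac{e\rho^2\mathsf E^2}{2\pi\sigma_1^2}\Big),\qquad R_2^{\mathrm{in}}(\rho)=\frac12\log\Big(1+\frac{e\,\mathsf E^2}{2\pi\sigma_2^2}\Big)-\mathsf C_{\mathrm{ub}}(\rho\mathsf E,\sigma_2)$$ is achievable, where for $b\ge0$, $\sigma>0$, $$\mathsf C_{\mathrm{ub}}(b,\sigma)=\frac12\log\Big\{\frac{e}{2\pi}\Big(2+\frac{b}{\sigma}\Big)^2\Big\}.$$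
   Context: Logarithms are natural. Two-user optical intensity broadcast channel (OI-BC): a transmitter sends independent messages $M_1,M_2$ at rates $R_1,R_2$ to users 1 and 2 over the memoryless channel $Y_k=X+Z_k$, with $Z_k\sim\mathcal N(0,\sigma_k^2)$ independent of the real, nonnegative input $X$. A pair $(R_1,R_2)$ is achievable if both users can decode their messages with error probability vanishing as the code length tends to infinity; the capacity region is the closure of the set of achievable pairs, and ''achievable'' below means belonging to the capacity region. Since the channel is degraded ($Y_2=Y_1+\widetilde Z_2$ with $\widetilde Z_2\sim\mathcal N(0,\sigma_2^2-\sigma_1^2)$ independent), by a standard known result the capacity region is the set of $(R_1,R_2)$ with $R_1\le \mathsf I(X;Y_1|U)$ and $R_2\le \mathsf I(U;Y_2)$ for some joint law of $(U,X)$ with $X$ satisfying the input constraints and $U\to X\to Y_1\to Y_2$ Markov. A pair with a negative coordinate is regarded as achievable if the pair obtained by replacing negative coordinates by $0$ is. *)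

(* Defs.v *)
From HB Require Import structures.
From mathcomp Require Import all_boot all_order all_algebra.
From mathcomp Require Import all_classical all_reals all_analysis.

Set Implicit Arguments.
Unset Strict Implicit.
Unset Printing Implicit Defensive.

Import Order.TTheory GRing.Theory Num.Theory.
Import numFieldNormedType.Exports.

Local Open Scope classical_set_scope.
Local Open Scope ring_scope.

Definition cons_pair (T : Type) (n : nat) (p : T * n.-tuple T) : n.+1.-tuple T :=
  [the n.+1.-tuple T of p.1 :: p.2].

Lemma measurable_cons_pair (d : measure_display) (T : measurableType d)
    (n : nat) :
  measurable_fun [set: (T * n.-tuple T)%type] (@cons_pair T n).
Proof. exact: measurable_cons. Qed.

HB.instance Definition _ (d : measure_display) (T : measurableType d)
    (n : nat) :=
  isMeasurableFun.Build _ _ _ _ (@cons_pair T n) (@measurable_cons_pair d T n).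

(* The n-fold product P x ... x P on n.-tuple T: the joint law of n independent
   samples of P. *)
Fixpoint iid (d : measure_display) (T : measurableType d) (R : realType)
    (P : probability T R) (n : nat) : probability (n.-tuple T) R :=
  match n with
  | 0 => \d_([tuple] : 0.-tuple T)
  | m.+1 => distribution (P \x iid P m)%E (@cons_pair T m)
  end.

Definition add_noise (R : realType) (n : nat) (x z : n.-tuple R) : n.-tuple R :=
  [tuple tnth x i + tnth z i | i < n].

(* Block codes for a two-user broadcast channel with real inputs and outputs;
   the codeword depends on both messages, and user k only sees its own output
   and only decodes its own message. *)
Record bc_code (R : realType) (n M1 M2 : nat) := BcCode {
  encoder : 'I_M1 -> 'I_M2 -> n.-tuple R;
  decoder1 : n.-tuple R -> 'I_M1;
  decoder2 : n.-tuple R -> 'I_M2;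
  measurable_decoder1 : forall m, measurable (decoder1 @^-1` [set m]);
  measurable_decoder2 : forall m, measurable (decoder2 @^-1` [set m]) }.

(* Inputs are nonnegative, and every codeword has empirical average at most E. *)
Definition admissible_code (R : realType) (E : R) (n M1 M2 : nat)
    (c : bc_code R n M1 M2) : Prop :=
  forall m1 m2,
    (forall i, 0 <= tnth (encoder c m1 m2) i) /\
    \sum_(i < n) tnth (encoder c m1 m2) i <= n%:R * E.

(* Decoding error probabilities, for independent uniformly distributed messages.
   They only involve the marginal law of the user's own noise, so no joint law
   of the two noises has to be fixed. *)
Definition error_prob1 (R : realType) (sigma1 : R) (n M1 M2 : nat)
    (c : bc_code R n M1 M2) : R :=
  (M1 * M2)%:R^-1 * \sum_(m1 < M1) \sum_(m2 < M2)
    fine (iid (normal_prob 0 sigma1) n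
      [set z | decoder1 c (add_noise (encoder c m1 m2) z) != m1]).

Definition error_prob2 (R : realType) (sigma2 : R) (n M1 M2 : nat)
    (c : bc_code R n M1 M2) : R :=
  (M1 * M2)%:R^-1 * \sum_(m1 < M1) \sum_(m2 < M2)
    fine (iid (normal_prob 0 sigma2) n
      [set z | decoder2 c (add_noise (encoder c m1 m2) z) != m2]).

(* Rates are in nats per channel use. *)
Definition achievable_pair (R : realType) (sigma1 sigma2 E : R) (r : R * R) :
    Prop :=
  [/\ 0 <= r.1, 0 <= r.2 &
    forall eps : R, 0 < eps ->
      \forall n \near \oo, exists (M1 M2 : nat) (c : bc_code R n M1 M2),
        [/\ expR (n%:R * r.1) <= M1%:R, expR (n%:R * r.2) <= M2%:R,
            admissible_code E c,
            error_prob1 sigma1 c <= eps & error_prob2 sigma2 c <= eps]].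

Definition capacity_region (R : realType) (sigma1 sigma2 E : R) : set (R * R) :=
  closure [set r | achievable_pair sigma1 sigma2 E r].

(* Membership in the capacity region, with the convention that negative
   coordinates are first replaced by 0. *)
Definition achievable (R : realType) (sigma1 sigma2 E : R) (r : R * R) : Prop :=
  capacity_region sigma1 sigma2 E (Num.max 0 r.1, Num.max 0 r.2).

Definition C_ub (R : realType) (b sigma : R) : R :=
  2^-1 * ln (expR 1 / (2 * pi) * (2 + b / sigma) ^+ 2).

Definition R1_in (R : realType) (sigma1 E rho : R) : R :=
  2^-1 * ln (1 + expR 1 * rho ^+ 2 * E ^+ 2 / (2 * pi * sigma1 ^+ 2)).

Definition R2_in (R : realType) (sigma2 E rho : R) : R :=
  2^-1 * ln (1 + expR 1 * E ^+ 2 / (2 * pi * sigma2 ^+ 2))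
  - C_ub (rho * E) sigma2.

(* Main.v *)
(* Superposition coding. With b = rho * m, the input is X = U + V, where V is
   exponential of mean b and carries message 1, and the cloud centre U is 0 with
   probability (b + s) / (m + s) and exponential of mean m + s otherwise
   (s = sigma2), so that X has mean m < E. Both users decode the cloud by comparing
   the sum of score2 to a threshold; user 1 then subtracts U and decodes V with
   score1. The exponential of a score has integral at most 1 over a wrong codeword,
   so a union bound handles the wrong messages. The mean of score1 at the true
   codeword is R1_in, and that of score2 is at least
     ln ((m + 2 s) / (b + 2 s)) - s / (m + s),
   which dominates R2_in as soon as R2_in is positive. A threshold below the mean is
   missed with exponentially small probability by Chernoff's bound, all moment
   generating functions being explicit. No random codebook is needed: the codewords
   are chosen one after the other so that the sum of these bounds does not exceed
   its mean. Letting m tend to E puts the rate pair in the closure. *)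

Require Import Defs.
From HB Require Import structures.
From mathcomp Require Import all_boot all_order all_algebra.
From mathcomp Require Import all_classical all_reals all_analysis.
From mathcomp Require Import measurable_realfun.
From mathcomp Require Import ring lra zify.

Set Implicit Arguments.
Unset Strict Implicit.
Unset Printing Implicit Defensive.

Import Order.TTheory GRing.Theory Num.Theory.
Import numFieldNormedType.Exports.

Local Open Scope classical_set_scope.
Local Open Scope ring_scope.

(** * Derandomized superposition coding *)

(** Neither score is the log-likelihood ratio of the channel itself, since an exponential input in
    Gaussian noise has no convenient output density. [score2] is the likelihood ratio of a
    substitute channel with two-sided exponential noise. Enlarging the mean of the right tail from
    [b] to [b + s], with a left tail of mean [s], makes room for the Gaussian noise, and the weight
    of the atom keeps the output density of the same shape. [score1] turns the entropy power
    inequality into a metric: an exponential of mean [b] has entropy power e b^2 / (2 pi), which is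
    the origin of e / (2 pi) in [R1_in]. For this reason V is an increasing function of a standard
    normal seed [g], and the satellite codebook consists of seeds. The bound on the mean of [score2]
    improves as the noise variance decreases, so one metric tuned to [sigma2] serves both users. A
    rate that clipping sends to 0 is met with a single message and a test that always passes. This
    settles [rho = 0], where [score1] is undefined, and small or negative [R2_in], where the bound
    for [score2] can be too weak. *)

Section measure_lemmas.
Context (d : measure_display) (T : measurableType d) (R : realType).
Local Open Scope ereal_scope.

Lemma measure_le_integral (P : {measure set T -> \bar R}) (A : set T)
    (f : T -> \bar R) :
  measurable A -> measurable_fun [set: T] f -> (forall x, 0 <= f x) ->
  (forall x, A x -> 1 <= f x) -> P A <= \int[P]_x f x.
Proof.
move=> mA mf f0 Af; rewrite -[P A]mul1e -integral_cst//.
apply: (@le_trans _ _ (\int[P]_(x in A) f x)).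
  by apply: ge0_le_integral => //; apply: measurable_funTS.
exact: ge0_subset_integral.
Qed.

(** Averaging argument. If [f] exceeded its mean everywhere, the positive function [f - c] would
    have integral 0, hence vanish almost everywhere, and the whole space would be a null set. *)
Lemma exists_le_integral (P : probability T R) (f : T -> \bar R) :
  measurable_fun [set: T] f -> (forall x, 0 <= f x) ->
  exists x, f x <= \int[P]_x f x.
Proof.
move=> mf f0; apply: contrapT => /forallNP H.
have {}H x : \int[P]_x f x < f x by rewrite ltNge; apply/negP/H.
have I0 : 0 <= \int[P]_x f x by apply: integral_ge0.
have [t _] : [set: T] !=set0.
  apply/set0P/negP => /eqP T0; have := probability_setT P.
  by rewrite T0 measure0 => /esym/eqP; rewrite onee_eq0.
have If : \int[P]_x f x \is a fin_num.
  by rewrite ge0_fin_numE// (lt_le_trans (H t))// leey.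
pose c := fine (\int[P]_x f x).
have cE : \int[P]_x f x = c%:E by rewrite fineK.
pose g x := f x - c%:E.
have g0 x : 0 <= g x by rewrite sube_ge0// -cE ltW.
have mg : measurable_fun [set: T] g by apply: emeasurable_funB.
have fg x : f x = g x + c%:E by rewrite subeK.
have Ig : \int[P]_x g x = 0.
  have : \int[P]_x f x = \int[P]_x g x + c%:E.
    under eq_integral do rewrite fg.
    rewrite ge0_integralD//; last by move=> x _; rewrite -cE.
    by rewrite integral_cst// [X in _ * X](_ : _ = 1) ?mule1//; exact: probability_setT.
  rewrite cE => cg.
  have gfin : \int[P]_x g x \is a fin_num.
    have : 0 <= \int[P]_x g x by apply: integral_ge0.
    by move: cg; case: (\int[P]_x g x).
  move: cg; rewrite -(fineK gfin) -EFinD => -[] /eqP.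
  by rewrite -subr_eq subrr => /eqP <-.
have /(ae_eq_integral_abs P measurableT mg) [N [mN N0 sN]] :
    \int[P]_x `|g x| = 0.
  by under eq_integral do rewrite gee0_abs//.
have NT : N = setT.
  apply/seteqP; split=> // x _; apply: sN => /= /(_ I) gx0.
  by have := H x; rewrite cE fg gx0 add0e ltxx.
have := probability_setT P; by rewrite -NT N0 => /esym/eqP; rewrite onee_eq0.
Qed.

Import HBNNSimple.

(** The density is given through the values of [nu] on sets, so the identity is carried from
    indicators to simple functions, and then to monotone limits. It turns integrals against normal
    and exponential laws into Lebesgue integrals. *)
Lemma ge0_integral_density (mu nu : {measure set T -> \bar R}) (p : T -> R)
    (f : T -> \bar R) :
  measurable_fun [set: T] p -> (forall x, 0 <= p x)%R ->
  (forall A, measurable A -> nu A = \int[mu]_(x in A) (p x)%:E) ->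
  measurable_fun [set: T] f -> (forall x, 0 <= f x) ->
  \int[nu]_x f x = \int[mu]_x (f x * (p x)%:E).
Proof.
move=> mp p0 nuE mf f0.
have mpE : measurable_fun [set: T] (EFin \o p) by exact/measurable_EFinP.
pose f_ := nnsfun_approx measurableT mf.
have indE E : measurable E ->
    \int[nu]_x (\1_E x)%:E = \int[mu]_x ((\1_E x)%:E * (p x)%:E).
  move=> mE; rewrite integral_indic//= setIT nuE// [LHS]integral_mkcond.
  apply: eq_integral => x _; rewrite patchE indicE.
  by case: ifPn => _; rewrite ?mul1e ?mul0e.
have nnE (h : {nnsfun T >-> R}) :
    \int[nu]_x (h x)%:E = \int[mu]_x ((h x)%:E * (p x)%:E).
  under [LHS]eq_integral do rewrite fimfunE -fsumEFin//.
  rewrite [LHS]ge0_integral_fsum//; last 2 first.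
    - by move=> r; exact/measurable_EFinP/measurableT_comp.
    - by move=> n x _; rewrite EFinM nnfun_muleindic_ge0.
  under [RHS]eq_integral.
    move=> x xD; rewrite fimfunE -fsumEFin// muleC ge0_mule_fsumr; last first.
      by move=> r; rewrite EFinM nnfun_muleindic_ge0.
    over.
  rewrite [RHS]ge0_integral_fsum//; last 2 first.
    - move=> r; apply: emeasurable_funM => //.
      by apply/measurable_EFinP; apply: measurableT_comp.
    - by move=> n x _; rewrite mule_ge0 ?lee_fin// -lee_fin EFinM
        nnfun_muleindic_ge0.
  apply: eq_fsbigr => r _.
  have [r0|r0] := leP 0%R r.
    under eq_integral do rewrite EFinM.
    rewrite ge0_integralZl ?lee_fin//; last exact/measurable_EFinP.
    rewrite indE//.
    under [RHS]eq_integral do rewrite muleC EFinM -muleA.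
    rewrite ge0_integralZl ?lee_fin//.
    - by apply: emeasurable_funM => //; exact/measurable_EFinP.
    - by move=> x _; rewrite mule_ge0 ?lee_fin.
  (* A nonnegative simple function never takes a negative value [r], so both sides are 0. *)
  have E0 x : (r * \1_(h @^-1` [set r]) x)%R = 0%R.
    rewrite indicE; case: (boolP (x \in _)); rewrite ?mulr0// inE /= => hx.
    have hx0 : (0 <= h x)%R by exact: fun_ge0.
    by move: hx0; rewrite hx leNgt r0.
  transitivity (0 : \bar R).
    by apply: integral0_eq => x _; rewrite E0.
  by apply/esym/integral0_eq => x _; rewrite E0 mule0.
transitivity (limn (fun n => \int[nu]_x (f_ n x)%:E)).
  rewrite -monotone_convergence//=.
  - by apply: eq_integral => x _; apply/esym/cvg_lim => //; exact: cvg_nnsfun_approx.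
  - by move=> n; exact/measurable_EFinP.
  - by move=> n x _; rewrite lee_fin.
  - by move=> x _ m n mn; rewrite lee_fin; exact/lefP/nd_nnsfun_approx.
under eq_fun do rewrite nnE.
rewrite -monotone_convergence//=.
- apply: eq_integral => x _; apply/cvg_lim => //.
  by apply: cvgeZr => //; exact: cvg_nnsfun_approx.
- by move=> n; apply: emeasurable_funM => //; exact/measurable_EFinP.
- by move=> n x _; rewrite mule_ge0 ?lee_fin.
- move=> x _ m n mn; rewrite lee_pmul ?lee_fin//; exact/lefP/nd_nnsfun_approx.
Qed.

End measure_lemmas.

Section iid_product.
Context (d : measure_display) (T : measurableType d) (R : realType).
Variable P : probability T R.
Local Open Scope ereal_scope.

Lemma emeasurable_prod (d' : measure_display) (S : measurableType d')
    (I : Type) (r : seq I) (f : I -> S -> \bar R) :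
  (forall i, measurable_fun [set: S] (f i)) ->
  measurable_fun [set: S] (fun x => \big[mule/1]_(i <- r) f i x).
Proof.
move=> mf; elim: r => [|i r IHr].
  by under eq_fun do rewrite big_nil; exact: measurable_cst.
by under eq_fun do rewrite big_cons; exact: emeasurable_funM.
Qed.

(** Reduces every block quantity below to one letter. The factors may depend on the position because
    the letters of a fixed codeword do. *)
Lemma integral_iid_prod (n : nat) (f : 'I_n -> T -> \bar R) :
  (forall i, measurable_fun [set: T] (f i)) -> (forall i x, 0 <= f i x) ->
  \int[iid P n]_t \big[mule/1]_(i < n) f i (tnth t i) =
  \big[mule/1]_(i < n) \int[P]_x f i x.
Proof.
elim: n f => [|n IHn] f mf f0.
  rewrite big_ord0; under eq_integral do rewrite big_ord0.
  by rewrite integral_dirac// diracT mul1e.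
have mprod m (g : 'I_m -> T -> \bar R) : (forall i, measurable_fun [set: T] (g i)) ->
    measurable_fun [set: m.-tuple T]
      (fun t => \big[mule/1]_(i < m) g i (tnth t i)).
  move=> mg; apply: emeasurable_prod => i.
  by apply: measurableT_comp => //; exact: measurable_tnth.
rewrite /= /distribution ge0_integral_pushforward//=; last 2 first.
- exact: mprod.
- by move=> t _; apply: prode_ge0.
rewrite preimage_setT.
under eq_integral => p _.
  rewrite big_ord_recl/= tnth0.
  under eq_bigr do rewrite tnthS.
  over.
rewrite fubini_tonelli1/=; last 2 first.
- apply: emeasurable_funM; first by apply: measurableT_comp.
  have := mprod _ _ (fun i => mf (lift ord0 i)).
  by move=> /measurableT_comp; apply.
- by move=> p; rewrite mule_ge0// prode_ge0.
rewrite /fubini_F/=.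
under eq_integral.
  move=> x _; rewrite ge0_integralZl//; last 2 first.
  - by apply: (mprod _ (fun i => f (lift ord0 i))).
  - by move=> t _; rewrite prode_ge0.
  rewrite (IHn (fun i => f (lift ord0 i)))//; over.
rewrite ge0_integralZr// ?big_ord_recl//.
by apply: prode_ge0 => i _; exact: integral_ge0.
Qed.

End iid_product.

(** * Choosing codewords by conditional expectations *)

Section derandomization.
Context (d : measure_display) (T : measurableType d) (R : realType).
Variable P : probability T R.
Local Open Scope ereal_scope.

Lemma ge0_integralMn (f : T -> \bar R) (n : nat) :
  measurable_fun [set: T] f -> (forall x, 0 <= f x) ->
  \int[P]_x (f x *+ n) = \int[P]_x f x *+ n.
Proof.
move=> mf f0; under eq_integral do rewrite -mule_natl.
by rewrite ge0_integralZl// mule_natl.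
Qed.

Lemma emeasurable_funMn (f : T -> \bar R) (n : nat) :
  measurable_fun [set: T] f -> measurable_fun [set: T] (fun x => f x *+ n).
Proof.
move=> mf; under eq_fun do rewrite -mule_natl.
by apply: emeasurable_funM.
Qed.

Lemma ereal_mulrn_ge0 (x : \bar R) n : 0 <= x -> 0 <= x *+ n.
Proof. by move=> x0; rewrite -mule_natl mule_ge0// lee_fin. Qed.

(** Once a point is fixed, its interactions with a later point depend on that point alone, so they
    can be absorbed into the one-point cost. This is why [a] is arbitrary in the induction. *)
Lemma exists_points_le_integral (h : T * T -> \bar R) (M : nat) (a : T -> \bar R) :
  measurable_fun [set: T * T] h -> (forall p, 0 <= h p) ->
  measurable_fun [set: T] a -> (forall x, 0 <= a x) ->
  exists t : 'I_M -> T,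
    \sum_(i < M) a (t i) + \sum_(i < M) \sum_(j < M | j != i) h (t i, t j) <=
    \int[P]_x a x *+ M + \int[P]_x \int[P]_y h (x, y) *+ (M * M.-1).
Proof.
move=> mh h0; elim: M a => [|M IHM] a ma a0.
  have [t _] := exists_le_integral P ma a0.
  by exists (fun=> t); rewrite !big_ord0.
have mh1 t : measurable_fun [set: T] (fun y => h (t, y)).
  exact: measurableT_comp.
have mh2 t : measurable_fun [set: T] (fun y => h (y, t)).
  exact: measurableT_comp.
pose F1 t := \int[P]_y h (t, y).
pose F2 t := \int[P]_y h (y, t).
have mF1 : measurable_fun [set: T] F1 by exact: measurable_fun_fubini_tonelli_F.
have mF2 : measurable_fun [set: T] F2 by exact: measurable_fun_fubini_tonelli_G.
have F10 t : 0 <= F1 t by exact: integral_ge0.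
have F20 t : 0 <= F2 t by exact: integral_ge0.
pose H := \int[P]_x \int[P]_y h (x, y).
have IF2 : \int[P]_x F2 x = H by rewrite /F2 -(fubini_tonelli h).
(* The mean of all the costs that involve the first point, given its value: its own cost and its
   interactions, in both orders, with the [M] points still to come. *)
pose g t := a t + (F1 t + F2 t) *+ M.
have [t0 gt0] : exists t, g t <= \int[P]_x a x + (H + H) *+ M.
  have mF : measurable_fun [set: T] (fun t => F1 t + F2 t)%E by exact: emeasurable_funD.
  have mg : measurable_fun [set: T] g.
    by apply: emeasurable_funD => //; exact: emeasurable_funMn.
  have [|t gt] := exists_le_integral P mg.
    by move=> t; rewrite adde_ge0// ereal_mulrn_ge0// adde_ge0.
  exists t; apply: (le_trans gt); rewrite /g ge0_integralD//; last 2 first.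
  - by move=> x _; rewrite ereal_mulrn_ge0// adde_ge0.
  - exact: emeasurable_funMn.
  rewrite ge0_integralMn//; last by move=> x; rewrite adde_ge0.
  by rewrite ge0_integralD// IF2.
pose a' t := a t + (h (t0, t) + h (t, t0)).
have ma' : measurable_fun [set: T] a'.
  by apply: emeasurable_funD => //; apply: emeasurable_funD.
have [|t ht] := IHM a' ma'; first by move=> t; rewrite !adde_ge0.
pose t' (i : 'I_M.+1) := if unlift ord0 i is Some j then t j else t0.
have t'0 : t' ord0 = t0 by rewrite /t' unlift_none.
have t'S i : t' (lift ord0 i) = t i by rewrite /t' liftK.
exists t'.
have -> : \sum_(i < M.+1) a (t' i) +
    \sum_(i < M.+1) \sum_(j < M.+1 | j != i) h (t' i, t' j) =
  a t0 + (\sum_(i < M) a' (t i) + \sum_(i < M) \sum_(j < M | j != i) h (t i, t j)).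
  under [X in _ + X]eq_bigr do rewrite big_mkcond.
  rewrite !big_ord_recl/= t'0.
  under eq_bigr do rewrite t'S.
  under [X in _ + (_ + X)]eq_bigr.
    move=> i _; rewrite big_ord_recl/= t'0 t'S.
    under eq_bigr do rewrite t'S (inj_eq lift_inj).
    rewrite -big_mkcond; over.
  under [X in _ + (_ + X + _)]eq_bigr do rewrite t'S.
  rewrite /a' !big_split/= add0e -!addeA; congr (_ + (_ + (_ + _))).
have Ia' : \int[P]_x a' x = \int[P]_x a x + (F1 t0 + F2 t0).
  rewrite /a' ge0_integralD//; last 2 first.
  - by move=> x _; rewrite adde_ge0.
  - exact: emeasurable_funD.
  by rewrite ge0_integralD.
apply: (le_trans (leeD2l _ ht)); rewrite Ia' -/H.
have nE (x : \bar R) n : x *+ n = GRing.natmul x n by [].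
have -> : a t0 + ((\int[P]_x a x + (F1 t0 + F2 t0)) *+ M + H *+ (M * M.-1)) =
  g t0 + (\int[P]_x a x *+ M + H *+ (M * M.-1)).
  by rewrite /g !nE (mulrnDl M (\int[P]_x a x)) -!addeA; congr (_ + _); rewrite addeCA.
apply: (le_trans (leeD2r _ gt0)).
rewrite le_eqVlt; apply/orP; left; apply/eqP.
rewrite !nE mulrSr (_ : H + H = GRing.natmul H 2)// -mulrnA.
(* Ordered pairs of distinct points: those that contain the new point, and those among the
   others. *)
have -> : (M.+1 * M.+1.-1 = 2 * M + M * M.-1)%N.
  by case: (M) => //= k; rewrite !mulSn !mulnS; lia.
by rewrite (mulrnDr H (2 * M)%N) addeACA (addeC (\int[P]_x a x)).
Qed.

End derandomization.

Section superposition_derandomization.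
Context (d d' : measure_display) (T : measurableType d) (G : measurableType d').
Context (R : realType) (PT : probability T R) (PG : probability G R).
Local Open Scope ereal_scope.

Lemma ereal_sum_mulrn (I : finType) (p : pred I) (f : I -> \bar R) n :
  \sum_(i | p i) f i *+ n = (\sum_(i | p i) f i) *+ n.
Proof.
have nE (x : \bar R) : x *+ n = GRing.natmul x n by [].
by under eq_bigr do rewrite nE; rewrite nE -sumrMnl.
Qed.

(** The centres are chosen first, against costs averaged over the satellites. For fixed centres, no
    cost involves satellites of two different clouds, so the satellites can then be chosen
    separately in each cloud. *)
Lemma exists_superposition_le_integral (a : T * G -> \bar R)
    (b2 : T * (T * G) -> \bar R) (b1 : G * G -> \bar R) (M1 M2 : nat) :
  measurable_fun [set: T * G] a -> (forall p, 0 <= a p) ->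
  measurable_fun [set: T * (T * G)] b2 -> (forall p, 0 <= b2 p) ->
  measurable_fun [set: G * G] b1 -> (forall p, 0 <= b1 p) ->
  exists (t : 'I_M2 -> T) (g : 'I_M2 -> 'I_M1 -> G),
    \sum_(j < M2) \sum_(i < M1)
      (a (t j, g j i) + \sum_(k < M2 | k != j) b2 (t k, (t j, g j i)) +
       \sum_(k < M1 | k != i) b1 (g j i, g j k)) <=
    (\int[PT]_x \int[PG]_y a (x, y) +
     \int[PT]_x \int[PT]_x' \int[PG]_y b2 (x', (x, y)) *+ M2.-1 +
     \int[PG]_y \int[PG]_y' b1 (y, y') *+ M1.-1) *+ (M1 * M2).
Proof.
move=> ma a0 mb2 b20 mb1 b10.
have ma2 t : measurable_fun [set: G] (fun g => a (t, g)) by exact: measurableT_comp.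
have mb22 t t' : measurable_fun [set: G] (fun g => b2 (t', (t, g))).
  apply: (measurableT_comp mb2); apply: measurable_fun_pair => //.
pose A t := \int[PG]_y a (t, y).
pose h (p : T * T) := \int[PG]_y b2 (p.2, (p.1, y)).
have mA : measurable_fun [set: T] A by exact: measurable_fun_fubini_tonelli_F.
have A0 t : 0 <= A t by exact: integral_ge0.
have mh : measurable_fun [set: T * T] h.
  apply: (measurable_fun_fubini_tonelli_F
    (fun q : (T * T) * G => b2 (q.1.2, (q.1.1, q.2)))) => //.
  apply: (measurableT_comp mb2); apply: measurable_fun_pair.
    by apply: (measurableT_comp measurable_snd).
  by apply: measurable_fun_pair => //; apply: (measurableT_comp measurable_fst).
have h0 p : 0 <= h p by exact: integral_ge0.
have [t ht] := exists_points_le_integral PT M2 mh h0 mA A0.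
pose B1 := \int[PG]_y \int[PG]_y' b1 (y, y').
have /choice [g hg] : forall j, exists g : 'I_M1 -> G,
    \sum_(i < M1) (a (t j, g i) + \sum_(k < M2 | k != j) b2 (t k, (t j, g i))) +
    \sum_(i < M1) \sum_(k < M1 | k != i) b1 (g i, g k) <=
    (A (t j) + \sum_(k < M2 | k != j) h (t j, t k)) *+ M1 + B1 *+ (M1 * M1.-1).
  move=> j.
  have ms : measurable_fun [set: G]
      (fun y => \sum_(k < M2 | k != j) b2 (t k, (t j, y))).
    by under eq_fun do rewrite big_mkcond; apply: emeasurable_sum => k; case: (k != j).
  (* With the centres fixed, a wrong-cloud term depends on one satellite only and joins the
     one-point cost; [b1] is the only remaining interaction. *)
  have [|y|g hg] := @exists_points_le_integral _ _ _ PG b1 M1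
      (fun y => a (t j, y) + \sum_(k < M2 | k != j) b2 (t k, (t j, y))) mb1 b10.
  - exact: emeasurable_funD.
  - by rewrite adde_ge0// sume_ge0.
  exists g; apply: (le_trans hg); rewrite ge0_integralD//; last first.
    by move=> y _; rewrite sume_ge0.
  under [X in (_ + X) *+ _ + _ <= _]eq_integral do rewrite big_mkcond.
  rewrite ge0_integral_sum//; last 2 first.
  - by move=> k; case: (k != j).
  - by move=> k y _; case: (k != j).
  rewrite [X in _ <= (_ + X) *+ _ + _]big_mkcond/= le_eqVlt; apply/orP; left.
  apply/eqP; congr ((_ + _) *+ _ + _); apply: eq_bigr => k _.
  by case: (k != j) => //; rewrite integral0.
exists t, g.
apply: (@le_trans _ _ (\sum_(j < M2)
    ((A (t j) + \sum_(k < M2 | k != j) h (t j, t k)) *+ M1 + B1 *+ (M1 * M1.-1)))).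
  by apply: lee_sum => j _; apply: le_trans (hg j); rewrite big_split.
have nE (x : \bar R) n : x *+ n = GRing.natmul x n by [].
rewrite big_split/= ereal_sum_mulrn big_split/= sumr_const card_ord.
have : (\sum_(i < M2) A (t i) + \sum_(i < M2) \sum_(k < M2 | k != i) h (t i, t k)) *+ M1
  <= (\int[PT]_x A x *+ M2 + \int[PT]_x \int[PT]_y h (x, y) *+ (M2 * M2.-1)) *+ M1.
  rewrite -[X in X <= _]mule_natl -[X in _ <= X]mule_natl.
  by apply: lee_wpmul2l; [rewrite lee_fin|exact: ht].
move=> /(leeD2r (GRing.natmul (B1 *+ (M1 * M1.-1)) M2)) /le_trans; apply.
rewrite le_eqVlt; apply/orP; left; apply/eqP.
rewrite !nE (mulrnDl (M1 * M2)) (mulrnDl (M1 * M2)) (mulrnDl M1) -!mulrnA /B1 /A /h/=.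
by congr (_ *+ _ + _ *+ _ + _ *+ _)%R; lia.
Qed.

End superposition_derandomization.

Section tuple_products.
Context (d d' : measure_display) (T : measurableType d) (G : measurableType d').
Context (R : realType) (PT : probability T R) (PG : probability G R).
Local Open Scope ereal_scope.

(** Markov's inequality for the exponential of the sum, which is at least 1 on [A] and factorizes
    over the letters. *)
Lemma iid_le_prod (n : nat) (H : 'I_n -> T -> R) (A : set (n.-tuple T)) :
  measurable A -> (forall i, measurable_fun [set: T] (H i)) ->
  (forall z, A z -> 0 <= \sum_(i < n) H i (tnth z i))%R ->
  iid PT n A <= \big[mule/1]_(i < n) \int[PT]_x (expR (H i x))%:E.
Proof.
move=> mA mH AH.
have mE i : measurable_fun [set: T] (fun x => (expR (H i x))%:E).
  by apply/measurable_EFinP; exact: measurableT_comp.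
have E0 i x : 0 <= (expR (H i x))%:E by rewrite lee_fin expR_ge0.
rewrite -integral_iid_prod//; apply: measure_le_integral => //.
- apply: emeasurable_prod => i; apply: (measurableT_comp (mE i)).
  exact: measurable_tnth.
- by move=> z; apply: prode_ge0.
- by move=> z /AH S0; rewrite prodEFin -expR_sum lee_fin -expR0 ler_expR.
Qed.

Lemma emeasurable_prod_tnth2 (n : nat) (K : T * G -> \bar R) :
  measurable_fun [set: T * G] K ->
  measurable_fun [set: n.-tuple T * n.-tuple G]
    (fun p => \big[mule/1]_(i < n) K (tnth p.1 i, tnth p.2 i)).
Proof.
move=> mK; apply: emeasurable_prod => i; apply: (measurableT_comp mK).
apply: (@measurable_fun_pair _ _ _ _ _ _
    (fun p : n.-tuple T * n.-tuple G => tnth p.1 i) (fun p => tnth p.2 i)).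
- by apply: (measurableT_comp (measurable_tnth i)).
- by apply: (measurableT_comp (measurable_tnth i)).
Qed.

Lemma integral_iid_prod2 (n : nat) (K : T * G -> \bar R) :
  measurable_fun [set: T * G] K -> (forall p, 0 <= K p) ->
  \int[iid PT n]_t \int[iid PG n]_g
    \big[mule/1]_(i < n) K (tnth t i, tnth g i) =
  \big[mule/1]_(i < n) \int[PT]_x \int[PG]_y K (x, y).
Proof.
move=> mK K0; rewrite -integral_iid_prod//.
- apply: eq_integral => t _.
  by rewrite (integral_iid_prod PG (f := fun i y => K (tnth t i, y)))// => i;
    exact: measurableT_comp.
- by move=> i; exact: (measurable_fun_fubini_tonelli_F K).
- by move=> i x; exact: integral_ge0.
Qed.

Lemma prode_le_exprn (n : nat) (x : \bar R) (c : R) : 0 <= x -> x <= c%:E ->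
  \big[mule/1]_(i < n) x <= (c ^+ n)%:E.
Proof.
move=> x0 xc; elim: n => [|n IHn]; first by rewrite big_ord0 expr0.
by rewrite big_ord_recl exprS EFinM lee_pmul// prode_ge0.
Qed.

Lemma measure_bigsetU_le (m : {measure set T -> \bar R}) (I : finType)
    (p : pred I) (A : I -> set T) : (forall i, measurable (A i)) ->
  m (\big[setU/set0]_(i | p i) A i) <= \sum_(i | p i) m (A i).
Proof.
move=> mA; rewrite unlock; elim: (index_enum I) => [|i r IHr] /=.
  by rewrite measure0.
case: (p i) => //; apply: le_trans (leeD2l _ IHr).
apply: measureU2 => //; elim: r {IHr} => [|k r IHr] //=.
by case: (p k) => //; exact: measurableU.
Qed.

(** A decision based on finitely many test results is constant on each of the cells where all
    results are prescribed. It makes the decoders measurable whatever [pick] does when several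
    candidates pass. *)
Lemma measurable_finfun_test (I : finType) (test : I -> T -> bool)
    (B : pred {ffun I -> bool}) :
  (forall i, measurable [set y | test i y]) ->
  measurable [set y | B [ffun i => test i y]].
Proof.
move=> mt.
have mt2 i (b : bool) : measurable [set y | test i y = b].
  case: b; first exact: mt.
  rewrite (_ : [set _ | _] = ~` [set y | test i y]).
    exact: measurableC.
  apply/seteqP; split => y /=; first by move=> /negbT/negP.
  by move=> ny; apply/negbTE/negP.
rewrite (_ : [set _ | _] = \big[setU/set0]_(b : {ffun I -> bool} | B b)
    \big[setI/setT]_(i : I) [set y | test i y = b i]).
  apply: bigsetU_measurable => b _.  apply: bigsetI_measurable => i _.  exact: mt2.
apply/seteqP; split => [y By|y].
- rewrite -bigcup_seq_cond; exists [ffun i => test i y].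
    by rewrite /= mem_index_enum.
  by rewrite -bigcap_seq => i _ /=; rewrite ffunE.
- rewrite -bigcup_seq_cond => -[b /= /andP[_ Bb]]; rewrite -bigcap_seq => tb.
  suff -> : [ffun i => test i y] = b by [].
  by apply/ffunP => i; rewrite ffunE; apply: tb => /=; rewrite mem_index_enum.
Qed.

End tuple_products.

(** * Error probabilities of a fixed codebook *)

Section superposition_code.
Context (R : realType) (dU dG : measure_display).
Context (TU : measurableType dU) (TG : measurableType dG).
Variables (sigma1 sigma2 E theta gam1 gam2 : R).
Variables (u : TU -> R) (v : TG -> R) (l2 : TU -> R -> R) (l1 : TG -> R -> R).
Hypotheses (E_ge0 : 0 <= E) (theta_ge0 : 0 <= theta).
Hypotheses (u_ge0 : forall x, 0 <= u x) (v_ge0 : forall x, 0 <= v x).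
Hypotheses (mu : measurable_fun [set: TU] u) (mv : measurable_fun [set: TG] v).
Hypothesis ml2 : measurable_fun [set: TU * R] (fun p => l2 p.1 p.2).
Hypothesis ml1 : measurable_fun [set: TG * R] (fun p => l1 p.1 p.2).

Local Notation N := (normal_prob 0).
Local Notation N1 := (normal_prob 0 sigma1).

(* The kernels are the one-letter factors of the Chernoff and Markov bounds on the
   events that a codeword exceeds the power constraint, that a transmitted
   codeword fails its test, and that a wrong codeword passes it. *)
Definition power_kernel (p : TU * TG) : \bar R :=
  (expR (theta * (u p.1 + v p.2 - E)))%:E.

Definition miss2_kernel (s : R) (p : TU * TG) : \bar R :=
  (\int[N s]_z (expR (theta * (gam2 - l2 p.1 (u p.1 + v p.2 + z))))%:E)%E.

Definition miss1_kernel (g : TG) : \bar R :=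
  (\int[N1]_z (expR (theta * (gam1 - l1 g (v g + z))))%:E)%E.

Definition hit2_kernel (s : R) (q : TU * (TU * TG)) : \bar R :=
  (\int[N s]_z (expR (l2 q.1 (u q.2.1 + v q.2.2 + z) - gam2))%:E)%E.

Definition hit1_kernel (q : TG * TG) : \bar R :=
  (\int[N1]_z (expR (l1 q.2 (v q.1 + z) - gam1))%:E)%E.

Section codebook.
Variables (n M1 M2 : nat) (t : 'I_M2 -> n.-tuple TU)
  (g : 'I_M2 -> 'I_M1 -> n.-tuple TG) (i1 : 'I_M1) (i2 : 'I_M2).

Let cword m1 m2 : n.-tuple R :=
  [tuple u (tnth (t m2) i) + v (tnth (g m2 m1) i) | i < n].

Let power_ok m1 m2 : bool := \sum_(i < n) tnth (cword m1 m2) i <= n%:R * E.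

(** The constraint binds every single codeword, so one that violates it is replaced by the zero
    word. For such a pair of messages the error probability is bounded by 1, and [power_term] is at
    least 1. *)
Let enc m1 m2 : n.-tuple R :=
  if power_ok m1 m2 then cword m1 m2 else [tuple 0 | i < n].

Let test2 (m2 : 'I_M2) (y : n.-tuple R) : bool :=
  n%:R * gam2 <= \sum_(i < n) l2 (tnth (t m2) i) (tnth y i).

Let test1 (m : 'I_M1 * 'I_M2) (y : n.-tuple R) : bool :=
  n%:R * gam1 <= \sum_(i < n)
    l1 (tnth (g m.2 m.1) i) (tnth y i - u (tnth (t m.2) i)).

Let pick2 (b : {ffun 'I_M2 -> bool}) := odflt i2 [pick m | b m].
Let pick1 (b : {ffun 'I_M1 * 'I_M2 -> bool}) :=
  (odflt (i1, i2) [pick m | b m]).1.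

Let dec2 (y : n.-tuple R) := pick2 [ffun m => test2 m y].
Let dec1 (y : n.-tuple R) :=
  pick1 [ffun m : 'I_M1 * 'I_M2 => test2 m.2 y && test1 m y].

Let ml2' x : measurable_fun [set: R] (l2 x).
Proof. exact: (measurable_fun_pair2 x ml2). Qed.

Let ml1' x : measurable_fun [set: R] (l1 x).
Proof. exact: (measurable_fun_pair2 x ml1). Qed.

Let measurable_test2 m : measurable [set y | test2 m y].
Proof.
rewrite -[X in measurable X]setTI; apply: measurable_fun_le => //.
apply: measurable_sum => i; apply: (measurableT_comp (ml2' _)).
exact: measurable_tnth.
Qed.

Let measurable_test1 m : measurable [set y | test1 m y].
Proof.
rewrite -[X in measurable X]setTI; apply: measurable_fun_le => //.
apply: measurable_sum => i; apply: (measurableT_comp (ml1' _)).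
by apply: measurable_funB => //; exact: measurable_tnth.
Qed.

Let mdec2 m : measurable (dec2 @^-1` [set m]).
Proof.
rewrite (_ : _ @^-1` _ =
    [set y | [pred b | pick2 b == m] [ffun m => test2 m y]]).
  exact: (measurable_finfun_test _ measurable_test2).
by apply/seteqP; split => y /= /eqP.
Qed.

Let mdec1 m : measurable (dec1 @^-1` [set m]).
Proof.
rewrite (_ : _ @^-1` _ = [set y | [pred b | pick1 b == m]
    [ffun m : 'I_M1 * 'I_M2 => test2 m.2 y && test1 m y]]).
  apply: (@measurable_finfun_test _ _ _ (fun m y => test2 m.2 y && test1 m y)).
  move=> p; rewrite (_ : [set _ | _] = [set y | test2 p.2 y] `&` [set y | test1 p y]).
    exact: measurableI.
  by apply/seteqP; split => y /= /andP.
by apply/seteqP; split => y /= /eqP.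
Qed.

Let code := BcCode enc mdec1 mdec2.

Let admissible : admissible_code E code.
Proof.
move=> m1 m2 /=; rewrite /enc; case: ifPn => [ok|_]; split.
- by move=> i; rewrite tnth_mktuple addr_ge0.
- exact: ok.
- by move=> i; rewrite tnth_mktuple.
- by rewrite big1 ?mulr_ge0// => i _; rewrite tnth_mktuple.
Qed.

Local Open Scope ereal_scope.

Let power_term m1 m2 : \bar R :=
  \prod_(i < n) power_kernel (tnth (t m2) i, tnth (g m2 m1) i).
Let miss2_term s m1 m2 : \bar R :=
  \prod_(i < n) miss2_kernel s (tnth (t m2) i, tnth (g m2 m1) i).
Let miss1_term m1 m2 : \bar R := \prod_(i < n) miss1_kernel (tnth (g m2 m1) i).
Let hit2_term s m1 m2 k : \bar R :=
  \prod_(i < n) hit2_kernel s (tnth (t k) i, (tnth (t m2) i, tnth (g m2 m1) i)).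
Let hit1_term m1 m2 k : \bar R :=
  \prod_(i < n) hit1_kernel (tnth (g m2 m1) i, tnth (g m2 k) i).

Let power_bad m1 m2 : ~~ power_ok m1 m2 -> 1 <= power_term m1 m2.
Proof.
rewrite /power_ok -ltNge => /ltW bad.
rewrite /power_term /power_kernel /= prodEFin -expR_sum lee_fin -expR0 ler_expR.
rewrite -mulr_sumr mulr_ge0// sumrB sumr_const card_ord subr_ge0 -[(_ *+ n)%R]mulr_natl.
apply: (le_trans bad); rewrite le_eqVlt; apply/orP; left; apply/eqP.
by apply: eq_bigr => i _; rewrite tnth_mktuple.
Qed.

Let term_ge0 m1 m2 : [/\ 0 <= power_term m1 m2,
  (forall s, 0 <= miss2_term s m1 m2), 0 <= miss1_term m1 m2,
  (forall s k, 0 <= hit2_term s m1 m2 k) & (forall k, 0 <= hit1_term m1 m2 k)].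
Proof.
split => *; apply: prode_ge0 => i _;
  rewrite /miss2_kernel /miss1_kernel /hit2_kernel /hit1_kernel /power_kernel.
- by rewrite lee_fin expR_ge0.
- by apply: integral_ge0 => z _; rewrite lee_fin expR_ge0.
- by apply: integral_ge0 => z _; rewrite lee_fin expR_ge0.
- by apply: integral_ge0 => z _; rewrite lee_fin expR_ge0.
- by apply: integral_ge0 => z _; rewrite lee_fin expR_ge0.
Qed.

Let mnoise m1 m2 : measurable_fun [set: n.-tuple R] (add_noise (enc m1 m2)).
Proof.
apply/measurable_fun_tnthP => i; rewrite /comp /add_noise.
under eq_fun do rewrite tnth_mktuple.
by apply: measurable_funD => //; exact: measurable_tnth.
Qed.

Let prob_miss2 s m1 m2 : power_ok m1 m2 ->
  iid (N s) n [set z | ~~ test2 m2 (add_noise (enc m1 m2) z)] <=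
  miss2_term s m1 m2.
Proof.
move=> ok.
apply: (@iid_le_prod _ _ _ (N s) n (fun i z => theta * (gam2 - l2 (tnth (t m2) i)
  (u (tnth (t m2) i) + v (tnth (g m2 m1) i) + z)))%R).
- rewrite (_ : [set _ | _] = add_noise (enc m1 m2) @^-1` (~` [set y | test2 m2 y])).
    rewrite -[X in measurable X]setTI; apply: mnoise => //; exact: measurableC.
  by apply/seteqP; split => z /= /negP.
- move=> i; apply: measurable_funM => //; apply: measurable_funB => //.
  by apply: (measurableT_comp (ml2' _)); exact: measurable_funD.
- move=> z /=; rewrite /test2 -ltNge => /ltW bad.
  rewrite -mulr_sumr mulr_ge0// sumrB sumr_const card_ord subr_ge0 -[(_ *+ n)%R]mulr_natl.
  apply: le_trans bad; rewrite le_eqVlt; apply/orP; left; apply/eqP.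
  by apply: eq_bigr => i _; rewrite /add_noise tnth_mktuple /enc ok tnth_mktuple.
Qed.

Let prob_miss1 m1 m2 : power_ok m1 m2 ->
  iid N1 n [set z | ~~ test1 (m1, m2) (add_noise (enc m1 m2) z)] <=
  miss1_term m1 m2.
Proof.
move=> ok.
apply: (@iid_le_prod _ _ _ N1 n (fun i z => theta * (gam1 - l1 (tnth (g m2 m1) i)
  (v (tnth (g m2 m1) i) + z)))%R).
- rewrite (_ : [set _ | _] = add_noise (enc m1 m2) @^-1` (~` [set y | test1 (m1, m2) y])).
    rewrite -[X in measurable X]setTI; apply: mnoise => //; exact: measurableC.
  by apply/seteqP; split => z /= /negP.
- move=> i; apply: measurable_funM => //; apply: measurable_funB => //.
  by apply: (measurableT_comp (ml1' _)); exact: measurable_funD.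
- move=> z /=; rewrite /test1 -ltNge => /ltW bad.
  rewrite -mulr_sumr mulr_ge0// sumrB sumr_const card_ord subr_ge0 -[(_ *+ n)%R]mulr_natl.
  apply: le_trans bad; rewrite le_eqVlt; apply/orP; left; apply/eqP.
  apply: eq_bigr => i _; rewrite /add_noise tnth_mktuple /enc ok tnth_mktuple/=.
  (* Subtracting the true centre leaves exactly the satellite plus noise, a single-user channel. *)
  by congr (l1 _ _); rewrite addrAC (addrC (u _)) addrK.
Qed.

Let prob_hit2 s m1 m2 k : power_ok m1 m2 ->
  iid (N s) n [set z | test2 k (add_noise (enc m1 m2) z)] <=
  hit2_term s m1 m2 k.
Proof.
move=> ok.
apply: (@iid_le_prod _ _ _ (N s) n (fun i z => l2 (tnth (t k) i)
  (u (tnth (t m2) i) + v (tnth (g m2 m1) i) + z) - gam2)%R).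
- rewrite (_ : [set _ | _] = add_noise (enc m1 m2) @^-1` [set y | test2 k y])//.
  by rewrite -[X in measurable X]setTI; apply: mnoise.
- move=> i; apply: measurable_funB => //.
  by apply: (measurableT_comp (ml2' _)); exact: measurable_funD.
- move=> z /=; rewrite /test2 => bad.
  rewrite sumrB sumr_const card_ord subr_ge0 -[(_ *+ n)%R]mulr_natl.
  apply: (le_trans bad); rewrite le_eqVlt; apply/orP; left; apply/eqP.
  by apply: eq_bigr => i _; rewrite /add_noise tnth_mktuple /enc ok tnth_mktuple.
Qed.

Let prob_hit1 m1 m2 k : power_ok m1 m2 ->
  iid N1 n [set z | test1 (k, m2) (add_noise (enc m1 m2) z)] <=
  hit1_term m1 m2 k.
Proof.
move=> ok.
apply: (@iid_le_prod _ _ _ N1 n (fun i z => l1 (tnth (g m2 k) i)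
  (v (tnth (g m2 m1) i) + z) - gam1)%R).
- rewrite (_ : [set _ | _] = add_noise (enc m1 m2) @^-1` [set y | test1 (k, m2) y])//.
  by rewrite -[X in measurable X]setTI; apply: mnoise.
- move=> i; apply: measurable_funB => //.
  by apply: (measurableT_comp (ml1' _)); exact: measurable_funD.
- move=> z /=; rewrite /test1 => bad.
  rewrite sumrB sumr_const card_ord subr_ge0 -[(_ *+ n)%R]mulr_natl.
  apply: (le_trans bad); rewrite le_eqVlt; apply/orP; left; apply/eqP.
  apply: eq_bigr => i _; rewrite /add_noise tnth_mktuple /enc ok tnth_mktuple/=.
  by congr (l1 _ _); rewrite addrAC (addrC (u _)) addrK.
Qed.

Let mtest2 m1 m2 k : measurable [set z | test2 k (add_noise (enc m1 m2) z)].
Proof.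
rewrite -[X in measurable X]setTI.
exact: (mnoise m1 m2 measurableT (measurable_test2 k)).
Qed.

Let mtest1 m1 m2 k : measurable [set z | test1 k (add_noise (enc m1 m2) z)].
Proof.
rewrite -[X in measurable X]setTI.
exact: (mnoise m1 m2 measurableT (measurable_test1 k)).
Qed.

Let mtestC (b : n.-tuple R -> bool) : measurable [set z | b z] ->
  measurable [set z | ~~ b z].
Proof.
move=> /measurableC; congr measurable.
by apply/seteqP; split => z /= /negP.
Qed.

Let mneq (I : finType) (f : n.-tuple R -> I) (i : I) x :
  (forall i, measurable (f @^-1` [set i])) ->
  measurable [set z | f (add_noise x z) != i].
Proof.
move=> mf; apply: (mtestC (b := fun z => f (add_noise x z) == i)).
rewrite (_ : [set _ | _] = add_noise x @^-1` (f @^-1` [set i])); last first.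
  by apply/seteqP; split => z /= /eqP.
rewrite -[X in measurable X]setTI.
have /(_ _ _ (mf i)) : measurable_fun [set: n.-tuple R] (add_noise x); last exact.
apply/measurable_fun_tnthP => j; rewrite /comp /add_noise.
under eq_fun do rewrite tnth_mktuple.
by apply: measurable_funD => //; exact: measurable_tnth.
Qed.

Let miss2_gap m2 y : dec2 y != m2 -> test2 m2 y ->
  exists2 k, k != m2 & test2 k y.
Proof.
rewrite /dec2 /pick2; case: pickP => [k /=|/(_ m2)]; rewrite ffunE.
  by move=> yk km2 _; exists k.
by move=> /= -> .
Qed.

(** Suppose that the true pair passes both tests, yet a pair with a wrong first index is picked. If
    its cloud is wrong, [test2] has accepted a wrong cloud. If its cloud is right, [test1] has
    accepted a wrong satellite after the true centre was subtracted. Thus [test1] is never estimated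
    with a wrong centre. *)
Let error1 m1 m2 :
  iid N1 n [set z | dec1 (add_noise (enc m1 m2) z) != m1] <=
  power_term m1 m2 + (miss2_term sigma1 m1 m2 + (miss1_term m1 m2 +
  (\sum_(k < M2 | k != m2) hit2_term sigma1 m1 m2 k +
   \sum_(k < M1 | k != m1) hit1_term m1 m2 k))).
Proof.
have [P0 S2 S1 H2 H1] := term_ge0 m1 m2.
have sH2 : 0 <= \sum_(k < M2 | k != m2) hit2_term sigma1 m1 m2 k.
  by apply: sume_ge0 => k _; exact: H2.
have sH1 : 0 <= \sum_(k < M1 | k != m1) hit1_term m1 m2 k.
  by apply: sume_ge0 => k _; exact: H1.
have [ok|bad] := boolP (power_ok m1 m2); last first.
  apply: (@le_trans _ _ 1); first by apply: probability_le1; apply: (mneq (f := dec1)); exact: mdec1.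
  apply: (le_trans (power_bad bad)); apply: leeDl.
  exact: (adde_ge0 (S2 _) (adde_ge0 S1 (adde_ge0 sH2 sH1))).
set y := add_noise (enc m1 m2).
pose A2 := [set z | ~~ test2 m2 (y z)].
pose A1 := [set z | ~~ test1 (m1, m2) (y z)].
pose B2 := \big[setU/set0]_(k < M2 | k != m2) [set z | test2 k (y z)].
pose B1 := \big[setU/set0]_(k < M1 | k != m1) [set z | test1 (k, m2) (y z)].
have mA2 : measurable A2 by apply: (mtestC (b := fun z => test2 m2 (y z))); exact: mtest2.
have mA1 : measurable A1 by apply: (mtestC (b := fun z => test1 (m1, m2) (y z))); exact: mtest1.
have mB2 : measurable B2 by apply: bigsetU_measurable => k _; exact: mtest2.
have mB1 : measurable B1 by apply: bigsetU_measurable => k _; exact: mtest1.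
apply: (@le_trans _ _ (iid N1 n (A2 `|` (A1 `|` (B2 `|` B1))))).
  apply: le_measure; rewrite ?inE.
  - by apply: (mneq (f := dec1)); exact: mdec1.
  - by do !apply: measurableU.
  - move=> z /=; rewrite /dec1 /pick1.
    have [t2|] := boolP (test2 m2 (y z)); last by left.
    have [t1|] := boolP (test1 (m1, m2) (y z)); last by right; left.
    case: pickP => [[k1 k2] /=|/(_ (m1, m2))]; rewrite ffunE/=; last first.
      by rewrite t2 t1.
    move=> /andP[tk2 tk1] k1m1; right; right.
    have [k2m2|k2m2] := eqVneq k2 m2; [right|left].
    + by rewrite /B1 -bigcup_seq_cond; exists k1; rewrite /= ?mem_index_enum// -k2m2.
    + by rewrite /B2 -bigcup_seq_cond; exists k2; rewrite /= ?mem_index_enum.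
apply: le_trans (leeDr _ P0).
apply: (le_trans (measureU2 _ _ _)) => //; first by do !apply: measurableU.
apply: leeD; first exact: prob_miss2.
apply: (le_trans (measureU2 _ _ _)) => //; first by do !apply: measurableU.
apply: leeD; first exact: prob_miss1.
apply: (le_trans (measureU2 _ _ _)) => //.
apply: leeD.
- have /le_trans := measure_bigsetU_le (iid N1 n) (fun k => k != m2) (mtest2 m1 m2); apply.
  by apply: lee_sum => k _; exact: prob_hit2.
- have /le_trans := measure_bigsetU_le (iid N1 n) (fun k => k != m1) (fun k => mtest1 m1 m2 (k, m2)); apply.
  by apply: lee_sum => k _; exact: prob_hit1.
Qed.

Let error2 m1 m2 :
  iid (N sigma2) n [set z | dec2 (add_noise (enc m1 m2) z) != m2] <=
  power_term m1 m2 + (miss2_term sigma2 m1 m2 +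
  \sum_(k < M2 | k != m2) hit2_term sigma2 m1 m2 k).
Proof.
have [P0 S2 S1 H2 H1] := term_ge0 m1 m2.
have sH2 : 0 <= \sum_(k < M2 | k != m2) hit2_term sigma2 m1 m2 k.
  by apply: sume_ge0 => k _; exact: H2.
have [ok|bad] := boolP (power_ok m1 m2); last first.
  apply: (@le_trans _ _ 1); first by apply: probability_le1; apply: (mneq (f := dec2)); exact: mdec2.
  apply: (le_trans (power_bad bad)); apply: leeDl.
  exact: (adde_ge0 (S2 _) sH2).
set y := add_noise (enc m1 m2).
pose A2 := [set z | ~~ test2 m2 (y z)].
pose B2 := \big[setU/set0]_(k < M2 | k != m2) [set z | test2 k (y z)].
have mA2 : measurable A2 by apply: (mtestC (b := fun z => test2 m2 (y z))); exact: mtest2.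
have mB2 : measurable B2 by apply: bigsetU_measurable => k _; exact: mtest2.
apply: (@le_trans _ _ (iid (N sigma2) n (A2 `|` B2))).
  apply: le_measure; rewrite ?inE.
  - by apply: (mneq (f := dec2)); exact: mdec2.
  - exact: measurableU.
  - move=> z /=.
    have [t2|] := boolP (test2 m2 (y z)); last by left.
    move=> /miss2_gap /(_ t2) [k km2 tk]; right.
    by rewrite /B2 -bigcup_seq_cond; exists k; rewrite /= ?mem_index_enum.
apply: le_trans (leeDr _ P0).
apply: (le_trans (measureU2 _ _ _)) => //.
apply: leeD; first exact: prob_miss2.
have /le_trans := measure_bigsetU_le (iid (N sigma2) n) (fun k => k != m2) (mtest2 m1 m2); apply.
by apply: lee_sum => k _; exact: prob_hit2.
Qed.

(** One codebook must be good for both users, hence the sum of the two error probabilities: a bound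
    on its average over the messages bounds each of them. The power term is charged once per user,
    and wrong clouds once per noise level. *)
Lemma codebook_error : exists2 c : bc_code R n M1 M2, admissible_code E c &
  forall m1 m2,
  iid N1 n [set z | decoder1 c (add_noise (encoder c m1 m2) z) != m1] +
  iid (N sigma2) n [set z | decoder2 c (add_noise (encoder c m1 m2) z) != m2] <=
  \prod_(i < n) power_kernel (tnth (t m2) i, tnth (g m2 m1) i) +
  \prod_(i < n) power_kernel (tnth (t m2) i, tnth (g m2 m1) i) +
  \prod_(i < n) miss2_kernel sigma1 (tnth (t m2) i, tnth (g m2 m1) i) +
  \prod_(i < n) miss2_kernel sigma2 (tnth (t m2) i, tnth (g m2 m1) i) +
  \prod_(i < n) miss1_kernel (tnth (g m2 m1) i) +
  \sum_(k < M2 | k != m2)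
    (\prod_(i < n) hit2_kernel sigma1
       (tnth (t k) i, (tnth (t m2) i, tnth (g m2 m1) i)) +
     \prod_(i < n) hit2_kernel sigma2
       (tnth (t k) i, (tnth (t m2) i, tnth (g m2 m1) i))) +
  \sum_(k < M1 | k != m1)
    \prod_(i < n) hit1_kernel (tnth (g m2 m1) i, tnth (g m2 k) i).
Proof.
exists code; first exact: admissible.
move=> m1 m2; apply: (le_trans (leeD (error1 m1 m2) (error2 m1 m2))).
rewrite big_split/=.
have AC (p a b c x y w : \bar R) : p + (a + (c + (x + w))) + (p + (b + y)) =
    p + p + a + b + c + (x + y) + w.
  by rewrite addeACA (addeACA a) -(addeA c) (addeAC x w y) !addeA.
by rewrite AC; exact: lexx.
Qed.

End codebook.
End superposition_code.

(** * Average error over the codebook ensemble *)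

Section code_existence.
Context (R : realType) (dU dG : measure_display).
Context (TU : measurableType dU) (TG : measurableType dG).
Variables (PU : probability TU R) (PG : probability TG R).
Variables (sigma1 sigma2 E theta gam1 gam2 : R).
Variables (u : TU -> R) (v : TG -> R) (l2 : TU -> R -> R) (l1 : TG -> R -> R).
Hypotheses (E_ge0 : 0 <= E) (theta_ge0 : 0 <= theta).
Hypotheses (u_ge0 : forall x, 0 <= u x) (v_ge0 : forall x, 0 <= v x).
Hypotheses (mu : measurable_fun [set: TU] u) (mv : measurable_fun [set: TG] v).
Hypothesis ml2 : measurable_fun [set: TU * R] (fun p => l2 p.1 p.2).
Hypothesis ml1 : measurable_fun [set: TG * R] (fun p => l1 p.1 p.2).
Local Open Scope ereal_scope.

Local Notation N := (normal_prob 0).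
Local Notation N1 := (normal_prob 0 sigma1).
Local Notation kpow := (power_kernel E theta u v).
Local Notation kmiss2 := (miss2_kernel theta gam2 u v l2).
Local Notation kmiss1 := (miss1_kernel sigma1 theta gam1 v l1).
Local Notation khit2 := (hit2_kernel gam2 u v l2).
Local Notation khit1 := (hit1_kernel sigma1 gam1 v l1).

Hypothesis l2_le1 : forall y, \int[PU]_x (expR (l2 x y))%:E <= 1.
Hypothesis l1_le1 : forall y, \int[PG]_x (expR (l1 x y))%:E <= 1.

Let expE0 (r : R) : 0 <= (expR r)%:E. Proof. by rewrite lee_fin expR_ge0. Qed.

Let mexp d (T : measurableType d) (f : T -> R) : measurable_fun [set: T] f ->
  measurable_fun [set: T] (fun x => (expR (f x))%:E).
Proof. by move=> mf; apply/measurable_EFinP; exact: measurableT_comp. Qed.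

Let ml2c d (T : measurableType d) (f : T -> TU) (g : T -> R) :
  measurable_fun [set: T] f -> measurable_fun [set: T] g ->
  measurable_fun [set: T] (fun x => l2 (f x) (g x)).
Proof.
by move=> mf mg; exact: (measurableT_comp ml2 (measurable_fun_pair mf mg)).
Qed.

Let ml1c d (T : measurableType d) (f : T -> TG) (g : T -> R) :
  measurable_fun [set: T] f -> measurable_fun [set: T] g ->
  measurable_fun [set: T] (fun x => l1 (f x) (g x)).
Proof.
by move=> mf mg; exact: (measurableT_comp ml1 (measurable_fun_pair mf mg)).
Qed.

Let mkpow : measurable_fun [set: TU * TG] kpow.
Proof.
apply: mexp; apply: measurable_funM => //; apply: measurable_funB => //.
by apply: measurable_funD; apply: measurableT_comp.
Qed.

Lemma measurable_miss2_kernel s : measurable_fun [set: TU * TG] (kmiss2 s).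
Proof.
apply: (@measurable_fun_fubini_tonelli_F _ _ _ _ _ (N s)
  (fun q => (expR (theta * (gam2 - l2 q.1.1 (u q.1.1 + v q.1.2 + q.2))))%:E)) => //.
apply: mexp; apply: measurable_funM => //; apply: measurable_funB => //.
apply: ml2c; first by apply: (measurableT_comp measurable_fst).
apply: measurable_funD => //; apply: measurable_funD.
- by apply: (measurableT_comp mu); apply: (measurableT_comp measurable_fst).
- by apply: (measurableT_comp mv); apply: (measurableT_comp measurable_snd).
Qed.

Let mkmiss1 : measurable_fun [set: TG] kmiss1.
Proof.
apply: (@measurable_fun_fubini_tonelli_F _ _ _ _ _ N1
  (fun q => (expR (theta * (gam1 - l1 q.1 (v q.1 + q.2))))%:E)) => //.
apply: mexp; apply: measurable_funM => //; apply: measurable_funB => //.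
apply: ml1c => //; apply: measurable_funD => //.
exact: measurableT_comp.
Qed.

Let mkhit2 s : measurable_fun [set: TU * (TU * TG)] (khit2 s).
Proof.
apply: (@measurable_fun_fubini_tonelli_F _ _ _ _ _ (N s)
  (fun q => (expR (l2 q.1.1 (u q.1.2.1 + v q.1.2.2 + q.2) - gam2))%:E)) => //.
apply: mexp; apply: measurable_funB => //.
apply: ml2c; first by apply: (measurableT_comp measurable_fst).
have m12 : measurable_fun [set: TU * (TU * TG) * R] (fun q => q.1.2).
  by apply: (measurableT_comp measurable_snd).
apply: measurable_funD => //; apply: measurable_funD.
- by apply: (measurableT_comp mu); apply: (measurableT_comp measurable_fst).
- by apply: (measurableT_comp mv); apply: (measurableT_comp measurable_snd).
Qed.

Let mkhit1 : measurable_fun [set: TG * TG] khit1.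
Proof.
apply: (@measurable_fun_fubini_tonelli_F _ _ _ _ _ N1
  (fun q => (expR (l1 q.1.2 (v q.1.1 + q.2) - gam1))%:E)) => //.
apply: mexp; apply: measurable_funB => //.
apply: ml1c; first by apply: (measurableT_comp measurable_snd).
apply: measurable_funD => //.
by apply: (measurableT_comp mv); apply: (measurableT_comp measurable_fst).
Qed.

Let kpow0 p : 0 <= kpow p. Proof. exact: expE0. Qed.
Let kmiss20 s p : 0 <= kmiss2 s p. Proof. exact: integral_ge0. Qed.
Let kmiss10 p : 0 <= kmiss1 p. Proof. exact: integral_ge0. Qed.
Let khit20 s p : 0 <= khit2 s p. Proof. exact: integral_ge0. Qed.
Let khit10 p : 0 <= khit1 p. Proof. exact: integral_ge0. Qed.

(** The wrong centre [x'] is independent of the output. By Tonelli its integral is taken first, and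
    [l2_le1] bounds it for each fixed output, so the output law never enters. *)
Let hit2_le s x : \int[PU]_x' \int[PG]_y khit2 s (x', (x, y)) <= (expR (- gam2))%:E.
Proof.
have mk : measurable_fun [set: TU * TG] (fun q => khit2 s (q.1, (x, q.2))).
  apply: (measurableT_comp (mkhit2 s)); apply: measurable_fun_pair => //.
  exact: measurable_fun_pair.
rewrite (fubini_tonelli (fun q => khit2 s (q.1, (x, q.2))))//=.
rewrite -[leRHS]mule1 -(@probability_setT _ _ _ PG) -integral_cst//.
have mG := measurable_fun_fubini_tonelli_G (m1 := PU) _ mk (fun=> khit20 _ _).
apply: ge0_le_integral => //.
- by move=> y _; exact: integral_ge0.
move=> y _; rewrite /hit2_kernel/=.
have ml : measurable_fun [set: TU * R]
    (fun q => (expR (l2 q.1 (u x + v y + q.2) - gam2))%:E).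
  apply: mexp; apply: measurable_funB => //; apply: ml2c => //.
  exact: measurable_funD.
rewrite (fubini_tonelli (m2 := N s)
  (fun q => (expR (l2 q.1 (u x + v y + q.2) - gam2))%:E))//=.
rewrite -[leRHS]mule1 -(@probability_setT _ _ _ (N s)) -integral_cst//.
have mGz := measurable_fun_fubini_tonelli_G (m1 := PU) _ ml (fun=> expE0 _).
apply: ge0_le_integral => //.
- by move=> z _; exact: integral_ge0.
move=> z _; under eq_integral do rewrite expRD EFinM muleC.
rewrite ge0_integralZl//; last first.
  apply: mexp; apply: ml2c => //.
rewrite -[leRHS]mule1 lee_wpmul2l//.
Qed.

Let hit1_le : \int[PG]_y \int[PG]_y' khit1 (y, y') <= (expR (- gam1))%:E.
Proof.
rewrite -[leRHS]mule1 -(@probability_setT _ _ _ PG) -integral_cst//.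
apply: ge0_le_integral => //.
- by move=> y _; exact: integral_ge0.
- exact: (measurable_fun_fubini_tonelli_F khit1).
move=> y _; rewrite /hit1_kernel/=.
have ml : measurable_fun [set: TG * R]
    (fun q => (expR (l1 q.1 (v y + q.2) - gam1))%:E).
  apply: mexp; apply: measurable_funB => //; apply: ml1c => //.
  exact: measurable_funD.
rewrite (fubini_tonelli (m2 := N1)
  (fun q => (expR (l1 q.1 (v y + q.2) - gam1))%:E))//=.
rewrite -[leRHS]mule1 -(@probability_setT _ _ _ N1) -integral_cst//.
have mGz := measurable_fun_fubini_tonelli_G (m1 := PG) _ ml (fun=> expE0 _).
apply: ge0_le_integral => //.
- by move=> z _; exact: integral_ge0.
move=> z _; under eq_integral do rewrite expRD EFinM muleC.
rewrite ge0_integralZl//; last first.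
  apply: mexp; apply: ml1c => //.
rewrite -[leRHS]mule1 lee_wpmul2l//.
Qed.

Let integral2D (d d' : measure_display) (T : measurableType d)
    (G : measurableType d') (P : probability T R) (Q : probability G R)
    (f g : T * G -> \bar R) :
  measurable_fun [set: T * G] f -> measurable_fun [set: T * G] g ->
  (forall p, 0 <= f p) -> (forall p, 0 <= g p) ->
  \int[P]_x \int[Q]_y (f (x, y) + g (x, y)) =
  \int[P]_x \int[Q]_y f (x, y) + \int[P]_x \int[Q]_y g (x, y).
Proof.
move=> mf mg f0 g0.
rewrite -(fubini_tonelli1 (m1 := P) (m2 := Q) (fun p => f p + g p))//; last 2 first.
- exact: emeasurable_funD.
- by move=> p; exact: adde_ge0.
by rewrite ge0_integralD// !fubini_tonelli1.
Qed.

(** In [B] the power term counts twice because both users pay for it, and the wrong-cloud term twice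
    because it is tested under both noises; wrong satellites concern user 1 only. *)
Lemma exists_code_average_error (n M1 M2 : nat) (c0 d1 d2 d3 : R) :
  (0 < M1)%N -> (0 < M2)%N ->
  \int[PU]_x \int[PG]_y kpow (x, y) <= c0%:E ->
  \int[PU]_x \int[PG]_y kmiss2 sigma1 (x, y) <= d1%:E ->
  \int[PU]_x \int[PG]_y kmiss2 sigma2 (x, y) <= d2%:E ->
  \int[PG]_y kmiss1 y <= d3%:E ->
  let B := (c0 ^+ n *+ 2 + d1 ^+ n + d2 ^+ n + d3 ^+ n +
    expR (- gam2) ^+ n *+ 2 *+ M2.-1 + expR (- gam1) ^+ n *+ M1.-1)%R in
  exists c : bc_code R n M1 M2, [/\ admissible_code E c,
    (error_prob1 sigma1 c <= B)%R & (error_prob2 sigma2 c <= B)%R].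
Proof.
move=> M10 M20 H0 H1 H2 H3 B.
pose K1 : n.-tuple TU * n.-tuple TG -> \bar R := fun p =>
  \prod_(i < n) kpow (tnth p.1 i, tnth p.2 i).
pose K2 s : n.-tuple TU * n.-tuple TG -> \bar R := fun p =>
  \prod_(i < n) kmiss2 s (tnth p.1 i, tnth p.2 i).
pose K3 : n.-tuple TU * n.-tuple TG -> \bar R := fun p =>
  \prod_(i < n) kmiss1 (tnth p.2 i).
pose K4 s : n.-tuple TU * (n.-tuple TU * n.-tuple TG) -> \bar R := fun p =>
  \prod_(i < n) khit2 s (tnth p.1 i, (tnth p.2.1 i, tnth p.2.2 i)).
pose K5 : n.-tuple TG * n.-tuple TG -> \bar R := fun p =>
  \prod_(i < n) khit1 (tnth p.1 i, tnth p.2 i).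
have mK1 : measurable_fun [set: n.-tuple TU * n.-tuple TG] K1.
  exact: (emeasurable_prod_tnth2 mkpow).
have mK2 s : measurable_fun [set: n.-tuple TU * n.-tuple TG] (K2 s).
  exact: (emeasurable_prod_tnth2 (measurable_miss2_kernel s)).
have mK3 : measurable_fun [set: n.-tuple TU * n.-tuple TG] K3.
  apply: emeasurable_prod => i; apply: (measurableT_comp mkmiss1).
  by apply: (measurableT_comp (measurable_tnth i)).
have mK4 s : measurable_fun [set: n.-tuple TU * (n.-tuple TU * n.-tuple TG)] (K4 s).
  apply: emeasurable_prod => i; apply: (measurableT_comp (mkhit2 s)).
  apply: (@measurable_fun_pair _ _ _ _ _ _
    (fun p : n.-tuple TU * (n.-tuple TU * n.-tuple TG) => tnth p.1 i)
    (fun p => (tnth p.2.1 i, tnth p.2.2 i))).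
    by apply: (measurableT_comp (measurable_tnth i)).
  apply: (@measurable_fun_pair _ _ _ _ _ _
    (fun p : n.-tuple TU * (n.-tuple TU * n.-tuple TG) => tnth p.2.1 i)
    (fun p => tnth p.2.2 i)).
  - apply: (measurableT_comp (measurable_tnth i)).
    by apply: (measurableT_comp measurable_fst).
  - apply: (measurableT_comp (measurable_tnth i)).
    by apply: (measurableT_comp measurable_snd).
have mK5 : measurable_fun [set: n.-tuple TG * n.-tuple TG] K5.
  exact: (emeasurable_prod_tnth2 mkhit1).
have K10 p : 0 <= K1 p by apply: prode_ge0 => i _; exact: kpow0.
have K20 s p : 0 <= K2 s p by apply: prode_ge0 => i _; exact: kmiss20.
have K30 p : 0 <= K3 p by apply: prode_ge0 => i _; exact: kmiss10.
have K40 s p : 0 <= K4 s p by apply: prode_ge0 => i _; exact: khit20.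
have K50 p : 0 <= K5 p by apply: prode_ge0 => i _; exact: khit10.
have I1 : \int[iid PU n]_x \int[iid PG n]_y K1 (x, y) <= (c0 ^+ n)%:E.
  rewrite (integral_iid_prod2 PU PG n mkpow kpow0); apply: prode_le_exprn H0.
  by apply: integral_ge0 => x _; apply: integral_ge0 => y _; exact: kpow0.
have I2 s d : \int[PU]_x \int[PG]_y kmiss2 s (x, y) <= d%:E ->
    \int[iid PU n]_x \int[iid PG n]_y K2 s (x, y) <= (d ^+ n)%:E.
  move=> Hd.
  rewrite (integral_iid_prod2 PU PG n (measurable_miss2_kernel s) (kmiss20 s)).
  apply: prode_le_exprn Hd.
  by apply: integral_ge0 => x _; apply: integral_ge0 => y _; exact: kmiss20.
have I3 : \int[iid PU n]_x \int[iid PG n]_y K3 (x, y) <= (d3 ^+ n)%:E.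
  have IK x : \int[iid PG n]_y K3 (x, y) = \prod_(i < n) \int[PG]_y kmiss1 y.
    exact: (integral_iid_prod PG (f := fun _ y => kmiss1 y) (fun=> mkmiss1) (fun=> kmiss10)).
  under eq_integral do rewrite IK.
  rewrite integral_cst//.
  rewrite [X in _ * X](_ : _ = 1); last exact: probability_setT.
  rewrite mule1; apply: prode_le_exprn H3.
  by apply: integral_ge0 => y _; exact: kmiss10.
have I4 s : measurable_fun [set: n.-tuple TU * n.-tuple TU]
    (fun p => \int[iid PG n]_y K4 s (p.2, (p.1, y))) /\
    \int[iid PU n]_x \int[iid PU n]_x' \int[iid PG n]_y K4 s (x', (x, y)) <=
    (expR (- gam2) ^+ n)%:E.
  pose H (q : TU * TU) := \int[PG]_y khit2 s (q.2, (q.1, y)).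
  have mH : measurable_fun [set: TU * TU] H.
    have mk : measurable_fun [set: (TU * TU) * TG]
        (fun p => khit2 s (p.1.2, (p.1.1, p.2))).
      apply: (measurableT_comp (mkhit2 s)); apply: measurable_fun_pair.
        by apply: (measurableT_comp measurable_snd).
      by apply: measurable_fun_pair => //; apply: (measurableT_comp measurable_fst).
    exact: (measurable_fun_fubini_tonelli_F (m2 := PG) _ mk (fun p => khit20 s _)).
  have H0' q : 0 <= H q by apply: integral_ge0 => y _; exact: khit20.
  have IH x x' : \int[iid PG n]_y K4 s (x', (x, y)) =
      \prod_(i < n) H (tnth x i, tnth x' i).
    apply: (integral_iid_prod PG
      (f := fun i y => khit2 s (tnth x' i, (tnth x i, y)))) => i; last first.
      by move=> y; exact: khit20.
    apply: (measurableT_comp (mkhit2 s)); apply: measurable_fun_pair => //.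
  split.
    under eq_fun do rewrite IH; exact: (emeasurable_prod_tnth2 mH).
  under eq_integral do under eq_integral do rewrite IH.
  rewrite (integral_iid_prod2 PU PU n mH H0'); apply: prode_le_exprn.
    by apply: integral_ge0 => x _; apply: integral_ge0 => x' _; exact: H0'.
  rewrite -[leRHS]mule1 -(@probability_setT _ _ _ PU) -integral_cst//.
  apply: ge0_le_integral => //.
  - by move=> x _; apply: integral_ge0 => x' _; exact: H0'.
  - exact: (measurable_fun_fubini_tonelli_F H).
  - by move=> x _; exact: hit2_le.
have I5 : \int[iid PG n]_y \int[iid PG n]_y' K5 (y, y') <= (expR (- gam1) ^+ n)%:E.
  rewrite (integral_iid_prod2 PG PG n mkhit1 khit10); apply: prode_le_exprn hit1_le.
  by apply: integral_ge0 => x _; apply: integral_ge0 => y _; exact: khit10.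
pose e1 (c : bc_code R n M1 M2) m1 m2 :=
  iid N1 n [set z | decoder1 c (add_noise (encoder c m1 m2) z) != m1].
pose e2 (c : bc_code R n M1 M2) m1 m2 :=
  iid (N sigma2) n [set z | decoder2 c (add_noise (encoder c m1 m2) z) != m2].
have err t g : exists2 c : bc_code R n M1 M2, admissible_code E c &
    forall m1 m2, e1 c m1 m2 + e2 c m1 m2 <=
    K1 (t m2, g m2 m1) + K1 (t m2, g m2 m1) + K2 sigma1 (t m2, g m2 m1) +
    K2 sigma2 (t m2, g m2 m1) + K3 (t m2, g m2 m1) +
    \sum_(k < M2 | k != m2) (K4 sigma1 (t k, (t m2, g m2 m1)) +
      K4 sigma2 (t k, (t m2, g m2 m1))) +
    \sum_(k < M1 | k != m1) K5 (g m2 m1, g m2 k).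
  exact: (codebook_error sigma1 sigma2 gam1 gam2 E_ge0 theta_ge0 u_ge0 v_ge0 ml2 ml1
    t g (Ordinal M10) (Ordinal M20)).
have {}I21 := I2 _ _ H1; have {I2}I22 := I2 _ _ H2.
clearbody K1 K2 K3 K4 K5.
pose a p := K1 p + K1 p + K2 sigma1 p + K2 sigma2 p + K3 p.
pose b2 p := K4 sigma1 p + K4 sigma2 p.
have ma1 := emeasurable_funD mK1 mK1.
have ma2 := emeasurable_funD ma1 (mK2 sigma1).
have ma3 := emeasurable_funD ma2 (mK2 sigma2).
have ma : measurable_fun [set: n.-tuple TU * n.-tuple TG] a.
  exact: (emeasurable_funD ma3 mK3).
have mb2 : measurable_fun [set: n.-tuple TU * (n.-tuple TU * n.-tuple TG)] b2.
  exact: (emeasurable_funD (mK4 sigma1) (mK4 sigma2)).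
have a0 p : 0 <= a p by rewrite /a !adde_ge0.
have b20 p : 0 <= b2 p by rewrite /b2 adde_ge0.
have [t [g tg]] := exists_superposition_le_integral (iid PU n) (iid PG n)
  M1 M2 ma a0 mb2 b20 mK5 K50.
have Ia : \int[iid PU n]_x \int[iid PG n]_y a (x, y) <=
    (c0 ^+ n *+ 2 + d1 ^+ n + d2 ^+ n + d3 ^+ n)%:E.
  rewrite (integral2D _ _ ma3 mK3)//; last by move=> p; rewrite !adde_ge0.
  rewrite (integral2D _ _ ma2 (mK2 sigma2))//; last by move=> p; rewrite !adde_ge0.
  rewrite (integral2D _ _ ma1 (mK2 sigma1))//; last by move=> p; rewrite !adde_ge0.
  rewrite (integral2D _ _ mK1 mK1)// mulr2n !EFinD.
  exact: (leeD (leeD (leeD (leeD I1 I1) I21) I22) I3).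
have Ib2 : \int[iid PU n]_x \int[iid PU n]_x' \int[iid PG n]_y b2 (x', (x, y)) <=
    (expR (- gam2) ^+ n *+ 2)%:E.
  have mK4y s x x' : measurable_fun [set: n.-tuple TG] (fun y => K4 s (x', (x, y))).
    by apply: (measurableT_comp (mK4 s)); apply: measurable_fun_pair.
  under eq_integral.
    move=> x _; under eq_integral.
      move=> x' _; rewrite /b2 ge0_integralD//; over.
    over.
  rewrite (integral2D (iid PU n) (iid PU n) (I4 sigma1).1 (I4 sigma2).1); last 2 first.
  - by move=> p; exact: integral_ge0.
  - by move=> p; exact: integral_ge0.
  by rewrite mulr2n EFinD; exact: (leeD (I4 sigma1).2 (I4 sigma2).2).
have [c adm {}err] := err t g.
have tot : \sum_(m2 < M2) \sum_(m1 < M1) (e1 c m1 m2 + e2 c m1 m2) <= (B *+ (M1 * M2))%:E.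
  apply: (@le_trans _ _ (\sum_(j < M2) \sum_(i < M1)
      (a (t j, g j i) + \sum_(k < M2 | k != j) b2 (t k, (t j, g j i)) +
       \sum_(k < M1 | k != i) K5 (g j i, g j k)))).
    by apply: lee_sum => j _; apply: lee_sum => i _; exact: err.
  apply: (le_trans tg); rewrite EFin_natmul -[leLHS]mule_natl -[leRHS]mule_natl.
  apply: lee_wpmul2l; first by rewrite lee_fin.
  rewrite /B 2!EFinD; apply: leeD; first apply: leeD.
  - exact: Ia.
  - rewrite EFin_natmul -[leLHS]mule_natl -[leRHS]mule_natl.
    by apply: lee_wpmul2l; [rewrite lee_fin|exact: Ib2].
  - rewrite EFin_natmul -[leLHS]mule_natl -[leRHS]mule_natl.
    by apply: lee_wpmul2l; [rewrite lee_fin|exact: I5].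
have e10 m1 m2 : 0 <= e1 c m1 m2 by exact: measure_ge0.
have e20 m1 m2 : 0 <= e2 c m1 m2 by exact: measure_ge0.
(* The bound on the total also shows that each error probability is finite, so that [fine] loses
   nothing. *)
have avg (e : 'I_M1 -> 'I_M2 -> \bar R) : (forall m1 m2, 0 <= e m1 m2) ->
    (forall m1 m2, e m1 m2 <= e1 c m1 m2 + e2 c m1 m2) ->
    ((M1 * M2)%:R^-1 * \sum_(m1 < M1) \sum_(m2 < M2) fine (e m1 m2) <= B)%R.
  move=> e0 ele.
  have ltot : \sum_(m2 < M2) \sum_(m1 < M1) e m1 m2 <= (B *+ (M1 * M2))%:E.
    by apply: le_trans tot; apply: lee_sum => j _; apply: lee_sum => i _.
  have efin m1 m2 : e m1 m2 \is a fin_num.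
    rewrite ge0_fin_numE// (le_lt_trans _ (ltry (B *+ (M1 * M2))%R))//.
    apply: le_trans ltot; rewrite (bigD1 m2)//= (bigD1 m1)//= -addeA leeDl//.
    by rewrite adde_ge0// sume_ge0// => *; exact: sume_ge0.
  have MM : (0 < (M1 * M2)%:R :> R)%R by rewrite ltr0n muln_gt0 M10.
  rewrite mulrC ler_pdivrMr// mulr_natr -lee_fin exchange_big/=.
  rewrite -sumEFin; under eq_bigr do rewrite -sumEFin.
  apply: le_trans ltot; rewrite le_eqVlt; apply/orP; left; apply/eqP.
  by apply: eq_bigr => j _; apply: eq_bigr => i _; rewrite fineK.
exists c; split => //.
- by apply: avg => // m1 m2; rewrite leeDl.
- by apply: avg => // m1 m2; rewrite leeDr.
Qed.

End code_existence.

(** * From one-letter exponents to achievable pairs *)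

Section achievability.
Context (R : realType).

Lemma near_exprn_le (q e : R) : 0 <= q -> q < 1 -> 0 < e ->
  \forall n \near \oo, q ^+ n <= e.
Proof.
move=> q0 q1 e0; have /cvgr0Pnorm_le/(_ e e0) : q ^+ n @[n --> \oo] --> (0 : R).
  by apply: cvg_expr; rewrite ger0_norm.
by apply: filterS => n; apply: le_trans; exact: ler_norm.
Qed.

(** At rate 0 a single message suffices: there is no wrong codeword, and [gam] may be anything, even
    negative. Otherwise the number of messages is the integer part of exp(n r) plus one, so at most
    exp(n r) of them are wrong, and [q] is exp(r - gam). *)
Lemma exists_message_number (r gam : R) : 0 <= r -> r = 0 \/ r < gam ->
  exists (M : nat -> nat) (q : R), [/\ 0 <= q, q < 1 & forall n,
    [/\ (0 < M n)%N, expR (n%:R * r) <= (M n)%:R &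
        expR (- gam) ^+ n *+ (M n).-1 <= q ^+ n]].
Proof.
move=> r0 [->|rg].
  exists (fun=> 1%N), 0; split => // n; split => //.
  by rewrite mulr0 expR0.
  by rewrite mulr0n exprn_ge0.
exists (fun n => (Num.truncn (expR (n%:R * r))).+1), (expR (r - gam)); split.
- exact: expR_ge0.
- by rewrite expR_lt1 subr_lt0.
move=> n; split => //; first by rewrite ltW// truncnS_gt.
rewrite -mulr_natr /= -!expRM_natl.
apply: (@le_trans _ _ (expR (n%:R * - gam) * expR (n%:R * r))).
  by apply: ler_wpM2l; [exact: expR_ge0|rewrite truncn_le expR_ge0].
by rewrite -expRD -mulrDr addrC.
Qed.

Context (dU dG : measure_display).
Context (TU : measurableType dU) (TG : measurableType dG).

Lemma achievable_of_exponents (PU : probability TU R) (PG : probability TG R)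
    (sigma1 sigma2 E theta gam1 gam2 r1 r2 : R) (u : TU -> R) (v : TG -> R)
    (l2 : TU -> R -> R) (l1 : TG -> R -> R) (c0 d1 d2 d3 : R) :
  0 <= E -> 0 <= theta -> (forall x, 0 <= u x) -> (forall x, 0 <= v x) ->
  measurable_fun [set: TU] u -> measurable_fun [set: TG] v ->
  measurable_fun [set: TU * R] (fun p => l2 p.1 p.2) ->
  measurable_fun [set: TG * R] (fun p => l1 p.1 p.2) ->
  (forall y, \int[PU]_x (expR (l2 x y))%:E <= 1)%E ->
  (forall y, \int[PG]_x (expR (l1 x y))%:E <= 1)%E ->
  (\int[PU]_x \int[PG]_y power_kernel E theta u v (x, y) <= c0%:E)%E ->
  (\int[PU]_x \int[PG]_y miss2_kernel theta gam2 u v l2 sigma1 (x, y) <= d1%:E)%E ->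
  (\int[PU]_x \int[PG]_y miss2_kernel theta gam2 u v l2 sigma2 (x, y) <= d2%:E)%E ->
  (\int[PG]_y miss1_kernel sigma1 theta gam1 v l1 y <= d3%:E)%E ->
  c0 < 1 -> d1 < 1 -> d2 < 1 -> d3 < 1 ->
  0 <= r1 -> r1 = 0 \/ r1 < gam1 -> 0 <= r2 -> r2 = 0 \/ r2 < gam2 ->
  achievable_pair sigma1 sigma2 E (r1, r2).
Proof.
move=> E0 th0 u0 v0 mu mv ml2 ml1 l2le l1le Hc0 Hd1 Hd2 Hd3 c01 d11 d21 d31.
move=> r10 /(exists_message_number r10) [N1 [q1 [q10 q11 Hq1]]].
move=> r20 /(exists_message_number r20) [N2 [q2 [q20 q21 Hq2]]].
have int2_ge0 (f : TU * TG -> \bar R) : (forall p, 0 <= f p)%E ->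
    (0 <= \int[PU]_x \int[PG]_y f (x, y))%E.
  by move=> f0; apply: integral_ge0 => x _; exact: integral_ge0.
have expE0 (r : R) : (0 <= (expR r)%:E)%E by rewrite lee_fin expR_ge0.
have c00 : 0 <= c0.
  by rewrite -lee_fin (le_trans _ Hc0)// int2_ge0// => p; exact: expE0.
have d10 : 0 <= d1.
  by rewrite -lee_fin (le_trans _ Hd1)// int2_ge0// => p; exact: integral_ge0.
have d20 : 0 <= d2.
  by rewrite -lee_fin (le_trans _ Hd2)// int2_ge0// => p; exact: integral_ge0.
have d30 : 0 <= d3.
  rewrite -lee_fin (le_trans _ Hd3)// integral_ge0// => p _; exact: integral_ge0.
split => //= eps eps0.
(* The error bound has eight terms, counted with multiplicity. *)
pose e := eps / 8.
have e0 : 0 < e by rewrite divr_gt0.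
near=> n.
have nc0 : c0 ^+ n <= e by near: n; exact: near_exprn_le.
have nd1 : d1 ^+ n <= e by near: n; exact: near_exprn_le.
have nd2 : d2 ^+ n <= e by near: n; exact: near_exprn_le.
have nd3 : d3 ^+ n <= e by near: n; exact: near_exprn_le.
have nq1 : q1 ^+ n <= e by near: n; exact: near_exprn_le.
have nq2 : q2 ^+ n <= e by near: n; exact: near_exprn_le.
have [M1 L1 B1] := Hq1 n; have [M2 L2 B2] := Hq2 n.
have [c [adm err1 err2]] := exists_code_average_error E0 th0 u0 v0 mu mv ml2 ml1
  l2le l1le n M1 M2 Hc0 Hd1 Hd2 Hd3.
exists (N1 n), (N2 n), c.
suff Be : c0 ^+ n *+ 2 + d1 ^+ n + d2 ^+ n + d3 ^+ n +
    expR (- gam2) ^+ n *+ 2 *+ (N2 n).-1 + expR (- gam1) ^+ n *+ (N1 n).-1 <= eps.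
  by split => //; [exact: le_trans err1 Be|exact: le_trans err2 Be].
rewrite mulrnAC.
have -> : eps = e *+ 2 + e + e + e + e *+ 2 + e by rewrite /e; lra.
do !apply: lerD => //;
  first [exact: (le_trans B2 nq2) | exact: (le_trans B1 nq1)].
Unshelve. all: by end_near. Qed.

End achievability.

(** * Gaussian and exponential laws *)

Section normal_law.
Context (R : realType).
Local Notation leb := (@lebesgue_measure R).
Local Notation N := (normal_prob 0).
Local Notation phi s := (normal_pdf (0 : R) s).

Lemma normal_pdf_expE (m s x : R) : s != 0 ->
  normal_pdf m s x = normal_peak s * expR (- (x - m) ^+ 2 / (s ^+ 2 *+ 2)).
Proof. by move=> s0; rewrite normal_pdfE. Qed.

Lemma normal_pdf_gt0 (m s x : R) : s != 0 -> 0 < normal_pdf m s x.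
Proof.
by move=> s0; rewrite normal_pdf_expE// mulr_gt0 ?expR_gt0// normal_peak_gt0.
Qed.

Lemma normal_peakE (s : R) : 0 < s ->
  normal_peak s = s^-1 * (Num.sqrt (2 * pi))^-1.
Proof.
move=> s0; rewrite /normal_peak -mulrnAr sqrtrM ?sqr_ge0// sqrtr_sqr.
by rewrite gtr0_norm// invfM -[pi *+ 2]mulr_natl.
Qed.

Lemma integral_normal_prob (s : R) (f : R -> \bar R) :
  measurable_fun [set: R] f -> (forall x, 0 <= f x)%E ->
  (\int[N s]_x f x = \int[leb]_x (f x * (phi s x)%:E))%E.
Proof.
move=> mf f0; apply: ge0_integral_density => //.
- exact: measurable_normal_pdf.
- exact: normal_pdf_ge0.
Qed.

(** Completing the square: the tilted density is a constant times the normal density of standard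
    deviation [s / q] and mean [t * s' ^+ 2]. *)
Lemma integral_normal_expR_quad (s k t : R) : 0 < s -> 2 * k * s ^+ 2 < 1 ->
  (\int[N s]_z (expR (k * z ^+ 2 + t * z))%:E =
   ((Num.sqrt (1 - 2 * k * s ^+ 2))^-1 *
    expR (t ^+ 2 * s ^+ 2 / (2 * (1 - 2 * k * s ^+ 2))))%:E)%E.
Proof.
move=> s0 ks; have q0 : 0 < 1 - 2 * k * s ^+ 2 by rewrite subr_gt0.
set q := Num.sqrt _; have q_gt0 : 0 < q by rewrite sqrtr_gt0.
have qE : q ^+ 2 = 1 - 2 * k * s ^+ 2 by rewrite sqr_sqrtr// ltW.
rewrite -qE; clearbody q.
pose s' := s / q; pose m' := t * s' ^+ 2.
have s'0 : 0 < s' by rewrite divr_gt0.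
have mquad : measurable_fun [set: R] (fun z => expR (k * z ^+ 2 + t * z)).
  apply: measurableT_comp => //; apply: measurable_funD; apply: measurable_funM => //.
rewrite integral_normal_prob//; last exact/measurable_EFinP.
set C := (q^-1 * _)%R.
have C0 : 0 <= C by rewrite mulr_ge0 ?expR_ge0// invr_ge0 ltW.
under eq_integral => z _.
  rewrite -EFinM (_ : (_ * _)%R = C * normal_pdf m' s' z); last first.
    rewrite !normal_pdf_expE ?gt_eqF// !normal_peakE// /C.
    rewrite [LHS]mulrCA -expRD.
    rewrite [RHS](_ : _ = s^-1 * (Num.sqrt (2 * pi))^-1 *
       (expR (t ^+ 2 * s ^+ 2 / (2 * q ^+ 2)) * expR (- (z - m') ^+ 2 / (s' ^+ 2 *+ 2)))).
      rewrite -expRD; congr (_ * expR _).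
      have kE : k = (1 - q ^+ 2) / (2 * s ^+ 2).
        by rewrite qE; field; rewrite gt_eqF.
      rewrite kE /m' /s'; field.
      by rewrite !gt_eqF.
    rewrite /s' invf_div; set a := expR _; set b := expR _; field.
    by rewrite !gt_eqF// sqrtr_gt0 mulr_gt0// pi_gt0.
  rewrite EFinM; over.
rewrite ge0_integralZl//.
- by rewrite integral_normal_pdf mule1.
- by apply/measurable_EFinP; exact: measurable_normal_pdf.
- by move=> z _; rewrite lee_fin normal_pdf_ge0.
Qed.

(** The fundamental theorem of calculus on growing intervals. Bounding the oscillation of [F]
    replaces the computation of its limits at infinity, at the price of an inequality. *)
Lemma integral_le_of_derive (f F : R -> R) (c : R) :
  (forall x : R, is_derive x 1 F (f x)) -> (forall x, 0 <= f x) -> continuous f ->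
  (forall x y, F x - F y <= c) ->
  (\int[leb]_x (f x)%:E <= c%:E)%E.
Proof.
move=> dF f0 cf Fc.
pose A n := `[- n.+1%:R, n.+1%:R]%classic : set R.
have UA : \bigcup_n A n = setT.
  apply/seteqP; split => // x _; exists (Num.truncn `|x|) => //=.
  by rewrite /A/= in_itv/= -ler_norml ltW// truncnS_gt.
have mf : measurable_fun [set: R] (EFin \o f).
  by apply/measurable_EFinP; exact: continuous_measurable_fun.
have : (\int[leb]_(x in A i) (f x)%:E @[i --> \oo] --> \int[leb]_x (f x)%:E)%E.
  rewrite -UA; apply: ge0_nondecreasing_set_cvg_integral.
  - apply/nondecreasing_seqP => n; apply/subsetPset => x /=.
    rewrite /A/= !in_itv/= => /andP[x1 x2]; apply/andP; split.
      by apply: le_trans x1; rewrite lerN2 ler_nat.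
    by apply: (le_trans x2); rewrite ler_nat.
  - by move=> n; exact: measurable_itv.
  - by move=> n; exact: measurable_funTS.
  - by move=> n x _; rewrite lee_fin.
move=> /cvg_lim <- //; apply: lime_le.
  apply: ereal_nondecreasing_is_cvgn.
  apply: ge0_nondecreasing_set_nondecreasing_integral.
  - apply/nondecreasing_seqP => n; apply/subsetPset => x /=.
    rewrite /A/= !in_itv/= => /andP[x1 x2]; apply/andP; split.
      by apply: le_trans x1; rewrite lerN2 ler_nat.
    by apply: (le_trans x2); rewrite ler_nat.
  - by move=> n; exact: measurable_itv.
  - by move=> n; exact: measurable_funTS.
  - by move=> n x _; rewrite lee_fin.
apply: nearW => n.
have cF : continuous F.
  by move=> x; apply/differentiable_continuous/derivable1_diffP; case: (dF x).
rewrite (@continuous_FTC2 _ f F)//.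
- by rewrite -EFinB lee_fin.
- by rewrite gtrN// ltr0n.
- exact: continuous_subspaceT.
- split.
  + by move=> x _; case: (dF x).
  + exact/cvg_at_right_filter/cF.
  + exact/cvg_at_left_filter/cF.
- by move=> x _; rewrite derive1E; apply: derive_val.
Qed.

Definition Phi (x : R) : R := (\int[leb]_(t in `]-oo, x]) (phi 1 t))%R.

Lemma is_derive_Phi (x : R) : is_derive x 1 Phi (phi 1 x).
Proof.
have xx1 : x < x + 1 by rewrite ltrDl.
have iphi : leb.-integrable [set` Interval -oo%O (BRight (x + 1))]
    (EFin \o phi 1).
  by apply: integrableS (integrable_normal_pdf 0 1) => //=.
have cphi : {for x, continuous (phi 1)}.
  by apply: continuous_normal_pdf; rewrite oner_eq0.
have [] := continuous_FTC1 xx1 iphi (ltNyr _) cphi.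
move=> dP PE; apply: DeriveDef; first exact: dP.
by rewrite -derive1E.
Qed.

Lemma continuous_Phi : continuous Phi.
Proof.
move=> x; apply/differentiable_continuous/derivable1_diffP.
by case: (is_derive_Phi x).
Qed.

Lemma Phi_ge0 x : 0 <= Phi x.
Proof. by apply: Rintegral_ge0 => t _; exact: normal_pdf_ge0. Qed.

Lemma Phi_le1 x : Phi x <= 1.
Proof.
rewrite -lee_fin /Phi /Rintegral fineK; last first.
  apply: integrable_fin_num => //.
  by apply: integrableS (integrable_normal_pdf 0 1) => //=.
rewrite -(integral_normal_pdf 0 1); apply: ge0_subset_integral => //.
- by apply/measurable_EFinP; apply: measurable_funTS; exact: measurable_normal_pdf.
- by move=> t _; rewrite lee_fin normal_pdf_ge0.
Qed.

Lemma Phi_gt0 x : 0 < Phi x.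
Proof.
have xx1 : x - 1 < x by rewrite ltrBlDr ltrDl.
have [c _ E] := MVT xx1 (fun y _ => is_derive_Phi y)
  (continuous_subspaceT continuous_Phi).
rewrite -(subrK (Phi (x - 1)) (Phi x)) ltr_wpDr ?Phi_ge0// E mulr_gt0//.
- by rewrite normal_pdf_gt0 ?oner_eq0.
- by rewrite subr_gt0.
Qed.

End normal_law.

(** * Decoding metrics *)

Section exponential_variable.
Context (R : realType).
Local Notation leb := (@lebesgue_measure R).
Local Notation N := (normal_prob 0).
Local Notation phi := (normal_pdf (0 : R) 1).

(* If [g] is a standard normal variable then [- lnw g] is exponentially
   distributed with mean one. *)
Definition lnw (g : R) : R := ln (Phi (- g)).

Lemma phi_expE (x : R) : phi x = (Num.sqrt (2 * pi))^-1 * expR (- x ^+ 2 / 2).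
Proof.
rewrite normal_pdf_expE ?oner_eq0// normal_peakE// invr1 mul1r subr0.
by rewrite expr1n.
Qed.

Lemma is_derive_lnw (x : R) : is_derive x 1 lnw (- (phi x / Phi (- x))).
Proof.
have h1 : is_derive (- x) 1 (@Phi R) (phi x).
  by have := is_derive_Phi (- x); rewrite !phi_expE sqrrN.
have h2 : is_derive x 1 (fun y => Phi (- y)) (- phi x).
  by rewrite -mulrN1; apply: is_derive1_comp.
have h3 := is_derive1_ln (Phi_gt0 (- x)).
have := @is_derive1_comp _ (@ln R) (fun y => Phi (- y)) _ _ _ h3 h2.
by rewrite mulrN mulrC.
Qed.

Lemma continuous_lnw : continuous lnw.
Proof.
move=> x; apply/differentiable_continuous/derivable1_diffP.
by case: (is_derive_lnw x).
Qed.

Lemma lnw_le0 x : lnw x <= 0. Proof. by rewrite ln_le0// Phi_le1. Qed.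

Lemma expR_lnw x : expR (lnw x) = Phi (- x).
Proof. by rewrite lnK// posrE Phi_gt0. Qed.

Lemma measurable_lnw : measurable_fun [set: R] lnw.
Proof. by apply: continuous_measurable_fun; exact: continuous_lnw. Qed.

(** Moment generating function of an exponential variable in terms of its normal seed: Phi(-g)^k
    phi(g) is the derivative of - Phi(-g)^(1+k) / (1+k), whose values lie between - 1 / (1+k) and
    0. *)
Lemma integral_expR_lnw_le (k : R) : -1 < k ->
  (\int[N 1]_g (expR (k * lnw g))%:E <= ((1 + k)^-1)%:E)%E.
Proof.
move=> k1; have k10 : 0 < 1 + k by rewrite -ltrBlDl sub0r.
have mk : measurable_fun [set: R] (fun g => expR (k * lnw g)).
  apply: measurableT_comp => //; apply: measurable_funM => //.
  exact: measurable_lnw.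
rewrite integral_normal_prob//; last exact/measurable_EFinP.
under eq_integral do rewrite -EFinM.
apply: (@integral_le_of_derive R (fun g => expR (k * lnw g) * phi g)
  (fun g => - (1 + k)^-1 * expR ((1 + k) * lnw g)) (1 + k)^-1).
- move=> x; have h1 := is_derive_lnw x.
  have -> : expR (k * lnw x) * phi x =
      - (1 + k)^-1 * (expR ((1 + k) * lnw x) * ((1 + k) * - (phi x / Phi (- x)))).
    rewrite mulrDl mul1r expRD expR_lnw; have := Phi_gt0 (- x).
    set p := Phi _; set e := expR _; move=> p0; field.
    by rewrite !gt_eqF.
  have h2 : is_derive x 1 (fun y => (1 + k) * lnw y) ((1 + k) * - (phi x / Phi (- x))).
    exact: is_deriveZ.
  have h3 := @is_derive1_comp _ expR (fun y => (1 + k) * lnw y) _ _ _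
    (is_derive_expR _) h2.
  exact: is_deriveZ.
- by move=> x; rewrite mulr_ge0 ?expR_ge0// normal_pdf_ge0.
- move=> x; apply: cvgM; last by apply: continuous_normal_pdf; rewrite oner_eq0.
  apply: (@continuous_comp _ _ _ (fun g => k * lnw g) expR x).
    by apply: cvgM; [exact: cvg_cst|exact: continuous_lnw].
  exact: continuous_expR.
- move=> x y /=.
  have c0 : 0 <= (1 + k)^-1 by rewrite invr_ge0 ltW.
  have e0 := expR_ge0 ((1 + k) * lnw x).
  have e1 : expR ((1 + k) * lnw y) <= 1.
    by rewrite -[leRHS]expR0 ler_expR mulr_ge0_le0 ?lnw_le0// ltW.
  move: e0 e1 c0; set p := expR _; set q := expR _; set c := _^-1 => p0 q1 c0.
  have -> : - c * p - - c * q = c * (q - p) by ring.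
  by rewrite -[leRHS]mulr1; apply: ler_wpM2l => //; lra.
Qed.

End exponential_variable.

(** * A decoding metric from the entropy power inequality *)

Section satellite_metric.
Context (R : realType).
Local Notation leb := (@lebesgue_measure R).
Local Notation N := (normal_prob 0).
Local Notation phi := (normal_pdf (0 : R) 1).
Variables (b s al be : R).
Hypotheses (b_gt0 : 0 < b) (s_gt0 : 0 < s) (al_gt0 : 0 < al) (be_gt0 : 0 < be).
(** The squares of [be] and [al] are the shares of signal and noise in the total entropy power:
    [b_al] says that be / al is the square root of e b^2 / (2 pi s^2). Hence - ln al equals the rate
    [R1_in], which is the mean of [score1] at the true codeword: the squared rotation has mean 1 and
    [lnw g] has mean -1. *)
Hypothesis al_be : al ^+ 2 + be ^+ 2 = 1.
Hypothesis b_al : b * al = be * s * Num.sqrt (2 * pi) * expR (- (1 / 2)).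

(* At [y = - b * lnw g + z] the squared term is [al * g - be * z / s], the rotation
   of [(g, z / s)] used in the transport proof of the entropy power inequality. *)
Definition score1 (g y : R) : R :=
  - (al * g + be * (- b * lnw g - y) / s) ^+ 2 / 2 + al ^+ 2 * g ^+ 2 / 2
  - be ^+ 2 * lnw g - ln al - be ^+ 2 / 2.

Let psi (y g : R) := al * g + be * (- b * lnw g - y) / s.
Let dpsi (g : R) := al + be * b / s * (phi g / Phi (- g)).

Let dpsiE (y x : R) : is_derive x 1 (psi y) (dpsi x).
Proof.
have h := is_derive_lnw x.
have -> : psi y = (fun g => al * g + (- (be * b / s) * lnw g + - (be * y / s))).
  by apply/funext => g; rewrite /psi; field; rewrite gt_eqF.
have -> : dpsi x = al * 1 + (- (be * b / s) * - (phi x / Phi (- x)) + 0).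
  by rewrite /dpsi mulr1 addr0 mulrNN.
exact: is_deriveD.
Qed.

Let dpsi_ge0 x : 0 <= dpsi x.
Proof.
apply: addr_ge0; first exact: ltW.
by apply: mulr_ge0; rewrite divr_ge0 ?normal_pdf_ge0 ?Phi_ge0 ?mulr_ge0 ?ltW.
Qed.

(* The density of the standard normal law pulled back along the increasing map
   [psi y] dominates [phi * expR (score1 _ y)], by convexity of [expR]. *)
Let score1_le y g : expR (score1 g y) * phi g <= phi (psi y g) * dpsi g.
Proof.
(* By [b_al] the slope of [psi y] is (al^2 + be^2 exp(q)) / al, a weighted mean of 1 and exp(q) up
   to the factor 1 / al. *)
pose q := - g ^+ 2 / 2 - lnw g - 1 / 2.
have -> : expR (score1 g y) * phi g =
    phi (psi y g) * (al^-1 * expR (be ^+ 2 * q)).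
  rewrite !phi_expE [LHS]mulrCA -!mulrA; congr (_ * _).
  rewrite -[al in RHS]lnK ?posrE// -expRN -!expRD; congr expR.
  rewrite /score1 -/(psi y g) /q.
  have -> : al ^+ 2 = 1 - be ^+ 2 by rewrite -al_be addrK.
  by field.
apply: ler_wpM2l; first exact: normal_pdf_ge0.
have -> : dpsi g = al^-1 * (al ^+ 2 + be ^+ 2 * expR q).
  rewrite /dpsi phi_expE /q 2!expRD [expR (- lnw g)]expRN expR_lnw.
  have -> : be * b / s = be ^+ 2 * Num.sqrt (2 * pi) * expR (- (1 / 2)) / al.
    by apply: (mulIf (lt0r_neq0 al_gt0)); rewrite mulfVK ?gt_eqF//
      mulrAC -[be * b * al]mulrA b_al; field; rewrite gt_eqF.
  have := Phi_gt0 (- g); set p := Phi _; set e := expR _; set e' := expR _ => p0.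
  field; rewrite !gt_eqF// sqrtr_gt0 mulr_gt0// pi_gt0//.
apply: ler_wpM2l; first by rewrite invr_ge0 ltW.
(* Jensen's inequality for the weights al^2 and be^2, by the tangent of the exponential at the mean
   exponent [p]. *)
set p := be ^+ 2 * q.
have -> : al ^+ 2 + be ^+ 2 * expR q =
    expR p * (al ^+ 2 * expR (- p) + be ^+ 2 * expR (q - p)).
  rewrite mulrDr mulrCA -expRD subrr expR0 mulr1 [in RHS]mulrCA -expRD.
  by rewrite [p + _]addrC subrK.
rewrite -[leLHS]mulr1 ler_wpM2l ?expR_ge0//.
apply: (@le_trans _ _ (al ^+ 2 * (1 - p) + be ^+ 2 * (1 + (q - p)))).
  have -> : al ^+ 2 = 1 - be ^+ 2 by rewrite -al_be addrK.
  rewrite /p le_eqVlt; apply/orP; left; apply/eqP; ring.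
by apply: lerD; apply: ler_wpM2l; rewrite ?sqr_ge0 ?expR_ge1Dx.
Qed.

Lemma measurable_score1 : measurable_fun [set: R * R] (fun p => score1 p.1 p.2).
Proof.
have m1 : measurable_fun [set: R * R] (fun p => lnw p.1).
  by apply: (measurableT_comp (@measurable_lnw R)).
rewrite /score1; do 2 apply: measurable_funB => //.
apply: measurable_funB; last exact: measurable_funM.
apply: measurable_funD; apply: measurable_funM => //; last first.
  by apply: measurable_funM => //; exact: measurable_funX.
apply: measurableT_comp => //; apply: measurable_funX.
apply: measurable_funD; first exact: measurable_funM.
apply: measurable_funM => //; apply: measurable_funM => //.
by apply: measurable_funB => //; exact: measurable_funM.
Qed.

Let measurable_score1_l y : measurable_fun [set: R] (fun g => score1 g y).
Proof. exact: (measurable_fun_pair1 y measurable_score1). Qed.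

(** The majorant in [score1_le] is the derivative of Phi(psi y g), and a distribution function has
    oscillation at most 1. *)
Lemma integral_expR_score1 y : (\int[N 1]_g (expR (score1 g y))%:E <= 1)%E.
Proof.
have mE : measurable_fun [set: R] (fun g => (expR (score1 g y))%:E).
  by apply/measurable_EFinP; exact: measurableT_comp.
have cpsi : continuous (psi y).
  move=> x; apply/differentiable_continuous/derivable1_diffP.
  by case: (dpsiE y x).
have cphi : continuous phi by apply: continuous_normal_pdf; rewrite oner_eq0.
have cf : continuous (fun g => phi (psi y g) * dpsi g).
  move=> x; apply: cvgM.
    exact: (@continuous_comp _ _ _ (psi y) phi x (cpsi x) (cphi _)).
  apply: cvgD; first exact: cvg_cst.
  apply: cvgM; first exact: cvg_cst.
  apply: cvgM; first exact: cphi.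
  apply: cvgV; first by rewrite gt_eqF// Phi_gt0.
  apply: (@continuous_comp _ _ _ -%R (@Phi R) x); last exact: continuous_Phi.
  by apply: (@continuousN _ R^o R^o id x); exact: cvg_id.
rewrite integral_normal_prob//.
apply: (@le_trans _ _ (\int[leb]_g (phi (psi y g) * dpsi g)%:E)%E).
  apply: ge0_le_integral => //.
  - by move=> g _; rewrite mule_ge0 ?lee_fin ?expR_ge0 ?normal_pdf_ge0.
  - apply: emeasurable_funM => //.
    by apply/measurable_EFinP; exact: measurable_normal_pdf.
  - by apply/measurable_EFinP; exact: continuous_measurable_fun.
  - by move=> g _; rewrite -EFinM lee_fin score1_le.
apply: (@integral_le_of_derive R (fun g => phi (psi y g) * dpsi g)
  (fun g => Phi (psi y g)) 1) => //.
- by move=> x; exact: (@is_derive1_comp _ (@Phi R) (psi y) _ _ _ (is_derive_Phi _) (dpsiE y x)).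
- by move=> x; rewrite mulr_ge0// normal_pdf_ge0.
- by move=> u v; rewrite lerBlDr ler_wpDr ?Phi_ge0 ?Phi_le1.
Qed.

End satellite_metric.

Section exponential_law.
Context (R : realType).
Local Notation leb := (@lebesgue_measure R).
Variable S : R.
Hypothesis S_gt0 : 0 < S.

Let Sinv_gt0 : 0 < S^-1. Proof. by rewrite invr_gt0. Qed.

Definition exponential_law : probability (measurableTypeR R) R :=
  exponential_distribution_exponential_prob__canonical__probability_measure_Probability
    Sinv_gt0.

Lemma integral_exponential_law (f : R -> \bar R) :
  measurable_fun [set: R] f -> (forall x, 0 <= f x)%E ->
  (\int[exponential_law]_x f x =
   \int[leb]_(x in `[0%R, +oo[) (f x * (S^-1 * expR (- S^-1 * x))%:E))%E.
Proof.
move=> mf f0.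
rewrite (@ge0_integral_density _ _ _ leb exponential_law (exponential_pdf S^-1))//.
- rewrite [RHS]integral_mkcond; apply: eq_integral => x _.
  rewrite /exponential_pdf !patchE; case: ifPn => _ //.
  by rewrite mule0.
- exact: measurable_exponential_pdf.
- by move=> x; apply: exponential_pdf_ge0; exact: ltW.
Qed.

Lemma integral_expRN_itvy (c y : R) : 0 < c ->
  (\int[leb]_(x in `[y, +oo[) (expR (- c * x))%:E = (c^-1 * expR (- c * y))%:E)%E.
Proof.
move=> c0.
have dF (x : R) : is_derive x 1 (fun x => - c^-1 * expR (- c * x)) (expR (- c * x)).
  have -> : expR (- c * x) = - c^-1 * (expR (- c * x) * (- c * 1)).
    by field; rewrite gt_eqF.
  have h : is_derive x 1 (fun x => - c * x) (- c * 1) by exact: is_deriveZ.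
  have h3 := @is_derive1_comp _ expR (fun y => - c * y) _ _ _ (is_derive_expR _) h.
  exact: is_deriveZ.
have cE : continuous (fun x : R => expR (- c * x)).
  move=> x; apply: (@continuous_comp _ _ _ (fun x => - c * x) expR x).
    by apply: cvgM; [exact: cvg_cst|exact: cvg_id].
  exact: continuous_expR.
have cF : continuous (fun x : R => - c^-1 * expR (- c * x)).
  by move=> x; apply: cvgM; [exact: cvg_cst|exact: cE].
rewrite (@ge0_continuous_FTC2y _ _ (fun x => - c^-1 * expR (- c * x)) _ 0)//.
- by rewrite sub0e -EFinN mulNr opprK.
- exact: continuous_subspaceT.
- rewrite -[X in _ --> X](mulr0 (- c^-1)); apply: cvgM; first exact: cvg_cst.
  rewrite (_ : (fun x => expR (- c * x)) = (fun z => expR (- z)) \o (fun z => c * z)).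
    apply: (@cvg_comp _ _ _ _ _ _ (pinfty_nbhs R)); last exact: cvgr_expR.
    exact: gt0_cvgMry.
  by apply/funext => x /=; rewrite mulNr.
- exact/cvg_at_right_filter/cF.
- by move=> x _; rewrite derive1E; case: (dF x) => _ ->.
Qed.

Lemma integral_expR_itv0 (c y : R) : 0 < y -> c != 0 ->
  (\int[leb]_(x in `[0%R, y]) (expR (c * x))%:E = (c^-1 * (expR (c * y) - 1))%:E)%E.
Proof.
move=> y0 c0.
have dF (x : R) : is_derive x 1 (fun x => c^-1 * expR (c * x)) (expR (c * x)).
  have -> : expR (c * x) = c^-1 * (expR (c * x) * (c * 1)).
    by field.
  have h : is_derive x 1 (fun x => c * x) (c * 1) by exact: is_deriveZ.
  have h3 := @is_derive1_comp _ expR (fun y => c * y) _ _ _ (is_derive_expR _) h.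
  exact: is_deriveZ.
have cE : continuous (fun x : R => expR (c * x)).
  move=> x; apply: (@continuous_comp _ _ _ (fun x => c * x) expR x).
    by apply: cvgM; [exact: cvg_cst|exact: cvg_id].
  exact: continuous_expR.
have cF : continuous (fun x : R => c^-1 * expR (c * x)).
  by move=> x; apply: cvgM; [exact: cvg_cst|exact: cE].
rewrite (@continuous_FTC2 _ _ (fun x => c^-1 * expR (c * x)))//.
- by rewrite -EFinB mulr0 expR0 mulrBr.
- exact: continuous_subspaceT.
- split.
  + by move=> x _; case: (dF x).
  + exact/cvg_at_right_filter/cF.
  + exact/cvg_at_left_filter/cF.
- by move=> x _; rewrite derive1E; case: (dF x) => _ ->.
Qed.

End exponential_law.

(** * The cloud law and its two-sided exponential metric *)

Section cloud_law.
Context (R : realType).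
Local Notation leb := (@lebesgue_measure R).
Variables (p S : R).
Hypotheses (S_gt0 : 0 < S) (p01 : 0 <= p <= 1).

Definition cloud_law : probability (bool * measurableTypeR R)%type R :=
  (bernoulli_prob p \x exponential_law S_gt0)%E.

(** The maximum changes nothing almost surely, but codewords are picked point by point, so
    nonnegativity has to hold at every sample point. *)
Definition cloud (x : bool * R) : R := if x.1 then 0 else Num.max 0 x.2.

Lemma cloud_ge0 x : 0 <= cloud x.
Proof. by rewrite /cloud; case: ifP => // _; rewrite le_max lexx. Qed.

Lemma measurable_cloud : measurable_fun [set: bool * R] cloud.
Proof.
apply: measurable_fun_ifT => //; exact: measurable_maxr.
Qed.

Lemma integral_cloud_law (h : R -> \bar R) :
  measurable_fun [set: R] h -> (forall x, 0 <= h x)%E ->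
  (\int[cloud_law]_x h (cloud x) = p%:E * h 0%R + (1 - p)%:E *
   \int[leb]_(x in `[0%R, +oo[) (h x * (S^-1 * expR (- S^-1 * x))%:E))%E.
Proof.
move=> mh h0; rewrite fubini_tonelli1//; last first.
  exact: (measurableT_comp mh measurable_cloud).
rewrite integral_bernoulli_prob//; last by move=> c; exact: integral_ge0.
rewrite /fubini_F; congr (_ * _ + _ * _)%E.
  transitivity (\int[exponential_law S_gt0]_y cst (h 0%R) y)%E; first by [].
  by rewrite integral_cst// [X in (_ * X)%E](_ : _ = 1%E) ?mule1//;
    exact: probability_setT.
transitivity (\int[exponential_law S_gt0]_y h (Num.max 0%R y))%E; first by [].
rewrite integral_exponential_law//; last first.
  by apply: (measurableT_comp mh); exact: measurable_maxr.
apply: eq_integral => x; rewrite inE/= in_itv/= andbT => x0.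
by rewrite max_r.
Qed.

Lemma integral_expR_cloud (k : R) : k * S < 1 ->
  (\int[cloud_law]_x (expR (k * cloud x))%:E =
   (p + (1 - p) / (1 - k * S))%:E)%E.
Proof.
move=> kS; have c0 : 0 < S^-1 - k.
  by rewrite subr_gt0 -(ltr_pM2r S_gt0) mulVf// gt_eqF.
have me (c : R) : measurable_fun [set: R] (fun x => (expR (c * x))%:E).
  by apply/measurable_EFinP; apply: measurableT_comp => //; exact: measurable_funM.
rewrite (integral_cloud_law (h := fun x => (expR (k * x))%:E))//.
under eq_integral.
  move=> x _; rewrite -EFinM mulrCA -expRD.
  rewrite (_ : k * x + - S^-1 * x = - (S^-1 - k) * x); last ring.
  rewrite EFinM; over.
rewrite ge0_integralZl//; last 2 first.
- by apply: measurable_funTS; exact: me.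
- by rewrite lee_fin invr_ge0 ltW.
rewrite integral_expRN_itvy// mulr0 expR0 mule1 !mulr0 expR0 mulr1 -!EFinM -EFinD.
congr EFin; congr (_ + _ * _).
by field; rewrite !gt_eqF ?subr_gt0.
Qed.

End cloud_law.

Section cloud_metric.
Context (R : realType).
Local Notation leb := (@lebesgue_measure R).
Variables (be S s : R).
Hypotheses (be_gt0 : 0 < be) (be_S : be <= S) (s_gt0 : 0 < s).

Let S_gt0 : 0 < S. Proof. exact: lt_le_trans be_S. Qed.
Let p := be / S.

Let p01 : 0 <= p <= 1.
Proof.
apply/andP; split; first by rewrite /p divr_ge0// ltW.
by rewrite /p ler_pdivrMr// mul1r.
Qed.

(* [expR (score2 u y)] is [q (y - u) / Q y], where [q] is the two-sided
   exponential density with means [be] on the right and [s] on the left, and [Q]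
   is the same density with [S] for [be], that is [q] convolved with the cloud
   law. *)
Definition score2 (u y : R) : R :=
  ln ((S + s) / (be + s)) + Num.min (- (y - u) / be) ((y - u) / s)
  - Num.min (- y / S) (y / s).

Let A := (S + s) / (be + s).
Let A_gt0 : 0 < A. Proof. by rewrite divr_gt0// addr_gt0. Qed.

(** The reason for p = be / S: the cloud law then has Laplace transform (1 + be t) / (1 + S t), so
    adding an independent exponential of mean [be] produces an exponential of mean [S]. This is the
    value at t = 1 / s. *)
Let A1 : A * (p + (1 - p) / (1 + S / s)) = 1.
Proof.
rewrite /A /p; field; rewrite !gt_eqF ?addr_gt0//.
Qed.

Lemma measurable_score2 : measurable_fun [set: R * R] (fun q => score2 q.1 q.2).
Proof.
apply: measurable_funB.
  apply: measurable_funD => //; apply: measurable_minr; apply: measurable_funM => //.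
    by apply: measurableT_comp => //; exact: measurable_funB.
  exact: measurable_funB.
apply: measurable_minr; apply: measurable_funM => //.
by apply: measurableT_comp => //.
Qed.

Let mscore2 y : measurable_fun [set: R] (fun x => (expR (score2 x y))%:E).
Proof.
apply/measurable_EFinP; apply: measurableT_comp => //.
exact: (measurable_fun_pair1 y measurable_score2).
Qed.

Let me (c : R) : measurable_fun [set: R] (fun x => (expR (c * x))%:E).
Proof.
by apply/measurable_EFinP; apply: measurableT_comp => //; exact: measurable_funM.
Qed.

Let score2_le0 u y : y <= 0 -> expR (score2 u y) <= A * expR (- s^-1 * u).
Proof.
move=> y0; rewrite /score2 -/A -[X in _ <= X * _](lnK A_gt0) -expRD ler_expR.
have -> : Num.min (- y / S) (y / s) = y / s.
  rewrite min_r// (@le_trans _ _ 0)//.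
    by rewrite mulr_le0_ge0// invr_ge0 ltW.
  by rewrite mulr_ge0 ?oppr_ge0// invr_ge0 ltW.
rewrite -addrA lerD2l lerBlDr ge_min; apply/orP; right.
rewrite le_eqVlt; apply/orP; left; apply/eqP; field; exact: lt0r_neq0.
Qed.

(** Either branch of the first minimum gives an upper bound. The first bound is sharp for u <= y and
    the second for u >= y, which is where the integral over [u] is split. *)
Let score2_gt0 u y : 0 <= y ->
  expR (score2 u y) <= A * expR (y / S - y / be) * expR (be^-1 * u) /\
  expR (score2 u y) <= A * expR (y / S + y / s) * expR (- s^-1 * u).
Proof.
move=> y0; rewrite /score2 -/A -[X in _ <= X * _ * _ /\ _](lnK A_gt0).
rewrite -[X in _ /\ _ <= X * _ * _](lnK A_gt0) -!expRD !ler_expR.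
have -> : Num.min (- y / S) (y / s) = - y / S.
  rewrite min_l// (@le_trans _ _ 0)//.
    by rewrite mulr_le0_ge0 ?oppr_le0// invr_ge0 ltW.
  by rewrite mulr_ge0// invr_ge0 ltW.
split; rewrite -!addrA lerD2l lerBlDr ge_min; apply/orP; [left|right];
  rewrite le_eqVlt; apply/orP; left; apply/eqP; field; rewrite !gt_eqF//.
Qed.

Lemma integral_expR_score2 y :
  (\int[cloud_law p S_gt0]_x (expR (score2 (cloud x) y))%:E <= 1)%E.
Proof.
have expE0 (r : R) : (0 <= (expR r)%:E)%E by rewrite lee_fin expR_ge0.
have A0 : (0 <= A%:E)%E by rewrite lee_fin ltW.
have [y0|y0] := leP y 0.
  apply: (@le_trans _ _ (\int[cloud_law p S_gt0]_x
      (A%:E * (expR (- s^-1 * cloud x))%:E))%E).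
    apply: ge0_le_integral => //.
    - exact: (measurableT_comp (mscore2 y) (@measurable_cloud R)).
    - apply: emeasurable_funM => //.
      exact: (measurableT_comp (me _) (@measurable_cloud R)).
    - by move=> x _; rewrite -EFinM lee_fin score2_le0.
  rewrite ge0_integralZl//; last first.
    exact: (measurableT_comp (me _) (@measurable_cloud R)).
  rewrite integral_expR_cloud//; last first.
    by rewrite mulNr (lt_trans _ ltr01)// oppr_lt0 mulr_gt0// invr_gt0.
  by rewrite -EFinM mulNr opprK (mulrC s^-1) A1.
rewrite (@integral_cloud_law _ p S S_gt0 p01 (fun x => (expR (score2 x y))%:E))//.
pose X := expR (y / S - y / be).
have h0 : (p%:E * (expR (score2 0 y))%:E <= (p * (A * X))%:E)%E.
  rewrite -EFinM lee_fin; apply: ler_wpM2l; first by case/andP: p01.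
  by have [+ _] := score2_gt0 0 (ltW y0); rewrite mulr0 expR0 mulr1.
(* If be = S then p = 1 and the cloud reduces to its atom at 0. This case is separate because the
   exponent [c] used below would vanish. *)
have [beS|SbeE] := ltP be S; last first.
  have beE : be = S by apply/eqP; rewrite eq_le be_S.
  have p1 : p = 1 by rewrite /p beE divff// gt_eqF.
  move: h0; rewrite p1 subrr mul0e adde0 mul1r => /le_trans; apply.
  by rewrite lee_fin /X beE subrr expR0 mulr1 -A1 p1 subrr mul0r addr0 mulr1.
pose d := S^-1 + s^-1; pose c := be^-1 - S^-1.
have d0 : 0 < d by rewrite addr_gt0// invr_gt0.
have c0 : 0 < c by rewrite subr_gt0 ltf_pV2.
have mf : measurable_fun [set: R]
    (fun x => (expR (score2 x y))%:E * (S^-1 * expR (- S^-1 * x))%:E)%E.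
  apply: emeasurable_funM => //; under eq_fun do rewrite EFinM.
  exact: emeasurable_funM.
have f0 x : (0 <= (expR (score2 x y))%:E * (S^-1 * expR (- S^-1 * x))%:E)%E.
  by rewrite mule_ge0// lee_fin mulr_ge0 ?expR_ge0// invr_ge0 ltW.
have h1 : (\int[leb]_(x in `[0%R, y])
    ((expR (score2 x y))%:E * (S^-1 * expR (- S^-1 * x))%:E) <=
    (A * X * S^-1 * (c^-1 * (expR (c * y) - 1)))%:E)%E.
  rewrite EFinM -integral_expR_itv0 ?gt_eqF// -ge0_integralZl//; last 2 first.
  - by apply: measurable_funTS; exact: me.
  - rewrite lee_fin; apply: mulr_ge0; last by rewrite invr_ge0 ltW.
    by apply: mulr_ge0; [exact: ltW|exact: expR_ge0].
  apply: ge0_le_integral => //.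
  - exact: measurable_funTS.
  - by apply: measurable_funTS; apply: emeasurable_funM; [exact: measurable_cst|exact: me].
  - move=> x _; rewrite -!EFinM lee_fin.
    have [+ _] := score2_gt0 x (ltW y0) => hx.
    have -> : c * x = be^-1 * x + - S^-1 * x by rewrite /c; ring.
    rewrite [in leRHS]expRD.
    rewrite [leRHS](_ : _ = S^-1 * expR (- S^-1 * x) *
      (A * X * expR (be^-1 * x))); last ring.
    by rewrite mulrC; apply: ler_wpM2l => //; rewrite mulr_ge0 ?expR_ge0// invr_ge0 ltW.
have h2 : (\int[leb]_(x in `[y, +oo[)
    ((expR (score2 x y))%:E * (S^-1 * expR (- S^-1 * x))%:E) <=
    (A * expR (y / S + y / s) * S^-1 * (d^-1 * expR (- d * y)))%:E)%E.
  have K0 : (0 <= (A * expR (y / S + y / s) * S^-1)%:E)%E.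
    rewrite lee_fin; apply: mulr_ge0; last by rewrite invr_ge0 ltW.
    by apply: mulr_ge0; [exact: ltW|exact: expR_ge0].
  rewrite EFinM -(integral_expRN_itvy y d0) -(ge0_integralZl _ _ _ _ K0)//; last first.
    by apply: measurable_funTS; exact: me.
  apply: ge0_le_integral => //.
  - exact: measurable_funTS.
  - by apply: measurable_funTS; apply: emeasurable_funM; [exact: measurable_cst|exact: me].
  - move=> x _; rewrite -!EFinM lee_fin.
    have [_ +] := score2_gt0 x (ltW y0) => hx.
    have -> : - d * x = - s^-1 * x + - S^-1 * x by rewrite /d; ring.
    rewrite (expRD (- s^-1 * x)).
    rewrite [leRHS](_ : _ = S^-1 * expR (- S^-1 * x) *
      (A * expR (y / S + y / s) * expR (- s^-1 * x))); last ring.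
    by rewrite mulrC; apply: ler_wpM2l => //; rewrite mulr_ge0 ?expR_ge0// invr_ge0 ltW.
have h12 : (\int[leb]_(x in `[0%R, +oo[)
    ((expR (score2 x y))%:E * (S^-1 * expR (- S^-1 * x))%:E) <=
    (A * X * S^-1 * (c^-1 * (expR (c * y) - 1)) +
     A * expR (y / S + y / s) * S^-1 * (d^-1 * expR (- d * y)))%:E)%E.
  have -> : `[0, +oo[%classic = `[0, y] `|` `]y, +oo[ :> set R.
    by rewrite -itv_bndbnd_setU// bnd_simp ltW.
  rewrite ge0_integral_setU//=.
  - rewrite EFinD; apply: leeD => //; apply: le_trans h2.
    apply: ge0_subset_integral => //; first exact: measurable_funTS.
    by move=> x /=; rewrite !in_itv/= !andbT => /ltW.
  - exact: measurable_funTS.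
  - apply/disj_setPS => x [] /=; rewrite !in_itv/= andbT => /andP[_ xy] yx.
    by move: (lt_le_trans yx xy); rewrite ltxx.
apply: (le_trans (leeD h0 (lee_wpmul2l _ h12))).
  by rewrite lee_fin subr_ge0; case/andP: p01.
rewrite -EFinM -EFinD lee_fin -[leRHS]A1.
(* The contributions at the splitting point no longer depend on [y], and the remaining multiples of
   [X] cancel since (1 - p) / (S c) = p. What is left is the left-hand side of [A1]. *)
have XE : X * expR (c * y) = 1.
  rewrite /X -expRD (_ : _ + _ = 0) ?expR0// /c; field; rewrite !gt_eqF//.
have dE : expR (y / S + y / s) * expR (- d * y) = 1.
  rewrite -expRD (_ : _ + _ = 0) ?expR0// /d; field; rewrite !gt_eqF//.
rewrite [leLHS](_ : _ = A * (p * X + (1 - p) * (S^-1 * c^-1 * (X * expR (c * y) - X) +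
    S^-1 * d^-1 * (expR (y / S + y / s) * expR (- d * y))))); last ring.
rewrite XE dE mulr1 le_eqVlt; apply/orP; left; apply/eqP; congr (_ * _).
rewrite /p /c /d; field.
by rewrite mulN1r; apply/and5P; split; rewrite gt_eqF ?subr_gt0// addr_gt0.
Qed.

End cloud_metric.

(** * Error exponents *)

Section first_order_bounds.
Context (R : realType).
Implicit Types (f g h : R -> R) (a b k w t : R).

(* First-order calculus of moment generating functions: a factor with [a < 0] is
   smaller than 1 for small [t], so that its n-th power vanishes. *)
Definition lin_le f a : Prop := exists2 C : R, 0 <= C &
  exists2 t0 : R, 0 < t0 & forall t, 0 <= t -> t <= t0 ->
    0 <= f t /\ f t <= 1 + a * t + C * t ^+ 2.

Lemma lin_le_mul f g a b : lin_le f a -> lin_le g b ->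
  lin_le (fun t => f t * g t) (a + b).
Proof.
move=> [C C0 [t0 t00 Hf]] [D D0 [t1 t10 Hg]].
exists (C + D + `|a| * `|b| + `|a| * D + `|b| * C + C * D).
  by rewrite !addr_ge0 ?mulr_ge0.
exists (Num.min 1 (Num.min t0 t1)); first by rewrite !lt_min ltr01 t00.
move=> t tge0; rewrite !le_min => /and3P[tle1 tt0 tt1].
have [f0 fle] := Hf t tge0 tt0; have [g0 gle] := Hg t tge0 tt1.
split; first exact: mulr_ge0.
apply: (le_trans (ler_pM f0 g0 fle gle)).
have t2 : 0 <= t ^+ 2 by rewrite sqr_ge0.
have E : 1 + (a + b) * t + (C + D + `|a| * `|b| + `|a| * D + `|b| * C + C * D) * t ^+ 2
  - (1 + a * t + C * t ^+ 2) * (1 + b * t + D * t ^+ 2) =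
  t ^+ 2 * ((`|a| * `|b| - a * b) + D * (`|a| - a * t) + C * (`|b| - b * t)
    + C * D * (1 - t ^+ 2)) by ring.
rewrite -subr_ge0 E; apply: mulr_ge0 => //.
have tn x : x * t <= `|x|.
  apply: (le_trans (ler_norm _)); rewrite normrM (ger0_norm tge0).
  by rewrite -[leRHS]mulr1 ler_wpM2l.
apply: addr_ge0; first apply: addr_ge0; first apply: addr_ge0.
- by rewrite subr_ge0 -normrM ler_norm.
- by rewrite mulr_ge0// subr_ge0.
- by rewrite mulr_ge0// subr_ge0.
- by rewrite mulr_ge0 ?mulr_ge0// subr_ge0 exprn_ile1.
Qed.

Lemma lin_le_avg3 f g h a b c : lin_le f a -> lin_le g b -> lin_le h c ->
  lin_le (fun t => 3^-1 * (f t + g t + h t)) (3^-1 * (a + b + c)).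
Proof.
move=> [C C0 [t0 t00 Hf]] [D D0 [t1 t10 Hg]] [F F0 [t2 t20 Hh]].
exists (3^-1 * (C + D + F)); first by rewrite mulr_ge0 ?addr_ge0.
exists (Num.min t0 (Num.min t1 t2)); first by rewrite !lt_min t00 t10.
move=> t tge0; rewrite !le_min => /and3P[tt0 tt1 tt2].
have [f0 fle] := Hf t tge0 tt0; have [g0 gle] := Hg t tge0 tt1.
have [h0 hle] := Hh t tge0 tt2.
split; first by rewrite mulr_ge0 ?addr_ge0.
lra.
Qed.

Lemma lin_le_affine f a p : 0 <= p <= 1 -> lin_le f a ->
  lin_le (fun t => p + (1 - p) * f t) ((1 - p) * a).
Proof.
move=> /andP[p0 p1] [C C0 [t0 t00 Hf]].
have q0 : 0 <= 1 - p by rewrite subr_ge0.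
exists ((1 - p) * C); first by rewrite mulr_ge0.
exists t0 => // t tge0 tt0; have [f0 fle] := Hf t tge0 tt0.
split; first by rewrite addr_ge0 ?mulr_ge0.
rewrite [leRHS](_ : _ = p + (1 - p) * (1 + a * t + C * t ^+ 2)); last ring.
by rewrite lerD2l ler_wpM2l.
Qed.

(** The shape in which the kernel bounds come out. The lower bound on [g] keeps the combination
    nonnegative, as [lin_le] demands for the sake of products. *)
Lemma lin_le_comb f g a b k w : 0 <= w -> 0 <= k ->
  lin_le f a -> lin_le g b -> (exists2 t0 : R, 0 < t0 & forall t, 0 <= t -> t <= t0 -> 1 <= g t) ->
  lin_le (fun t => f t + w * (k * t + (g t - 1))) (a + w * (k + b)).
Proof.
move=> w0 k0 [C C0 [t0 t00 Hf]] [D D0 [t1 t10 Hg]] [t2 t20 Hg1].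
exists (C + w * D); first by rewrite addr_ge0 ?mulr_ge0.
exists (Num.min t0 (Num.min t1 t2)); first by rewrite !lt_min t00 t10.
move=> t tge0; rewrite !le_min => /and3P[tt0 tt1 tt2].
have [f0 fle] := Hf t tge0 tt0; have [g0 gle] := Hg t tge0 tt1.
have g1 := Hg1 t tge0 tt2.
split.
  apply: addr_ge0 => //; apply: mulr_ge0 => //.
  by apply: addr_ge0; [exact: mulr_ge0|rewrite subr_ge0].
rewrite [leRHS](_ : _ = 1 + a * t + C * t ^+ 2 +
  w * (k * t + (1 + b * t + D * t ^+ 2 - 1))); last ring.
by rewrite lerD// ler_wpM2l// lerD2l lerD2r.
Qed.

Let small_mul k : exists2 t0 : R, 0 < t0 & forall t, 0 <= t -> t <= t0 -> k * t <= 2^-1 /\ t <= 1.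
Proof.
exists (2 * (`|k| + 1))^-1.
  by rewrite invr_gt0 mulr_gt0// ltr_wpDl.
move=> t t0 tt.
have k1 : 0 < `|k| + 1 by rewrite ltr_wpDl.
have H : (`|k| + 1) * t <= 2^-1.
  rewrite -(@ler_pM2l _ (`|k| + 1)^-1) ?invr_gt0// mulrA mulVf ?gt_eqF// mul1r.
  by rewrite -invfM mulrC.
split.
- apply: le_trans H; rewrite mulrDl mul1r ler_wpDr//.
  by apply: ler_wpM2r => //; exact: ler_norm.
- apply: (@le_trans _ _ ((`|k| + 1) * t)); first by rewrite mulrDl mul1r ler_wpDl// mulr_ge0.
  by apply: (le_trans H); lra.
Qed.

Let inv_le (x : R) : x <= 2^-1 -> 0 <= (1 - x)^-1 /\ (1 - x)^-1 <= 1 + x + 2 * x ^+ 2.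
Proof.
move=> x2; have x1 : 0 < 1 - x by lra.
split; first by rewrite invr_ge0 ltW.
rewrite -[leLHS]mul1r ler_pdivrMr//.
have -> : (1 + x + 2 * x ^+ 2) * (1 - x) = 1 + x ^+ 2 * (1 - 2 * x) by ring.
by rewrite lerDl mulr_ge0 ?sqr_ge0//; lra.
Qed.

Lemma lin_le_inv k : lin_le (fun t => (1 - k * t)^-1) k.
Proof.
exists (2 * k ^+ 2); first by rewrite mulr_ge0 ?sqr_ge0.
have [t0 t00 H] := small_mul k; exists t0 => // t tge0 tt0.
have [kt _] := H t tge0 tt0; have [h1 h2] := inv_le kt.
by split => //; apply: (le_trans h2); rewrite exprMn mulrA.
Qed.

Lemma lin_le_expR a : lin_le (fun t => expR (a * t)) a.
Proof.
exists (2 * a ^+ 2); first by rewrite mulr_ge0 ?sqr_ge0.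
have [t0 t00 H] := small_mul a; exists t0 => // t tge0 tt0.
have [kt _] := H t tge0 tt0; have [h1 h2] := inv_le kt.
split; first exact: expR_ge0.
rewrite -mulrA -exprMn; apply: le_trans h2.
have x1 : 0 < 1 - a * t by lra.
rewrite -[expR _]invrK lef_pV2 ?posrE ?invr_gt0 ?expR_gt0// -expRN.
exact: expR_ge1Dx.
Qed.

Lemma lin_le_expR_sqr k : 0 <= k -> lin_le (fun t => expR (k * t ^+ 2)) 0.
Proof.
move=> k0; exists (k + 2 * k ^+ 2); first by rewrite addr_ge0 ?mulr_ge0 ?sqr_ge0.
have [t0 t00 H] := small_mul k; exists t0 => // t tge0 tt0.
have [kt t1] := H t tge0 tt0.
have ktt : k * t ^+ 2 <= 2^-1.
  by apply: le_trans kt; rewrite expr2 mulrA -[leRHS]mulr1 ler_wpM2l ?mulr_ge0.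
have [h1 h2] := inv_le ktt.
split; first exact: expR_ge0.
apply: (@le_trans _ _ (1 - k * t ^+ 2)^-1).
  have x1 : 0 < 1 - k * t ^+ 2 by lra.
  rewrite -[expR _]invrK lef_pV2 ?posrE ?invr_gt0 ?expR_gt0// -expRN.
  exact: expR_ge1Dx.
apply: (le_trans h2).
rewrite [leRHS](_ : _ = 1 + k * t ^+ 2 + 2 * (k ^+ 2 * t ^+ 2)); last ring.
rewrite lerD2l ler_wpM2l// exprMn ler_wpM2l ?sqr_ge0//.
by rewrite [leLHS]expr2 -[leRHS]mulr1 ler_wpM2l ?sqr_ge0// exprn_ile1.
Qed.

Let sqrtinv_le (x : R) : 0 <= x -> x <= 2^-1 ->
  1 <= (Num.sqrt (1 - x))^-1 /\ (Num.sqrt (1 - x))^-1 <= 1 + x / 2 + x ^+ 2.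
Proof.
move=> x0 x2; have x1 : 0 < 1 - x by lra.
have s0 : 0 < Num.sqrt (1 - x) by rewrite sqrtr_gt0.
split.
  rewrite -[leLHS]invr1 lef_pV2 ?posrE// -[leRHS]sqrtr1 ler_wsqrtr//; lra.
rewrite -[leLHS]mul1r ler_pdivrMr//.
have y0 : 0 <= 1 + x / 2 + x ^+ 2 by rewrite !addr_ge0 ?sqr_ge0// divr_ge0.
have sq : 1 <= ((1 + x / 2 + x ^+ 2) * Num.sqrt (1 - x)) ^+ 2.
  rewrite exprMn sqr_sqrtr; last exact: ltW.
  have -> : (1 + x / 2 + x ^+ 2) ^+ 2 * (1 - x) =
    1 + x ^+ 2 * (5 / 4 * (1 - x) - x ^+ 3) by field.
  rewrite lerDl mulr_ge0 ?sqr_ge0//.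
  have : x ^+ 3 <= 2^-1 * (2^-1 * 2^-1).
    by rewrite exprS expr2 ler_pM// ?mulr_ge0// ler_pM.
  lra.
have Y0 := mulr_ge0 y0 (ltW s0).
by move: sq; rewrite -[X in X <= _](expr1n _ 2) ler_sqr ?nnegrE.
Qed.

Lemma lin_le_sqrtV k : 0 <= k -> lin_le (fun t => (Num.sqrt (1 - k * t))^-1) (k / 2) /\
  exists2 t0 : R, 0 < t0 & forall t, 0 <= t -> t <= t0 -> 1 <= (Num.sqrt (1 - k * t))^-1.
Proof.
move=> k0; have [t0 t00 H] := small_mul k; split; last first.
  exists t0 => // t tge0 tt0; have [kt _] := H t tge0 tt0.
  by have [] := sqrtinv_le (mulr_ge0 k0 tge0) kt.
exists (k ^+ 2); first exact: sqr_ge0.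
exists t0 => // t tge0 tt0; have [kt _] := H t tge0 tt0.
have [h1 h2] := sqrtinv_le (mulr_ge0 k0 tge0) kt.
split; first exact: le_trans h1.
by apply: (le_trans h2); rewrite exprMn mulrAC.
Qed.

Lemma lin_le_sqrtV_sqr k : 0 <= k -> lin_le (fun t => (Num.sqrt (1 - k * t ^+ 2))^-1) 0 /\
  exists2 t0 : R, 0 < t0 & forall t, 0 <= t -> t <= t0 -> 1 <= (Num.sqrt (1 - k * t ^+ 2))^-1.
Proof.
move=> k0; have [t0 t00 H] := small_mul k.
have ktt t : 0 <= t -> t <= t0 -> k * t ^+ 2 <= 2^-1.
  move=> tge0 tt0; have [kt t1] := H t tge0 tt0.
  by apply: le_trans kt; rewrite expr2 mulrA -[leRHS]mulr1 ler_wpM2l ?mulr_ge0.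
have kt0 t : 0 <= k * t ^+ 2 by rewrite mulr_ge0 ?sqr_ge0.
split; last first.
  by exists t0 => // t tge0 tt0; have [] := sqrtinv_le (kt0 t) (ktt t tge0 tt0).
exists (k + k ^+ 2); first by rewrite addr_ge0 ?sqr_ge0.
exists t0 => // t tge0 tt0.
have [_ t1] := H t tge0 tt0.
have [h1 h2] := sqrtinv_le (kt0 t) (ktt t tge0 tt0).
split; first exact: le_trans h1.
apply: (le_trans h2).
rewrite [leRHS](_ : _ = 1 + k * t ^+ 2 + k ^+ 2 * t ^+ 2); last ring.
apply: lerD; first by rewrite lerD2l; have := kt0 t; lra.
rewrite exprMn ler_wpM2l ?sqr_ge0//.
by rewrite [leLHS]expr2 -[leRHS]mulr1 ler_wpM2l ?sqr_ge0// exprn_ile1.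
Qed.

Lemma lin_le_scale f a k : 0 < k -> lin_le f a -> lin_le (fun t => f (k * t)) (a * k).
Proof.
move=> k0 [C C0 [t0 t00 Hf]]; exists (C * k ^+ 2); first by rewrite mulr_ge0 ?sqr_ge0.
exists (t0 / k); first by rewrite divr_gt0.
move=> t tge0 tt0; have kt0 : 0 <= k * t by rewrite mulr_ge0// ltW.
have ktt : k * t <= t0 by rewrite mulrC -ler_pdivlMr.
have [f0 fle] := Hf (k * t) kt0 ktt.
by split => //; apply: (le_trans fle); rewrite exprMn !mulrA.
Qed.

Lemma lin_le_lt1 f a : lin_le f a -> a < 0 ->
  exists2 t0 : R, 0 < t0 & forall t, 0 < t -> t <= t0 -> f t < 1.
Proof.
move=> [C C0 [t0 t00 Hf]] a0.
have C1 : 0 < C + 1 by rewrite ltr_wpDl.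
exists (Num.min t0 (- a / (C + 1))).
  by rewrite lt_min t00 divr_gt0// oppr_gt0.
move=> t tgt0; rewrite le_min => /andP[tt0 ta].
have [_ fle] := Hf t (ltW tgt0) tt0.
apply: (le_lt_trans fle).
have : C * t < - a.
  move: ta; rewrite ler_pdivlMr// mulrC mulrDl mul1r => ta.
  by apply: lt_le_trans ta; rewrite ltrDl.
move=> Ct; have : t * (a + C * t) < 0 by rewrite pmulr_rlt0//; lra.
have -> : t * (a + C * t) = a * t + C * t ^+ 2 by ring.
lra.
Qed.

End first_order_bounds.

(** * Moment generating functions at the transmitted codeword *)

Section kernel_bounds.
Context (R : realType).
Local Notation leb := (@lebesgue_measure R).
Local Notation N := (normal_prob 0).

Definition expvar (b g : R) : R := - b * lnw g.

Lemma expvar_ge0 b g : 0 <= b -> 0 <= expvar b g.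
Proof. by move=> b0; rewrite /expvar mulNr oppr_ge0 mulr_ge0_le0 ?lnw_le0. Qed.

Lemma measurable_expvar b : measurable_fun [set: R] (expvar b).
Proof. by apply: measurable_funM => //; exact: measurable_lnw. Qed.

Let mexp (d : measure_display) (T : measurableType d) (f : T -> R) :
  measurable_fun [set: T] f -> measurable_fun [set: T] (fun x => (expR (f x))%:E).
Proof. by move=> mf; apply/measurable_EFinP; exact: measurableT_comp. Qed.

Let expE0 (r : R) : (0 <= (expR r)%:E)%E. Proof. by rewrite lee_fin expR_ge0. Qed.

Lemma integral_expR_expvar_le k b : k * b < 1 ->
  (\int[N 1]_g (expR (k * expvar b g))%:E <= ((1 - k * b)^-1)%:E)%E.
Proof.
move=> kb.
under eq_integral do rewrite /expvar mulrA mulrN.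
by apply: integral_expR_lnw_le; rewrite ltrN2.
Qed.

Lemma expR_convex (r y : R) : 0 <= r <= 1 -> expR (r * y) <= 1 - r + r * expR y.
Proof.
move=> /andP[r0 r1].
have -> : 1 - r + r * expR y =
    expR (r * y) * ((1 - r) * expR (- (r * y)) + r * expR (y - r * y)).
  rewrite mulrDr mulrCA -expRD subrr expR0 mulr1 [in RHS]mulrCA -expRD.
  by rewrite [r * y + _]addrC subrK.
rewrite -[leLHS]mulr1 ler_wpM2l ?expR_ge0//.
have E : 1 = (1 - r) * (1 + - (r * y)) + r * (1 + (y - r * y)) by ring.
by rewrite [leLHS]E; apply: lerD; apply: ler_wpM2l; rewrite ?subr_ge0 ?expR_ge1Dx.
Qed.

(** Isolates the linear term, which decides the slope, and leaves the exponential of a square, whose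
    Gaussian integral is explicit. *)
Lemma expR_le_sqr (t : R) : 0 <= t -> expR t <= t + expR (2 * t ^+ 2).
Proof.
move=> t0; have [th|th] := leP t 2^-1; last first.
  apply: ler_wpDl => //; rewrite ler_expR expr2 mulrA ler_peMl//; lra.
have t1 : 0 < 1 - t by lra.
apply: (@le_trans _ _ (1 - t)^-1).
  rewrite -[expR _]invrK lef_pV2 ?posrE ?invr_gt0 ?expR_gt0// -expRN.
  exact: expR_ge1Dx.
apply: (@le_trans _ _ (t + (1 + 2 * t ^+ 2))); last by rewrite lerD2l expR_ge1Dx.
rewrite -[leLHS]mul1r ler_pdivrMr//.
have -> : (t + (1 + 2 * t ^+ 2)) * (1 - t) = 1 + t ^+ 2 * (1 - 2 * t) by ring.
by rewrite lerDl mulr_ge0 ?sqr_ge0//; lra.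
Qed.

Lemma power_kernel_bound (p S b E th : R) (S0 : 0 < S) : 0 <= p <= 1 ->
  th * S < 1 -> th * b < 1 ->
  (\int[cloud_law p S0]_x \int[N 1]_g
     power_kernel E th (@cloud R) (expvar b) (x, g) <=
   (expR (- E * th) * (p + (1 - p) * (1 - S * th)^-1) * (1 - b * th)^-1)%:E)%E.
Proof.
move=> p01 thS thb.
have I x : (\int[N 1]_g power_kernel E th (@cloud R) (expvar b) (x, g) <=
    (expR (th * cloud x))%:E * (expR (- E * th) * (1 - b * th)^-1)%:E)%E.
  rewrite /power_kernel/=.
  under eq_integral.
    move=> g _.
    rewrite (_ : th * _ = th * cloud x + (- E * th + th * expvar b g)); last by ring.
    rewrite !expRD !EFinM; over.
  rewrite ge0_integralZl//; last first.
    apply: emeasurable_funM => //; apply: mexp.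
    by apply: measurable_funM => //; exact: measurable_expvar.
  apply: lee_wpmul2l => //.
  rewrite ge0_integralZl//; last first.
    by apply: mexp; apply: measurable_funM => //; exact: measurable_expvar.
  rewrite EFinM; apply: lee_wpmul2l => //.
  by rewrite mulrC; exact: integral_expR_expvar_le.
have mc : measurable_fun [set: bool * R] (fun x => (expR (th * cloud x))%:E).
  by apply: mexp; apply: measurable_funM => //; exact: measurable_cloud.
apply: (@le_trans _ _ (\int[cloud_law p S0]_x
  ((expR (th * cloud x))%:E * (expR (- E * th) * (1 - b * th)^-1)%:E))%E).
  apply: ge0_le_integral => //.
  - by move=> x _; apply: integral_ge0 => g _; exact: expE0.
  - apply: (measurable_fun_fubini_tonelli_F (m2 := N 1)
      (power_kernel E th (@cloud R) (expvar b))) => //; last by move=> q; exact: expE0.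
    apply: mexp; apply: measurable_funM => //; apply: measurable_funB => //.
    apply: measurable_funD.
      by apply: (measurableT_comp (@measurable_cloud R)).
    by apply: (measurableT_comp (measurable_expvar b)).
  - by apply: emeasurable_funM.
have b0 : 0 <= (1 - b * th)^-1 by rewrite invr_ge0 subr_ge0 mulrC ltW.
rewrite ge0_integralZr//; last by rewrite lee_fin mulr_ge0 ?expR_ge0.
rewrite integral_expR_cloud// -EFinM lee_fin le_eqVlt; apply/orP; left; apply/eqP.
by rewrite (mulrC S th); ring.
Qed.

(** At the true codeword the squares of [g] in [score1] cancel, and the noise integral is Gaussian.
    It leaves the product of X = exp(th be^2 lnw g) and Y = exp(q g^2), both functions of [g]. Since
    X <= 1 <= Y, one has X Y + 1 <= X + Y, which separates them without loss at first order; [q] is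
    quadratic in [th], so Y does not affect the slope. The factors [1 *] and [0 *] fit
    [lin_le_comb]. *)
Lemma miss1_kernel_bound (b s al be gam th : R) :
  0 < s -> al ^+ 2 + be ^+ 2 = 1 -> 0 <= th -> th * be ^+ 2 <= 2^-1 ->
  2 * (al ^+ 2 * be ^+ 2) * th ^+ 2 < 1 ->
  (\int[N 1]_g miss1_kernel s th gam (expvar b) (score1 b s al be) g <=
   (expR ((gam + ln al + be ^+ 2 / 2) * th) * (Num.sqrt (1 - be ^+ 2 * th))^-1 *
    ((1 - (- be ^+ 2) * th)^-1 + 1 * (0 * th +
      ((Num.sqrt (1 - 2 * (al ^+ 2 * be ^+ 2) * th ^+ 2))^-1 - 1))))%:E)%E.
Proof.
move=> s0 albe th0 thbe thq.
pose K := expR ((gam + ln al + be ^+ 2 / 2) * th) * (Num.sqrt (1 - be ^+ 2 * th))^-1.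
pose q := al ^+ 2 * be ^+ 2 * th ^+ 2.
have K0 : 0 <= K by rewrite mulr_ge0 ?expR_ge0// invr_ge0 sqrtr_ge0.
have q0 : 0 <= q.
  by apply: mulr_ge0; rewrite ?sqr_ge0//; apply: mulr_ge0; rewrite sqr_ge0.
have D0 : 0 < 1 - be ^+ 2 * th by rewrite mulrC; lra.
pose X g := expR (th * be ^+ 2 * lnw g); pose Y g := expR (q * g ^+ 2).
have ker g : (miss1_kernel s th gam (expvar b) (score1 b s al be) g <=
    K%:E * (X g * Y g)%:E)%E.
  rewrite /miss1_kernel.
  under eq_integral.
    move=> z _.
    rewrite (_ : th * _ = ((gam + ln al + be ^+ 2 / 2) * th + th * be ^+ 2 * lnw g) +
      (th * be ^+ 2 / (2 * s ^+ 2) * z ^+ 2 + - (th * al * be * g / s) * z)); last first.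
      by rewrite /score1 /expvar; field; rewrite gt_eqF.
    rewrite [expR (_ + (_ + _))]expRD EFinM; over.
  rewrite ge0_integralZl//; last first.
    apply: mexp; apply: measurable_funD; apply: measurable_funM => //.
  have kk : 2 * (th * be ^+ 2 / (2 * s ^+ 2)) * s ^+ 2 = be ^+ 2 * th.
    by field; rewrite gt_eqF.
  rewrite integral_normal_expR_quad// kk; last by rewrite -subr_gt0.
  rewrite -!EFinM lee_fin expRD /K /X /Y.
  rewrite [leLHS](_ : _ = expR ((gam + ln al + be ^+ 2 / 2) * th) *
    (Num.sqrt (1 - be ^+ 2 * th))^-1 * (expR (th * be ^+ 2 * lnw g) *
    expR ((- (th * al * be * g / s)) ^+ 2 * s ^+ 2 / (2 * (1 - be ^+ 2 * th))))); last ring.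
  apply: ler_wpM2l => //; apply: ler_wpM2l; first exact: expR_ge0.
  rewrite ler_expR sqrrN.
  have -> : (th * al * be * g / s) ^+ 2 * s ^+ 2 = q * g ^+ 2.
    by rewrite /q; field; rewrite gt_eqF.
  (* The denominator is at least 1 because th be^2 <= 1/2. *)
  rewrite ler_pdivrMr ?mulr_gt0// ler_peMr//; first by apply: mulr_ge0; rewrite ?sqr_ge0.
  by rewrite (mulrC (be ^+ 2)); lra.
have mX : measurable_fun [set: R] X.
  by apply: measurableT_comp => //; apply: measurable_funM => //; exact: measurable_lnw.
have mY : measurable_fun [set: R] Y.
  by apply: measurableT_comp => //; apply: measurable_funM.
have X0 g : 0 <= X g by exact: expR_ge0.
have Y1 g : 1 <= Y g by rewrite -[leLHS]expR0 ler_expR; apply: mulr_ge0; rewrite ?sqr_ge0.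
have X1 g : X g <= 1.
  rewrite -[leRHS]expR0 ler_expR mulr_ge0_le0 ?lnw_le0//.
  by apply: mulr_ge0; rewrite ?sqr_ge0.
have IX : (\int[N 1]_g (X g)%:E <= ((1 - (- be ^+ 2) * th)^-1)%:E)%E.
  rewrite (_ : 1 - _ = 1 + th * be ^+ 2); last by ring.
  apply: integral_expR_lnw_le; apply: (@lt_le_trans _ _ 0); first lra.
  by apply: mulr_ge0; rewrite ?sqr_ge0.
have IY : (\int[N 1]_g (Y g)%:E = ((Num.sqrt (1 - 2 * (al ^+ 2 * be ^+ 2) * th ^+ 2))^-1)%:E)%E.
  have := @integral_normal_expR_quad R 1 q 0 ltr01.
  rewrite expr1n mulr1 [0 ^+ 2 * _]mulr1 expr0n/= mul0r expR0 mulr1.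
  have -> : 2 * q = 2 * (al ^+ 2 * be ^+ 2) * th ^+ 2 by rewrite /q; ring.
  by move=> <-//; apply: eq_integral => g _; rewrite mul0r addr0.
have IXY : (\int[N 1]_g (X g * Y g)%:E + 1 <=
    \int[N 1]_g (X g)%:E + \int[N 1]_g (Y g)%:E)%E.
  have P1 : (\int[N 1]_g (cst 1%E g) = 1 :> \bar R)%E.
    by rewrite integral_cst// mul1e; exact: probability_setT.
  have mXY : measurable_fun [set: R] (fun g => (X g * Y g)%:E).
    by apply/measurable_EFinP; exact: measurable_funM.
  have XY0 g : (0 <= (X g * Y g)%:E)%E by rewrite lee_fin mulr_ge0// (le_trans ler01).
  have XE0 g : (0 <= (X g)%:E)%E by rewrite lee_fin.
  have Y0 g : (0 <= (Y g)%:E)%E by rewrite lee_fin (le_trans ler01).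
  rewrite -[X in (_ + X <= _)%E]P1 -!ge0_integralD//; last 2 first.
  - exact/measurable_EFinP.
  - exact/measurable_EFinP.
  apply: ge0_le_integral => //.
  - by move=> g _; rewrite adde_ge0.
  - by apply: emeasurable_funD.
  - by apply: emeasurable_funD; exact/measurable_EFinP.
  - move=> g _; rewrite -!EFinD lee_fin -subr_ge0.
    rewrite (_ : _ - _ = (1 - X g) * (Y g - 1)); last by ring.
    by rewrite mulr_ge0// subr_ge0.
have step : (\int[N 1]_g miss1_kernel s th gam (expvar b) (score1 b s al be) g <=
    \int[N 1]_g (K%:E * (X g * Y g)%:E))%E.
  have mXY : measurable_fun [set: R] (fun g => (X g * Y g)%:E).
    by apply/measurable_EFinP; exact: measurable_funM.
  apply: ge0_le_integral => //.
  - by move=> g _; apply: integral_ge0 => z _; exact: expE0.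
  - have ms : measurable_fun [set: R * R]
        (fun p => (expR (th * (gam - score1 b s al be p.1 (expvar b p.1 + p.2))))%:E).
      apply: mexp; apply: measurable_funM => //; apply: measurable_funB => //.
      apply: (measurableT_comp (measurable_score1 b s al be)
        (g := fun p => (p.1, expvar b p.1 + p.2))).
      apply: measurable_fun_pair => //; apply: measurable_funD => //.
      by apply: (measurableT_comp (measurable_expvar b)).
    exact: (measurable_fun_fubini_tonelli_F (m2 := N s) _ ms (fun=> expE0 _)).
  - exact: emeasurable_funM.
apply: (le_trans step); rewrite ge0_integralZl//; last 2 first.
- by apply/measurable_EFinP; exact: measurable_funM.
- by move=> g _; rewrite lee_fin mulr_ge0// (le_trans ler01).
rewrite -/K [leRHS]EFinM; apply: lee_wpmul2l; first by rewrite lee_fin.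
rewrite mul1r mul0r add0r addrA EFinB leeBrDr//.
by apply: (le_trans IXY); rewrite IY EFinD leeD2r.
Qed.

End kernel_bounds.

Section cloud_metric_bound.
Context (R : realType).
Local Notation leb := (@lebesgue_measure R).
Local Notation N := (normal_prob 0).

Let expE0 (r : R) : (0 <= (expR r)%:E)%E. Proof. by rewrite lee_fin expR_ge0. Qed.

Let mexp (d : measure_display) (T : measurableType d) (f : T -> R) :
  measurable_fun [set: T] f -> measurable_fun [set: T] (fun x => (expR (f x))%:E).
Proof. by move=> mf; apply/measurable_EFinP; exact: measurableT_comp. Qed.

Lemma integral_cst_prob (d : measure_display) (T : measurableType d)
  (P : probability T R) (c : \bar R) : (\int[P]_x c = c)%E.
Proof.
rewrite (_ : (fun=> c) = cst c)// integral_cst// [X in (_ * X)%E](_ : _ = 1%E) ?mule1//.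
exact: probability_setT.
Qed.

Lemma integral_normal_neg (s c : R) (h : R -> R) : s != 0 -> continuous h ->
  (forall z, 0 <= h z) -> (forall z, h (- z) = h z) ->
  (\int[N s]_z (h z)%:E = c%:E ->
   \int[N s]_(z in [set z | (z < 0)%R]) (h z)%:E = (2^-1 * c)%:E)%E.
Proof.
move=> s0 ch h0 hN hc.
have mh : measurable_fun [set: R] h by exact: continuous_measurable_fun.
have mneg : measurable [set z : R | z < 0] by rewrite -set_itvNyo.
have mpos : measurable [set z : R | 0 <= z] by rewrite -set_itvcy.
have pos : (\int[N s]_(z in [set z | (0 <= z)%R]) (h z)%:E = (2^-1 * c)%:E)%E.
  have half : (2%:E * \int[N s]_(z in [set z | (0 <= z)%R]) (h z)%:E = c%:E)%E.
    rewrite -hc [in RHS]integral_normal_prob//; last exact/measurable_EFinP.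
    rewrite integral_mkcond integral_normal_prob; last 2 first.
    - apply/(measurable_restrictT (fun z => (h z)%:E) mpos)/measurable_funTS.
      exact/measurable_EFinP.
    - by move=> x; apply: erestrict_ge0 => y _; rewrite lee_fin.
    under [RHS]eq_integral do rewrite -EFinM.
    rewrite (ge0_symfun_integralT (f := fun x => h x * normal_pdf 0 s x)).
    + rewrite [in RHS]integral_mkcond; congr (_ * _)%E; apply: eq_integral => x _.
      by rewrite /patch; case: ifP => //; rewrite mul0e.
    + by move=> x; rewrite mulr_ge0// normal_pdf_ge0.
    + by move=> x; apply: cvgM; [exact: ch|exact: continuous_normal_pdf].
    + by move=> x /=; rewrite hN !normal_pdf_expE// !subr0 sqrrN.
  move: half; case: (integral _ _ _) => [r| |].
  - by rewrite -EFinM => -[<-]; rewrite mulrA mulVf// mul1r.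
  - by rewrite gt0_muley ?lte_fin.
  - by rewrite gt0_muleNy ?lte_fin.
have : (\int[N s]_(z in [set z | (z < 0)%R]) (h z)%:E + (2^-1 * c)%:E = c%:E)%E.
  rewrite -pos -ge0_integral_setU//; last 3 first.
  - exact/measurable_funTS/measurable_EFinP.
  - by move=> z _; rewrite lee_fin.
  - by apply/disj_setPS => z [] /= z0; rewrite leNgt z0.
  rewrite (_ : _ `|` _ = setT) ?hc//.
  by apply/seteqP; split => z //= _; have [|] := ltP z 0; [left|right].
move: (\int[N s]_(z in [set z | (z < 0)%R]) (h z)%:E)%E => [r| |] //.
by case=> rc; congr EFin; lra.
Qed.

(** With x = -z > 0, V the exponential variable and r = exp(- V / x), the inequality 1 - V / x <= r
    bounds the positive part of x - V by r x. Convexity gives exp(k r x) <= 1 + r (exp(k x) - 1),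
    and the mean of [r] is at most x / (x + b). *)
Lemma integral_expR_expvar_neg (b k z : R) : 0 <= b -> 0 <= k ->
  (\int[N 1]_g (expR (k * Num.max 0 (- (expvar b g + z))))%:E <=
   (if z < 0 then 1 + - z / (- z + b) * (expR (k * - z) - 1) else 1)%:E)%E.
Proof.
move=> b0 k0; case: ltP => z0; last first.
  under eq_integral.
    move=> g _.
    rewrite max_l ?mulr0 ?expR0; last by rewrite oppr_le0 addr_ge0// expvar_ge0.
    over.
  by rewrite integral_cst_prob.
pose x := - z; have x0 : 0 < x by rewrite oppr_gt0.
rewrite -/x.
have e0 : 0 <= expR (k * x) - 1.
  by rewrite subr_ge0 -expR0 ler_expR mulr_ge0// ltW.
have mr : measurable_fun [set: R] (fun g => expR (b / x * lnw g)).
  by apply: measurableT_comp => //; apply: measurable_funM => //; exact: measurable_lnw.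
apply: (@le_trans _ _ (\int[N 1]_g (1%:E +
    (expR (k * x) - 1)%:E * (expR (b / x * lnw g))%:E))%E).
  apply: ge0_le_integral => //.
  - apply: mexp; apply: measurable_funM => //; apply: measurable_maxr => //.
    by apply: measurableT_comp => //; apply: measurable_funD => //; exact: measurable_expvar.
  - by apply: emeasurable_funD => //; apply: emeasurable_funM => //; exact/measurable_EFinP.
  - move=> g _; rewrite -EFinM -EFinD lee_fin.
    set r := expR (b / x * lnw g).
    have r1 : r <= 1.
      by rewrite -expR0 ler_expR mulr_ge0_le0 ?lnw_le0// divr_ge0// ltW.
    have r0 : 0 <= r by exact: expR_ge0.
    have H : Num.max 0 (- (expvar b g + z)) <= r * x.
      rewrite ge_max mulr_ge0 ?(ltW x0)//=.
      have : 1 + b / x * lnw g <= r by exact: expR_ge1Dx.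
      rewrite -(@ler_pM2r _ x)//; apply: le_trans.
      by rewrite /expvar /x le_eqVlt; apply/orP; left; apply/eqP; field; rewrite lt_eqF.
    apply: (@le_trans _ _ (expR (r * (k * x)))).
      by rewrite ler_expR mulrCA ler_wpM2l.
    apply: (le_trans (expR_convex _ _)); first by rewrite r0.
    by rewrite le_eqVlt; apply/orP; left; apply/eqP; ring.
rewrite ge0_integralD//; last 2 first.
- by move=> g _; rewrite -EFinM lee_fin mulr_ge0 ?expR_ge0.
- by apply: emeasurable_funM => //; exact/measurable_EFinP.
rewrite integral_cst_prob ge0_integralZl//; last exact/measurable_EFinP.
rewrite [leRHS]EFinD leeD2l// (mulrC (x / _)) [leRHS]EFinM; apply: lee_wpmul2l => //.
have -> : x / (x + b) = (1 + b / x)^-1 by field; rewrite gt_eqF//= gt_eqF// ltr_wpDr.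
apply: integral_expR_lnw_le; apply: (@lt_le_trans _ _ 0); first lra.
by rewrite divr_ge0// ltW.
Qed.

(** The fraction x^2 / (x + b) has no explicit Gaussian mean, so it is replaced by (s^2 + x^2) / (b
    + 2 s). Cross-multiplied, the gap is s^2 b + x (x - s)^2. In [near_miss2_kernel] this majorant
    yields exactly the slope s / (b + s). *)
Lemma expR_neg_part_le (b s c t x : R) : 0 <= b -> 0 < s -> 0 <= c -> 0 <= t -> 0 < x ->
  x / (x + b) * (expR (t * c * x) - 1) <=
  (expR (2 * (t * c) ^+ 2 * x ^+ 2) - 1) +
  c / (b + 2 * s) * (s ^+ 2 * t + (expR (t * x ^+ 2) - 1)).
Proof.
move=> b0 s0 c0 t0 x0.
have xb : 0 < x + b by rewrite ltr_wpDr.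
have bs : 0 < b + 2 * s by rewrite ltr_wpDl// mulr_gt0.
have r1 : x / (x + b) <= 1 by rewrite ler_pdivrMr// mul1r lerDl.
have r0 : 0 <= x / (x + b) by rewrite divr_ge0// ltW.
have tx : 0 <= t * c * x by rewrite !mulr_ge0// ltW.
apply: (@le_trans _ _ (x / (x + b) * (t * c * x + (expR (2 * (t * c * x) ^+ 2) - 1)))).
  by rewrite ler_wpM2l// addrA lerD2r; exact: expR_le_sqr.
rewrite mulrDr addrC (_ : 2 * (t * c * x) ^+ 2 = 2 * (t * c) ^+ 2 * x ^+ 2); last by ring.
apply: lerD.
  apply: ler_piMl => //; rewrite subr_ge0 -[leLHS]expR0 ler_expR.
  by apply: mulr_ge0; [apply: mulr_ge0 => //|]; exact: sqr_ge0.
have tE : t * x ^+ 2 <= expR (t * x ^+ 2) - 1 by have := expR_ge1Dx (t * x ^+ 2); lra.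
apply: (@le_trans _ _ (c / (b + 2 * s) * (s ^+ 2 * t + t * x ^+ 2))); last first.
  by apply: ler_wpM2l; [rewrite divr_ge0// ltW|rewrite lerD2l].
rewrite [leLHS](_ : _ = c * t * (x ^+ 2 / (x + b))); last by field; rewrite gt_eqF.
rewrite [leRHS](_ : _ = c * t * ((s ^+ 2 + x ^+ 2) / (b + 2 * s))); last first.
  by field; rewrite gt_eqF.
apply: ler_wpM2l; first exact: mulr_ge0.
rewrite ler_pdivrMr// mulrAC ler_pdivlMr// -subr_ge0.
rewrite [X in 0 <= X](_ : _ = s ^+ 2 * b + x * (x - s) ^+ 2); last ring.
by apply: addr_ge0; apply: mulr_ge0 => //; rewrite ?sqr_ge0// ltW.
Qed.

(** The output term is bounded by its right branch alone, which is linear and lets the cloud factor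
    out. The left branch of the other minimum becomes a multiple of the negative part of [t]. *)
Lemma score2_ge (be S s u t : R) : 0 < be -> 0 < s ->
  - score2 be S s u (u + t) <= - ln ((S + s) / (be + s)) + (be^-1 - S^-1) * t +
    (be^-1 + s^-1) * Num.max 0 (- t) - S^-1 * u.
Proof.
move=> be0 s0; rewrite /score2 [u + t - u]addrAC subrr add0r.
set L := ln _.
have h1 : Num.min (- (u + t) / S) ((u + t) / s) <= - (u + t) / S by rewrite ge_min lexx.
have h2 : - (be^-1 * t) - (be^-1 + s^-1) * Num.max 0 (- t) <= Num.min (- t / be) (t / s).
  rewrite le_min; have [t0|t0] := leP 0 t.
    rewrite max_l ?oppr_le0// mulr0 subr0 mulNr mulrC lexx/=.
    by rewrite (@le_trans _ _ 0)// ?oppr_le0 ?divr_ge0// ltW.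
  rewrite max_r ?oppr_ge0 ?(ltW t0)//.
  rewrite (_ : _ - _ = t / s); last by ring.
  rewrite lexx andbT; apply: (@le_trans _ _ 0).
    by rewrite pmulr_lle0 ?invr_gt0// ltW.
  by rewrite divr_ge0 ?oppr_ge0// ltW.
move: h1; rewrite mulNr mulrDl => h1; lra.
Qed.

End cloud_metric_bound.

Section cloud_kernel_bound.
Context (R : realType).
Local Notation N := (normal_prob 0).

Let expE0 (r : R) : (0 <= (expR r)%:E)%E. Proof. by rewrite lee_fin expR_ge0. Qed.

Let mexp (d : measure_display) (T : measurableType d) (f : T -> R) :
  measurable_fun [set: T] f -> measurable_fun [set: T] (fun x => (expR (f x))%:E).
Proof. by move=> mf; apply/measurable_EFinP; exact: measurableT_comp. Qed.

Let integral_quad (s k : R) : 0 < s -> 2 * k * s ^+ 2 < 1 ->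
  (\int[N s]_z (expR (k * z ^+ 2))%:E = ((Num.sqrt (1 - 2 * k * s ^+ 2))^-1)%:E)%E.
Proof.
move=> s0 ks; have := integral_normal_expR_quad 0 s0 ks.
rewrite expr0n/= !mul0r expR0 mulr1 => <-.
by apply: eq_integral => z _; rewrite mul0r addr0.
Qed.

(** Only negative noise contributes beyond the constant 1, and the majorant [h] is even, so it
    contributes half of its full integral. The half is kept for the term of first order in [t]; half
    of X - 1 is rounded up to X - 1, which is of second order. *)
Lemma integral_expR_neg_part_le (b s sg c t : R) : 0 <= b -> 0 < s -> 0 < sg ->
  0 <= c -> 0 <= t -> 4 * c ^+ 2 * sg ^+ 2 * t ^+ 2 < 1 -> 2 * sg ^+ 2 * t < 1 ->
  (\int[N 1]_g \int[N sg]_z (expR (t * c * Num.max 0 (- (expvar b g + z))))%:E <=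
   ((Num.sqrt (1 - 4 * c ^+ 2 * sg ^+ 2 * t ^+ 2))^-1 + c / (2 * (b + 2 * s)) *
     (s ^+ 2 * t + ((Num.sqrt (1 - 2 * sg ^+ 2 * t))^-1 - 1)))%:E)%E.
Proof.
move=> b0 s0 sg0 c0 t0 q1 q2.
pose X : R := (Num.sqrt (1 - 4 * c ^+ 2 * sg ^+ 2 * t ^+ 2))^-1.
pose Y : R := (Num.sqrt (1 - 2 * sg ^+ 2 * t))^-1.
rewrite -/X -/Y.
pose w := c / (b + 2 * s).
have w0 : 0 <= w by rewrite divr_ge0// addr_ge0// mulr_ge0// ltW.
pose h z := (expR (2 * (t * c) ^+ 2 * z ^+ 2) - 1) + w * (s ^+ 2 * t + (expR (t * z ^+ 2) - 1)).
have sq0 (r : R) : 0 <= r ^+ 2 by exact: sqr_ge0.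
have exp1 (r : R) : 0 <= r -> 0 <= expR r - 1.
  by move=> r0; rewrite subr_ge0 -[leLHS]expR0 ler_expR.
have h0 z : 0 <= h z.
  apply: addr_ge0; first by apply: exp1; rewrite mulr_ge0// mulr_ge0.
  by apply: mulr_ge0 => //; apply: addr_ge0; [exact: mulr_ge0|exact/exp1/mulr_ge0].
have cexp (k : R) : continuous (fun z : R => expR (k * z ^+ 2)).
  move=> z; apply: continuous_comp; last exact: continuous_expR.
  by apply: cvgM; [exact: cvg_cst|exact: exprn_continuous].
have ch : continuous h.
  move=> z; apply: cvgD; first by apply: cvgB; [exact: cexp|exact: cvg_cst].
  apply: cvgM; first exact: cvg_cst.
  apply: cvgD; first exact: cvg_cst.
  by apply: cvgB; [exact: cexp|exact: cvg_cst].
have mh : measurable_fun [set: R] h by exact: continuous_measurable_fun.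
have mexp2 k : measurable_fun [set: R] (fun z => (expR (k * z ^+ 2))%:E).
  by apply/measurable_EFinP; apply: continuous_measurable_fun; exact: cexp.
have hX : (\int[N sg]_z (expR (2 * (t * c) ^+ 2 * z ^+ 2))%:E = X%:E)%E.
  rewrite integral_quad//; last by rewrite (_ : _ * _ = 4 * c ^+ 2 * sg ^+ 2 * t ^+ 2)//; ring.
  by rewrite /X; congr ((Num.sqrt _)^-1)%:E; ring.
have hY : (\int[N sg]_z (expR (t * z ^+ 2))%:E = Y%:E)%E.
  rewrite integral_quad//; last by rewrite (_ : _ * _ = 2 * sg ^+ 2 * t)//; ring.
  by rewrite /Y; congr ((Num.sqrt _)^-1)%:E; ring.
have hE : (\int[N sg]_z (h z)%:E = (X - 1 + w * (s ^+ 2 * t + (Y - 1)))%:E)%E.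
  have : (\int[N sg]_z (h z)%:E + (1 + w)%:E = (X + (w * (s ^+ 2 * t) + w * Y))%:E)%E.
    rewrite -[(1 + w)%:E](integral_cst_prob (N sg)) -ge0_integralD//; last 3 first.
    - by move=> z _; rewrite lee_fin.
    - exact/measurable_EFinP.
    - by move=> z _; rewrite lee_fin addr_ge0.
    have wst : (0 <= (w * (s ^+ 2 * t))%:E)%E.
      by rewrite lee_fin; apply: mulr_ge0 => //; exact: mulr_ge0.
    transitivity (\int[N sg]_z ((expR (2 * (t * c) ^+ 2 * z ^+ 2))%:E +
        ((w * (s ^+ 2 * t))%:E + w%:E * (expR (t * z ^+ 2))%:E)))%E.
      by apply: eq_integral => z _; rewrite -EFinM -!EFinD; congr EFin; rewrite /h; ring.
    have mw : measurable_fun [set: R] (fun z => (w%:E * (expR (t * z ^+ 2))%:E)%E).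
      exact: emeasurable_funM.
    have Y0 z : (0 <= w%:E * (expR (t * z ^+ 2))%:E)%E.
      by rewrite -EFinM lee_fin mulr_ge0 ?expR_ge0.
    rewrite ge0_integralD//; last 3 first.
    - exact: mexp2.
    - by move=> z _; exact: adde_ge0.
    - exact: emeasurable_funD.
    rewrite ge0_integralD// ge0_integralZl//; last exact: mexp2.
    rewrite (EFinD X) (EFinD (w * _) (w * Y)) (EFinM w Y).
    congr (_ + (_ + _ * _))%E; [exact: hX|exact: (integral_cst_prob (N sg))|exact: hY].
  move: (\int[N sg]_z (h z)%:E)%E => [r| |] //.
  by case=> rE; congr EFin; lra.
have X1 : 1 <= X.
  rewrite invf_ge1 ?sqrtr_gt0 ?subr_gt0// -[leRHS]sqrtr1 ler_wsqrtr// gerBl.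
  by rewrite mulr_ge0// mulr_ge0// mulr_ge0.
have mneg : measurable [set z : R | z < 0] by rewrite -set_itvNyo.
have mk : measurable_fun [set: R * R]
    (fun p => (expR (t * c * Num.max 0 (- (expvar b p.1 + p.2))))%:E).
  apply: mexp; apply: measurable_funM => //; apply: measurable_maxr => //.
  apply: measurableT_comp => //; apply: measurable_funD => //.
  by apply: (measurableT_comp (measurable_expvar b)).
rewrite (fubini_tonelli (m1 := N 1) (m2 := N sg) _ mk)//.
apply: (@le_trans _ _ (\int[N sg]_z (1%E + ((fun z => (h z)%:E) \_ [set z | (z < 0)%R]) z))%E).
  have mr : measurable_fun [set: R] ((fun z => (h z)%:E) \_ [set z | (z < 0)%R]).
    apply/(measurable_restrictT (fun z => (h z)%:E) mneg)/measurable_funTS.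
    exact/measurable_EFinP.
  apply: ge0_le_integral => //.
  - by move=> z _; apply: integral_ge0 => g _; exact: expE0.
  - exact: (measurable_fun_fubini_tonelli_G (m1 := N 1) _ mk (fun=> expE0 _)).
  - exact: emeasurable_funD.
  - move=> z _; apply: (le_trans (integral_expR_expvar_neg z b0 (mulr_ge0 t0 c0))).
    rewrite /patch; case: ltP => z0; last by rewrite ifF ?adde0// memNset//= ltNge z0.
    rewrite mem_set// -EFinD lee_fin lerD2l.
    have := @expR_neg_part_le R b s c t (- z) b0 s0 c0 t0.
    by rewrite oppr_gt0 !sqrrN => /(_ z0).
rewrite ge0_integralD//; last 2 first.
- by move=> z _; apply: erestrict_ge0 => y _; rewrite lee_fin.
- apply/(measurable_restrictT (fun z => (h z)%:E) mneg)/measurable_funTS.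
  exact/measurable_EFinP.
rewrite (integral_cst_prob (N sg)) -integral_mkcond (@integral_normal_neg _ sg _ h _ ch h0 _ hE) ?gt_eqF//.
  rewrite -EFinD lee_fin.
  have -> : c / (2 * (b + 2 * s)) = 2^-1 * w by rewrite /w; field; rewrite gt_eqF// ltr_wpDl// mulr_gt0.
  lra.
by move=> z; rewrite /h sqrrN.
Qed.

Let amgm3 (x y z : R) : 0 <= x -> 0 <= y -> 0 <= z ->
  x * y * z <= 3^-1 * (x ^+ 3 + y ^+ 3 + z ^+ 3).
Proof.
move=> x0 y0 z0; rewrite -subr_ge0 (_ : _ - _ = 6^-1 * ((x + y + z) *
  ((x - y) ^+ 2 + (y - z) ^+ 2 + (z - x) ^+ 2))); last by field.
by apply: mulr_ge0 => //; apply: mulr_ge0; do ?apply: addr_ge0 => //; rewrite sqr_ge0.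
Qed.

(** By [score2_ge] the cloud factors out, and three dependent factors remain: those of the
    satellite, of the noise, and of the negative part of their sum. The inequality of arithmetic and
    geometric means separates them by tripling the exponent. At first order this is free, since
    three thirds of a tripled slope give the sum of the slopes. *)
Lemma miss2_kernel_bound (b m s sg gam th : R) (S0 : 0 < m + s) :
  let be := b + s in let S := m + s in let p := be / S in
  let eta := be^-1 - S^-1 in let c := be^-1 + s^-1 in
  0 <= b -> b <= m -> 0 < s -> 0 < sg -> 0 <= th -> eta * b * (3 * th) < 1 ->
  4 * c ^+ 2 * sg ^+ 2 * (3 * th) ^+ 2 < 1 -> 2 * sg ^+ 2 * (3 * th) < 1 ->
  (\int[cloud_law p S0]_x \int[N 1]_g miss2_kernel th gam (@cloud R) (expvar b)
      (fun x y => score2 be S s (cloud x) y) sg (x, g) <=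
   (expR ((gam - ln ((S + s) / (be + s))) * th) * (p + (1 - p) * (1 - -1 * th)^-1) *
    (3^-1 * ((1 - eta * b * (3 * th))^-1 + expR (eta ^+ 2 * sg ^+ 2 / 2 * (3 * th) ^+ 2) +
     ((Num.sqrt (1 - 4 * c ^+ 2 * sg ^+ 2 * (3 * th) ^+ 2))^-1 + c / (2 * (b + 2 * s)) *
       (s ^+ 2 * (3 * th) + ((Num.sqrt (1 - 2 * sg ^+ 2 * (3 * th)))^-1 - 1))))))%:E)%E.
Proof.
move=> be S p eta c b0 bm s0 sg0 th0 q0 q1 q2.
have be0 : 0 < be by rewrite ltr_wpDl.
have beS : be <= S by rewrite lerD2r.
have c0 : 0 <= c by rewrite addr_ge0// invr_ge0 ltW.
have eta0 : 0 <= eta by rewrite subr_ge0 lef_pV2.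
have p01 : 0 <= p <= 1.
  apply/andP; split; first by rewrite divr_ge0// ltW.
  by rewrite ler_pdivrMr// mul1r.
pose t := 3 * th; rewrite -/t in q0 q1 q2 *.
have t0 : 0 <= t by rewrite mulr_ge0.
set C := _ + c / _ * _; set B := expR (_ * t ^+ 2); set A := (_ - _ * t)^-1.
pose L := ln ((S + s) / (be + s)); rewrite -/L.
pose K := expR ((gam - L) * th).
pose e1 g := expR (t * eta * expvar b g).
pose e2 z := expR (t * eta * z).
pose e3 g z := expR (t * c * Num.max 0 (- (expvar b g + z))).
pose F g z := 3^-1 * (e1 g + e2 z + e3 g z).
have F0 g z : 0 <= F g z.
  by apply: mulr_ge0 => //; apply: addr_ge0; [apply: addr_ge0|]; exact: expR_ge0.
have m1 : measurable_fun [set: R] e1.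
  by apply: measurableT_comp => //; apply: measurable_funM => //; exact: measurable_expvar.
have m2 : measurable_fun [set: R] e2.
  by apply: measurableT_comp => //; exact: measurable_funM.
have m3 : measurable_fun [set: R * R] (fun q => e3 q.1 q.2).
  apply: measurableT_comp => //; apply: measurable_funM => //; apply: measurable_maxr => //.
  apply: measurableT_comp => //; apply: measurable_funD => //.
  by apply: (measurableT_comp (measurable_expvar b)).
have mF : measurable_fun [set: R * R] (fun q => F q.1 q.2).
  apply: measurable_funM => //; apply: measurable_funD => //; apply: measurable_funD.
    by apply: (measurableT_comp m1).
  by apply: (measurableT_comp m2).
have mkm : measurable_fun [set: (bool * R) * R] (miss2_kernel th gam (@cloud R) (expvar b)
    (fun x y => score2 be S s (cloud x) y) sg).
  apply: measurable_miss2_kernel.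
  - exact: measurable_cloud.
  - exact: measurable_expvar.
  - apply: (measurableT_comp (measurable_score2 be S s) (g := fun q => (cloud q.1, q.2))).
    by apply: measurable_fun_pair => //; apply: (measurableT_comp (@measurable_cloud R)).
have IF : (\int[N 1]_g \int[N sg]_z (F g z)%:E <= (3^-1 * (A + B + C))%:E)%E.
  have E1 : (\int[N 1]_g (e1 g)%:E <= A%:E)%E.
    have tb : t * eta * b < 1 by rewrite [t * _]mulrC mulrAC.
    apply: (le_trans (integral_expR_expvar_le tb)).
    by rewrite lee_fin le_eqVlt; apply/orP; left; apply/eqP; congr (_^-1); ring.
  have E2 : (\int[N sg]_z (e2 z)%:E = B%:E)%E.
    have := @integral_normal_expR_quad R sg 0 (t * eta) sg0.
    rewrite mulr0 mul0r subr0 sqrtr1 invr1 mul1r mulr1 => /(_ ltr01) H.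
    transitivity (\int[N sg]_z (expR (0 * z ^+ 2 + t * eta * z))%:E)%E.
      by apply: eq_integral => z _; rewrite mul0r add0r.
    by rewrite H; congr (expR _)%:E; ring.
  have E3 := integral_expR_neg_part_le b0 s0 sg0 c0 t0 q1 q2.
  have A0 : 0 <= A by rewrite -lee_fin (le_trans _ E1)// integral_ge0// => g _; exact: expE0.
  have mE3 : measurable_fun [set: R] (fun g => \int[N sg]_z (e3 g z)%:E)%E.
    apply: (measurable_fun_fubini_tonelli_F (m2 := N sg) (fun q => (e3 q.1 q.2)%:E)).
      exact/measurable_EFinP.
    by move=> q; exact: expE0.
  have I30 g : (0 <= \int[N sg]_z (e3 g z)%:E)%E.
    by apply: integral_ge0 => z _; exact: expE0.
  have inner g : (\int[N sg]_z (F g z)%:E =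
      (3^-1)%:E * ((e1 g)%:E + (B%:E + \int[N sg]_z (e3 g z)%:E)))%E.
    have m3g : measurable_fun [set: R] (fun z => (e3 g z)%:E).
      by apply/measurable_EFinP; exact: (measurable_fun_pair2 g m3).
    have m2' : measurable_fun [set: R] (fun z => (e2 z)%:E) by exact/measurable_EFinP.
    transitivity (\int[N sg]_z ((3^-1)%:E * ((e1 g)%:E + ((e2 z)%:E + (e3 g z)%:E))))%E.
      by apply: eq_integral => z _; rewrite -!EFinD -EFinM /F !addrA.
    rewrite ge0_integralZl//; last 2 first.
    - by apply: emeasurable_funD => //; exact: emeasurable_funD.
    - by move=> z _; rewrite -!EFinD lee_fin !addr_ge0 ?expR_ge0.
    congr (_ * _)%E; rewrite ge0_integralD//; last 3 first.
    - by move=> z _; exact: expE0.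
    - by move=> z _; rewrite -EFinD lee_fin addr_ge0 ?expR_ge0.
    - exact: emeasurable_funD.
    congr (_ + _)%E; first exact: (integral_cst_prob (N sg)).
    rewrite ge0_integralD//; last 2 first.
    - by move=> z _; exact: expE0.
    - by move=> z _; exact: expE0.
    by congr (_ + _)%E; exact: E2.
  under eq_integral do rewrite inner.
  have B0 : 0 <= B by exact: expR_ge0.
  have m1' : measurable_fun [set: R] (fun g => (e1 g)%:E) by exact/measurable_EFinP.
  rewrite ge0_integralZl//; last 2 first.
  - by apply: emeasurable_funD => //; apply: emeasurable_funD.
  - by move=> g _; apply: adde_ge0; [exact: expE0|exact: adde_ge0].
  rewrite [leRHS]EFinM; apply: lee_wpmul2l; first by rewrite lee_fin.
  rewrite ge0_integralD//; last 3 first.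
  - by move=> g _; exact: expE0.
  - by move=> g _; rewrite adde_ge0// lee_fin.
  - exact: emeasurable_funD.
  rewrite (_ : A + B + C = A + (B + C)); last by ring.
  rewrite [leRHS]EFinD; apply: leeD => //.
  rewrite ge0_integralD//.
  rewrite [leRHS]EFinD; apply: leeD; last exact: E3.
  by have -> := integral_cst_prob (N 1) B%:E.
have I x : (\int[N 1]_g miss2_kernel th gam (@cloud R) (expvar b)
      (fun x y => score2 be S s (cloud x) y) sg (x, g) <=
    (expR (- S^-1 * th * cloud x))%:E * (K * (3^-1 * (A + B + C)))%:E)%E.
  pose k := (expR (- S^-1 * th * cloud x) * K)%:E.
  have k0 : (0 <= k)%E by rewrite lee_fin mulr_ge0 ?expR_ge0.
  have mFx : measurable_fun [set: R] (fun g => \int[N sg]_z (F g z)%:E)%E.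
    apply: (measurable_fun_fubini_tonelli_F (m2 := N sg) (fun q => (F q.1 q.2)%:E)).
      exact/measurable_EFinP.
    by move=> q; rewrite lee_fin; exact: F0.
  have FI0 g : (0 <= \int[N sg]_z (F g z)%:E)%E.
    by apply: integral_ge0 => z _; rewrite lee_fin.
  rewrite (_ : (_ * (K * _)%:E)%E = (k * (3^-1 * (A + B + C))%:E)%E); last first.
    by rewrite /k -!EFinM mulrA.
  apply: (@le_trans _ _ (\int[N 1]_g (k * \int[N sg]_z (F g z)%:E))%E); last first.
    rewrite ge0_integralZl//; exact: (lee_wpmul2l k0 IF).
  apply: ge0_le_integral; first exact: measurableT.
  - by move=> g _; apply: integral_ge0 => z _; exact: expE0.
  - exact: (measurable_fun_pair2 x mkm).
  - exact: emeasurable_funM.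
  move=> g _; rewrite /miss2_kernel/=.
  have mFg : measurable_fun [set: R] (fun z => (F g z)%:E).
    by apply/measurable_EFinP; exact: (measurable_fun_pair2 g mF).
  rewrite -ge0_integralZl//; last by move=> z _; rewrite lee_fin.
  apply: ge0_le_integral; first exact: measurableT.
  - by move=> z _; exact: expE0.
  - apply: mexp; apply: measurable_funM => //; apply: measurable_funB => //.
    apply: (measurableT_comp (measurable_fun_pair2 (cloud x) (measurable_score2 be S s))).
    exact: measurable_funD.
  - exact: emeasurable_funM.
  move=> z _; rewrite /k -EFinM lee_fin -addrA.
  have := @score2_ge R be S s (cloud x) (expvar b g + z) be0 s0.
  rewrite -/L -/eta -/c; set D := Num.max 0 _ => H.
  apply: (@le_trans _ _ (expR (- S^-1 * th * cloud x + (gam - L) * th +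
      (th * eta * expvar b g + th * eta * z + th * c * D)))).
    rewrite ler_expR; move: (ler_wpM2l th0 H).
    rewrite -(lerD2l (th * gam)) -mulrDr; move/le_trans; apply.
    by rewrite le_eqVlt; apply/orP; left; apply/eqP; ring.
  rewrite expRD (expRD _ ((gam - L) * th)) -/K; apply: ler_wpM2l.
    by rewrite mulr_ge0 ?expR_ge0.
  rewrite !expRD; apply: (le_trans (amgm3 (expR_ge0 _) (expR_ge0 _) (expR_ge0 _))).
  rewrite -!expRM_natl /F /e1 /e2 /e3 -/D /t.
  by rewrite le_eqVlt; apply/orP; left; apply/eqP; congr (_ * (expR _ + expR _ + expR _)); ring.
apply: (@le_trans _ _ (\int[cloud_law p S0]_x
  ((expR (- S^-1 * th * cloud x))%:E * (K * (3^-1 * (A + B + C)))%:E))%E).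
  apply: ge0_le_integral; first exact: measurableT.
  - by move=> x _; apply: integral_ge0 => g _; apply: integral_ge0 => z _; exact: expE0.
  - apply: (measurable_fun_fubini_tonelli_F (m2 := N 1) _ mkm).
    by move=> q; apply: integral_ge0 => z _; exact: expE0.
  - apply: emeasurable_funM => //; apply: mexp; apply: measurable_funM => //.
    exact: measurable_cloud.
  - by move=> x _; exact: I.
have ABC0 : 0 <= 3^-1 * (A + B + C).
  rewrite -lee_fin; apply: le_trans IF; apply: integral_ge0 => g _.
  by apply: integral_ge0 => z _; rewrite lee_fin.
rewrite ge0_integralZr//; last 2 first.
- by apply: mexp; apply: measurable_funM => //; exact: measurable_cloud.
- by rewrite lee_fin mulr_ge0// expR_ge0.
have Sth : - S^-1 * th * S = - th by field; rewrite gt_eqF.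
rewrite integral_expR_cloud// Sth; last first.
  by apply: (@le_lt_trans _ _ 0) => //; rewrite oppr_le0.
rewrite -EFinM lee_fin le_eqVlt; apply/orP; left; apply/eqP.
by rewrite mulN1r -/K; ring.
Qed.

End cloud_kernel_bound.

(** * Numerical bounds *)

Section numerical_bounds.
Context (R : realType).
Implicit Types (x t : R).

Lemma le_of_is_derive_ge0 (f df : R -> R) x : 0 <= x ->
  (forall t, 0 <= t -> is_derive t (1 : R) f (df t)) ->
  (forall t, 0 <= t -> 0 <= df t) -> f 0 <= f x.
Proof.
move=> x0 fdf df0.
have [||c + fE] := @MVT_segment R f df 0 x x0.
- by move=> t; rewrite in_itv/= => /andP[/ltW t0 _]; exact: fdf.
- apply: derivable_within_continuous => t; rewrite in_itv/= => /andP[t0 _].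
  by have [] := fdf _ t0.
- rewrite in_itv/= => /andP[c0 _].
  by rewrite -subr_ge0 fE subr0 mulr_ge0// df0.
Qed.

Let is_derive_monomial n (a t : R) :
  is_derive t (1 : R) (fun t => a * t ^+ n.+1) (a * (n.+1%:R * t ^+ n)).
Proof.
have h : is_derive t (1 : R) (fun t : R => t ^+ n.+1) ((n.+1%:R * t ^+ n) *: (1 : R)).
  have := is_deriveX n.+1 (is_derive_id t (1 : R)); by rewrite exprfctE.
by have := is_deriveZ a h; rewrite /GRing.scale/= mulr1.
Qed.

Let sin_le x : 0 <= x -> sin x <= x.
Proof.
move=> x0; rewrite -subr_ge0 -[leLHS](_ : 0 - sin 0 = 0); last by rewrite sin0 subr0.
by apply: (@le_of_is_derive_ge0 (fun t => t - sin t) (fun t => 1 - cos t)).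
Qed.

Let cos_ge x : 0 <= x -> 1 - 2^-1 * x ^+ 2 <= cos x.
Proof.
move=> x0; rewrite -subr_ge0 opprB addrA.
rewrite -[leLHS](_ : cos 0 + 2^-1 * 0 ^+ 2 - 1 = 0); last by rewrite cos0 expr0n/= mulr0 addr0 subrr.
apply: (@le_of_is_derive_ge0 (fun t => cos t + 2^-1 * t ^+ 2 - 1)
  (fun t => - sin t + 2^-1 * (2 * t ^+ 1) - 0)) => // t t0.
  by apply: is_deriveB; exact: is_deriveD.
by have := sin_le t0; lra.
Qed.

Let sin_ge x : 0 <= x -> x - 6^-1 * x ^+ 3 <= sin x.
Proof.
move=> x0; rewrite -subr_ge0 opprB addrA.
rewrite -[leLHS](_ : sin 0 + 6^-1 * 0 ^+ 3 - 0 = 0); last by rewrite sin0 expr0n/= mulr0 !addr0 subr0.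
apply: (@le_of_is_derive_ge0 (fun t => sin t + 6^-1 * t ^+ 3 - t)
  (fun t => cos t + 6^-1 * (3 * t ^+ 2) - 1)) => // t t0.
  by apply: is_deriveB; exact: is_deriveD.
by have := cos_ge t0; lra.
Qed.

Let cos_le x : 0 <= x -> cos x <= 1 - 2^-1 * x ^+ 2 + 24^-1 * x ^+ 4.
Proof.
move=> x0; rewrite -subr_ge0.
rewrite -[leLHS](_ : 1 - 2^-1 * 0 ^+ 2 + 24^-1 * 0 ^+ 4 - cos 0 = 0); last first.
  by rewrite cos0 !expr0n/= !mulr0 subr0 addr0 subrr.
apply: (@le_of_is_derive_ge0 (fun t => 1 - 2^-1 * t ^+ 2 + 24^-1 * t ^+ 4 - cos t)
  (fun t => 0 - 2^-1 * (2 * t ^+ 1) + 24^-1 * (4 * t ^+ 3) - - sin t)) => // t t0.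
  apply: is_deriveB; apply: is_deriveD; last exact: is_derive_monomial.
  exact: is_deriveB.
by have := sin_ge t0; lra.
Qed.

(** The Taylor bound on the cosine is negative at 33/20. Together with [expR1_ge] this gives 2 pi /
    e <= 22/9, the estimate that [R2_in_le] rests on. *)
Lemma pi_le : pi <= 33 / 10 :> R.
Proof.
rewrite leNgt; apply/negP => pi_gt.
have : 0 < cos (33 / 20 : R) by apply: cos_gt0_pihalf; apply/andP; split; lra.
by have := @cos_le (33 / 20) ltac:(lra); lra.
Qed.

Lemma expR1_ge : 27 / 10 <= expR 1 :> R.
Proof.
have h : 1 + (1 / 8) + 2^-1 * (1 / 8) ^+ 2 <= expR (1 / 8 : R).
  rewrite -subr_ge0 -[leLHS](_ : expR 0 - (1 + 0 + 2^-1 * 0 ^+ 2) = 0); last first.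
    by rewrite expR0 expr0n/= mulr0 !addr0 subrr.
  apply: (@le_of_is_derive_ge0 (fun t => expR t - (1 + t + 2^-1 * t ^+ 2))
    (fun t => expR t - (0 + 1 + 2^-1 * (2 * t ^+ 1)))) => [|t _|t t0]; first by lra.
    by apply: is_deriveB; apply: is_deriveD; exact: is_derive_monomial.
  by have := expR_ge1Dx t; lra.
rewrite [X in expR X](_ : 1 = 8%:R * (1 / 8)); last by field.
rewrite expRM_natl.
apply: (@le_trans _ _ ((1 + 1 / 8 + 2^-1 * (1 / 8) ^+ 2) ^+ 8)); first by lra.
by rewrite lerXn2r ?nnegrE//; lra.
Qed.

Lemma ln_ge_div (r : R) : 1 <= r -> 2 * (r - 1) / (r + 1) <= ln r.
Proof.
move=> r1; have y0 : 0 <= r - 1 by rewrite subr_ge0.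
suff : 0 <= ln (1 + (r - 1)) - (2 - 4 * (2 + (r - 1))^-1).
  rewrite subr_ge0 (_ : 1 + (r - 1) = r); last by ring.
  apply: le_trans.
  rewrite le_eqVlt; apply/orP; left; apply/eqP; field.
  by do ?[apply/andP; split]; apply/eqP; lra.
rewrite -[leLHS](_ : ln (1 + 0) - (2 - 4 * (2 + 0)^-1) = 0); last first.
  by rewrite addr0 ln1; field.
apply: (@le_of_is_derive_ge0 (fun y => ln (1 + y) - (2 - 4 * (2 + y)^-1))
  (fun y => (1 + y)^-1 * 1 - (0 - 4 * (- (2 + y) ^- 2 * 1)))) => // t t0.
- have h1 : is_derive t (1 : R) (fun y => 1 + y) (1 : R).
    by rewrite -[X in is_derive _ _ _ X]add0r; exact: is_deriveD.
  have h2 : is_derive t (1 : R) (fun y => 2 + y) (1 : R).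
    by rewrite -[X in is_derive _ _ _ X]add0r; exact: is_deriveD.
  have p1 : 0 < 1 + t by lra.
  have h3 := @is_derive1_comp _ (@ln R) (fun y => 1 + y) _ _ _ (is_derive1_ln p1) h1.
  have p2 : 2 + t != 0 by apply/eqP; lra.
  have h4 : is_derive t (1 : R) (fun y => (2 + y)^-1) (- (2 + t) ^- 2 * 1).
    exact: (is_deriveV p2 h2).
  apply: is_deriveB => //; apply: is_deriveB; exact: (is_deriveZ 4 h4).
- rewrite (_ : _ - _ = t ^+ 2 / ((1 + t) * (2 + t) ^+ 2)); last first.
    by field; do ?[apply/andP; split]; apply/eqP; lra.
  by rewrite divr_ge0 ?sqr_ge0// mulr_ge0 ?sqr_ge0//; lra.
Qed.

(** With x = m / s and c = 2 pi / e, the dependence on [rho] cancels and the claim is 2 / (x + 1) <=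
    ln ((x + 2)^2 / (x^2 + c)). It fails for small x, but positivity of the rate forces x^2 + c > 4.
    Near that boundary, with c = 22/9, the bound [ln_ge_div] leaves a margin of about one percent,
    and ln r >= 1 - 1 / r would not do. *)
Lemma R2_in_le (s m rho : R) : 0 < s -> 0 < m -> 0 <= rho -> 0 < R2_in s m rho ->
  R2_in s m rho <= ln ((m + 2 * s) / (rho * m + 2 * s)) - s / (m + s).
Proof.
move=> s0 m0 rho0; rewrite /R2_in /C_ub -mulrBr.
move: (pi : R) (pi_gt0 R) pi_le => q q0 q_le.
move: (expR 1 : R) (expR_gt0 (1 : R)) expR1_ge => e e0 e_ge.
have q20 : 0 < 2 * q by rewrite mulr_gt0.
pose c := 2 * q / e; pose x := m / s; pose a := rho * m / s.
have x0 : 0 < x by rewrite divr_gt0.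
have a0 : 0 <= a by rewrite divr_ge0 ?mulr_ge0// ltW.
have c0 : 0 < c by rewrite divr_gt0// mulr_gt0.
have cle : c <= 22 / 9.
  rewrite ler_pdivrMr//; lra.
have xc0 : 0 < x ^+ 2 + c by rewrite ltr_wpDl ?sqr_ge0.
have a20 : 0 < 2 + a by lra.
have -> : 1 + e * m ^+ 2 / (2 * q * s ^+ 2) = (x ^+ 2 + c) / c.
  by rewrite /c /x; field; rewrite !gt_eqF.
have -> : e / (2 * q) * (2 + rho * m / s) ^+ 2 = (2 + a) ^+ 2 / c.
  by rewrite /c /a; field; rewrite !gt_eqF.
rewrite -ln_div ?posrE ?divr_gt0 ?exprn_gt0//.
rewrite (_ : _ / c / _ = (x ^+ 2 + c) / (2 + a) ^+ 2); last first.
  by field; rewrite !gt_eqF.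
move=> Rpos; have xc : 4 < x ^+ 2 + c.
  have : 1 < (x ^+ 2 + c) / (2 + a) ^+ 2.
    rewrite -ltr_ln ?posrE ?divr_gt0 ?exprn_gt0// ln1; lra.
  rewrite ltr_pdivlMr ?exprn_gt0// mul1r; apply: le_lt_trans; nra.
have -> : (m + 2 * s) / (rho * m + 2 * s) = (x + 2) / (2 + a).
  have rm0 : 0 <= rho * m by rewrite mulr_ge0// ltW.
  by rewrite /x /a; field; do ?[apply/andP; split]; apply/eqP; lra.
have -> : s / (m + s) = (x + 1)^-1.
  by rewrite /x; field; rewrite !gt_eqF ?addr_gt0.
rewrite !ln_div ?posrE ?exprn_gt0//; last lra.
rewrite lnXn//.
suff : 2 / (x + 1) <= ln ((x + 2) ^+ 2 / (x ^+ 2 + c)).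
  rewrite ln_div ?posrE ?exprn_gt0//; last lra.
  by rewrite lnXn//; lra.
have r1 : 1 <= (x + 2) ^+ 2 / (x ^+ 2 + c) by rewrite ler_pdivlMr// mul1r; nra.
apply: le_trans (ln_ge_div r1).
have x1 : 0 < x + 1 by lra.
rewrite ler_pdivrMr//.
rewrite (_ : 2 * _ / _ * _ = 2 * (((4 * x + 4 - c) * (x + 1)) / (2 * x ^+ 2 + 4 * x + 4 + c))); last first.
  by field; do ?[apply/andP; split]; apply/eqP; nra.
rewrite ler_peMr// ler_pdivlMr; nra.
Qed.

End numerical_bounds.

(** * Achievability *)

Section error_exponents.
Context (R : realType).
Local Notation N := (normal_prob 0).
Implicit Types (b s m E rho : R).

Lemma lin_le_near (f : R -> R) (a : R) : lin_le f a -> a < 0 ->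
  \forall t \near 0^'+, f t < 1.
Proof.
move=> fa a0; have [t0 t00 H] := lin_le_lt1 fa a0; near=> t; apply: H; near: t; [exact: nbhs_right_gt|exact: nbhs_right_le].
Unshelve. all: by end_near. Qed.

Let near_mul_lt1 (k : R) : \forall t \near (0 : R)^'+, k * t < 1.
Proof.
have k0 : 0 < `|k| + 1 by rewrite ltr_wpDl.
near=> t; have t0 : 0 < t by near: t; exact: nbhs_right_gt.
apply: (@le_lt_trans _ _ (`|k| * t)); first by rewrite ler_wpM2r ?ler_norm// ltW.
apply: (@lt_le_trans _ _ ((`|k| + 1) * t)); first by rewrite ltr_pM2r// ltrDl.
rewrite mulrC -ler_pdivlMr// div1r; near: t; apply: nbhs_right_le.
by rewrite invr_gt0.
Unshelve. all: by end_near. Qed.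

Let near_mul_sqr_lt1 (k : R) : 0 <= k -> \forall t \near (0 : R)^'+, k * t ^+ 2 < 1.
Proof.
move=> k0; near=> t; have t0 : 0 < t by near: t; exact: nbhs_right_gt.
have t1 : t <= 1 by near: t; exact: nbhs_right_le.
apply: (@le_lt_trans _ _ (k * t)); last by near: t; exact: near_mul_lt1.
by rewrite ler_wpM2l// expr2 ler_piMl// ltW.
Unshelve. all: by end_near. Qed.

Section scheme.
Variables (b m s : R).
Hypotheses (b_ge0 : 0 <= b) (b_le : b <= m) (s_gt0 : 0 < s) (S_gt0 : 0 < m + s).

Let p := (b + s) / (m + s).
Let be_gt0 : 0 < b + s. Proof. by rewrite ltr_wpDl. Qed.

Let p01 : 0 <= p <= 1.
Proof.
apply/andP; split; first by rewrite divr_ge0// ltW.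
by rewrite ler_pdivrMr// mul1r lerD2r.
Qed.

Let PU := cloud_law p S_gt0.

(** The slope is the mean of the input minus the budget, m - E: this is why the scheme runs at a
    mean strictly below [E]. *)
Lemma near_power_kernel E : m < E -> \forall th \near (0 : R)^'+, exists2 d : R, d < 1 &
  (\int[PU]_x \int[N 1]_g power_kernel E th (@cloud R) (expvar b) (x, g) <= d%:E)%E.
Proof.
move=> mE.
have F := lin_le_mul (lin_le_mul (lin_le_expR (- E))
  (lin_le_affine p01 (lin_le_inv (m + s)))) (lin_le_inv b).
have sl : - E + (1 - p) * (m + s) + b < 0.
  rewrite (_ : _ + b = m - E); first by rewrite subr_lt0.
  by rewrite /p; field; rewrite gt_eqF.
have Hlt := lin_le_near F sl.
near=> th; exists (expR (- E * th) * (p + (1 - p) * (1 - (m + s) * th)^-1) * (1 - b * th)^-1).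
  by near: th.
by apply: power_kernel_bound => //; rewrite mulrC; near: th; exact: near_mul_lt1.
Unshelve. all: by end_near. Qed.

(** The slopes are - (1 - p) from the cloud, eta b from the satellite, 0 from the noise, and at most
    s / (b + s) from the negative part; they add up to s / (m + s). The noise variance enters only
    the last one, monotonically, so the metric tuned to [s] also works for smaller noise. *)
Lemma near_miss2_kernel (sg gam : R) : 0 < sg <= s ->
  gam < ln ((m + 2 * s) / (b + 2 * s)) - s / (m + s) ->
  \forall th \near (0 : R)^'+, exists2 d : R, d < 1 &
  (\int[PU]_x \int[N 1]_g miss2_kernel th gam (@cloud R) (expvar b)
      (fun x y => score2 (b + s) (m + s) s (cloud x) y) sg (x, g) <= d%:E)%E.
Proof.
move=> /andP[sg0 sgs] gamlt.
pose L := ln ((m + s + s) / (b + s + s)).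
pose eta := (b + s)^-1 - (m + s)^-1; pose c := (b + s)^-1 + s^-1.
pose w := c / (2 * (b + 2 * s)).
have c0 : 0 <= c by rewrite addr_ge0// invr_ge0 ltW.
have w0 : 0 <= w by rewrite divr_ge0// mulr_ge0// addr_ge0// mulr_ge0// ltW.
have k0 : 0 <= 4 * c ^+ 2 * sg ^+ 2 by apply: mulr_ge0; rewrite ?sqr_ge0// mulr_ge0 ?sqr_ge0.
have h0 : 0 <= eta ^+ 2 * sg ^+ 2 / 2 by apply: divr_ge0 => //; apply: mulr_ge0; exact: sqr_ge0.
have l0 : 0 <= 2 * sg ^+ 2 by apply: mulr_ge0 => //; exact: sqr_ge0.
have three : 0 < 3 :> R by [].
have [F1 _] := lin_le_sqrtV_sqr k0; have [F2 F2ge] := lin_le_sqrtV l0.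
have F := lin_le_mul (lin_le_mul (lin_le_expR (gam - L))
  (lin_le_affine p01 (lin_le_inv (-1))))
  (lin_le_scale three (lin_le_avg3 (lin_le_inv (eta * b)) (lin_le_expR_sqr h0)
    (lin_le_comb w0 (sqr_ge0 s) F1 F2 F2ge))).
have sl : gam - L + (1 - p) * -1 +
    3^-1 * (eta * b + 0 + (0 + w * (s ^+ 2 + 2 * sg ^+ 2 / 2))) * 3 < 0.
  have LE : L = ln ((m + 2 * s) / (b + 2 * s)) by rewrite /L; congr ln; congr (_ / _); ring.
  have wle : w * (s ^+ 2 + 2 * sg ^+ 2 / 2) <= w * (2 * s ^+ 2).
    apply: ler_wpM2l => //; have : sg ^+ 2 <= s ^+ 2 by rewrite ler_sqr ?nnegrE// ltW.
    lra.
  have wE : w * (2 * s ^+ 2) = s / (b + s).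
    have bs0 : 0 < b + 2 * s by rewrite ltr_wpDl// mulr_gt0.
    by rewrite /w /c; field; rewrite !gt_eqF.
  have E1 : - (1 - p) + eta * b + s / (b + s) = s / (m + s).
    by rewrite /p /eta; field; rewrite !gt_eqF.
  move: gamlt; rewrite -LE => gamlt; lra.
have Hlt := lin_le_near F sl.
near=> th.
have th0 : 0 < th by near: th; exact: nbhs_right_gt.
eexists; last first.
  apply: (@miss2_kernel_bound R b m s sg gam th S_gt0 b_ge0 b_le s_gt0 sg0 (ltW th0)).
  - rewrite mulrA; near: th; exact: near_mul_lt1.
  - rewrite exprMn mulrA; near: th; apply: near_mul_sqr_lt1.
    by apply: mulr_ge0 => //; exact: sqr_ge0.
  - rewrite mulrA; near: th; exact: near_mul_lt1.
by near: th.
Unshelve. all: by end_near. Qed.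

End scheme.

(** The contributions of be^2 from the constant, the squared noise and the mean of [lnw] cancel, so
    the slope is gam + ln al. *)
Lemma near_miss1_kernel (b s al be gam : R) : 0 < s -> al ^+ 2 + be ^+ 2 = 1 ->
  gam + ln al < 0 -> \forall th \near (0 : R)^'+, exists2 d : R, d < 1 &
  (\int[N 1]_g miss1_kernel s th gam (expvar b) (score1 b s al be) g <= d%:E)%E.
Proof.
move=> s0 albe gamlt.
have k0 : 0 <= 2 * (al ^+ 2 * be ^+ 2).
  by apply: mulr_ge0 => //; apply: mulr_ge0; exact: sqr_ge0.
have [F1 _] := lin_le_sqrtV (sqr_ge0 be); have [F2 F2ge] := lin_le_sqrtV_sqr k0.
have F := lin_le_mul (lin_le_mul (lin_le_expR (gam + ln al + be ^+ 2 / 2)) F1)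
  (lin_le_comb ler01 (lexx 0) (lin_le_inv (- be ^+ 2)) F2 F2ge).
have sl : gam + ln al + be ^+ 2 / 2 + be ^+ 2 / 2 + (- be ^+ 2 + 1 * (0 + 0)) < 0 by lra.
have Hlt := lin_le_near F sl.
near=> th.
have th0 : 0 < th by near: th; exact: nbhs_right_gt.
eexists; last first.
  apply: (miss1_kernel_bound b gam s0 albe (ltW th0)).
  - have : 2 * be ^+ 2 * th < 1 by near: th; exact: near_mul_lt1.
    lra.
  - near: th; exact: near_mul_sqr_lt1.
by near: th.
Unshelve. all: by end_near. Qed.

End error_exponents.

Section coding_below_rates.
Context (R : realType).
Local Notation N := (normal_prob 0).

Let near_trivial_metric : \forall th \near (0 : R)^'+, expR (th * (- 1 - 0)) < 1.
Proof.
near=> th; rewrite -[ltRHS]expR0 ltr_expR subr0 mulrN1 oppr_lt0.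
by near: th; exact: nbhs_right_gt.
Unshelve. all: by end_near. Qed.

Lemma exists_satellite_metric (sigma m rho r : R) :
  0 < sigma -> 0 < m -> 0 <= rho -> 0 <= r -> r = 0 \/ r < R1_in sigma m rho ->
  exists (l : R -> R -> R) (gam : R),
  [/\ measurable_fun [set: R * R] (fun p => l p.1 p.2),
      (forall y, \int[N 1]_g (expR (l g y))%:E <= 1)%E, r = 0 \/ r < gam &
      \forall th \near (0 : R)^'+, exists2 d : R, d < 1 &
        (\int[N 1]_g miss1_kernel sigma th gam (expvar (rho * m)) l g <= d%:E)%E].
Proof.
move=> sigma0 m0 rho0 r0 [->|rR].
  (* The zero score always exceeds the threshold -1, so the only message is never missed. *)
  exists (fun _ _ => 0), (- 1); split; [by [] | | by left | ].
    by move=> y; rewrite expR0; have -> := integral_cst_prob (N 1) 1%E.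
  near=> th; exists (expR (th * (- 1 - 0))).
    by near: th; exact: near_trivial_metric.
  have H g : miss1_kernel sigma th (- 1) (expvar (rho * m)) (fun _ _ => 0) g =
      (expR (th * (- 1 - 0)))%:E := integral_cst_prob (N sigma) _.
  under eq_integral do rewrite H.
  by have -> := integral_cst_prob (N 1) (expR (th * (- 1 - 0)))%:E.
(* The square root of the ratio of entropy powers; [(al, be)] is the unit vector along [(1, k)]. *)
pose k := rho * m / (sigma * Num.sqrt (2 * pi)) * expR (1 / 2).
have pi0 : 0 < Num.sqrt (2 * pi : R) by rewrite sqrtr_gt0 mulr_gt0// pi_gt0.
have kE : k ^+ 2 = expR 1 * rho ^+ 2 * m ^+ 2 / (2 * pi * sigma ^+ 2).
  have -> : expR 1 = expR (1 / 2) ^+ 2 :> R.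
    by rewrite -expRM_natl; congr expR; field.
  rewrite -[2 * pi]sqr_sqrtr; last by rewrite mulr_ge0// pi_ge0.
  rewrite /k; set q := Num.sqrt _; field; by rewrite !gt_eqF.
have RE : R1_in sigma m rho = 2^-1 * ln (1 + k ^+ 2) by rewrite /R1_in kE.
have rho_gt0 : 0 < rho.
  rewrite lt_neqAle rho0 andbT; apply/eqP => rhoE.
  move: rR; rewrite RE /k -rhoE !mul0r expr0n/= addr0 ln1 mulr0 => rR.
  by move: (le_lt_trans r0 rR); rewrite ltxx.
have k0 : 0 < k by rewrite mulr_gt0 ?expR_gt0// divr_gt0 ?mulr_gt0.
have k1 : 0 < 1 + k ^+ 2 by rewrite ltr_wpDr ?sqr_ge0.
pose al := (Num.sqrt (1 + k ^+ 2))^-1; pose be := k * al.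
have al0 : 0 < al by rewrite invr_gt0 sqrtr_gt0.
have be0 : 0 < be by rewrite mulr_gt0.
have albe : al ^+ 2 + be ^+ 2 = 1.
  rewrite /be exprMn -[X in X + _]mul1r -mulrDl /al exprVn sqr_sqrtr ?ltW//.
  by rewrite divff// gt_eqF.
have bal : rho * m * al = be * sigma * Num.sqrt (2 * pi) * expR (- (1 / 2)).
  have e0 := expR_gt0 (1 / 2 : R).
  rewrite /be /k expRN; set q := Num.sqrt _ in pi0 *.
  by field; rewrite !gt_eqF.
have lnal : ln al = - R1_in sigma m rho.
  by rewrite RE /al -powR12_sqrt ?ltW// lnV ?posrE ?powR_gt0// ln_powR.
exists (score1 (rho * m) sigma al be), ((r + R1_in sigma m rho) / 2); split.
- exact: measurable_score1.
- by apply: integral_expR_score1 => //; rewrite mulr_gt0.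
- by right; lra.
- by apply: near_miss1_kernel => //; rewrite lnal; lra.
Unshelve. all: by end_near. Qed.

(** At rate 0 the single centre is still transmitted but is known to both users, so a trivial test
    suffices. A positive gap above r >= 0 makes [R2_in] positive, as [R2_in_le] requires. *)
Lemma exists_cloud_metric (s m rho r : R) (S_gt0 : 0 < m + s) :
  0 < s -> 0 < m -> 0 <= rho <= 1 -> 0 <= r -> r = 0 \/ r < R2_in s m rho ->
  exists (l : bool * R -> R -> R) (gam : R),
  [/\ measurable_fun [set: (bool * R) * R] (fun p => l p.1 p.2),
      (forall y, \int[cloud_law ((rho * m + s) / (m + s)) S_gt0]_x (expR (l x y))%:E <= 1)%E,
      r = 0 \/ r < gam &
      forall sigma, 0 < sigma <= s -> \forall th \near (0 : R)^'+, exists2 d : R, d < 1 &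
        (\int[cloud_law ((rho * m + s) / (m + s)) S_gt0]_x \int[N 1]_g
          miss2_kernel th gam (@cloud R) (expvar (rho * m)) l sigma (x, g) <= d%:E)%E].
Proof.
move=> s0 m0 /andP[rho0 rho1] r0 [->|rR].
  exists (fun _ _ => 0), (- 1); split; [by [] | | by left | ].
    move=> y; rewrite expR0.
    by have -> := integral_cst_prob (cloud_law ((rho * m + s) / (m + s)) S_gt0) 1%E.
  move=> sigma _; near=> th; exists (expR (th * (- 1 - 0))).
    by near: th; exact: near_trivial_metric.
  have H x : (\int[N 1]_g miss2_kernel th (- 1)%R (@cloud R) (expvar (rho * m))
      (fun _ _ => 0%R) sigma (x, g) = (expR (th * (- 1 - 0)))%:E)%E.
    have H g : miss2_kernel th (- 1) (@cloud R) (expvar (rho * m)) (fun _ _ => 0) sigma (x, g) =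
        (expR (th * (- 1 - 0)))%:E := integral_cst_prob (N sigma) _.
    under eq_integral do rewrite H.
    exact: (integral_cst_prob (N 1)).
  under eq_integral do rewrite H.
  by have -> := integral_cst_prob (cloud_law ((rho * m + s) / (m + s)) S_gt0)
    (expR (th * (- 1 - 0)))%:E.
have b0 : 0 <= rho * m by rewrite mulr_ge0// ltW.
have bm : rho * m <= m by rewrite ler_piMl// ltW.
have b_gt0 : 0 < rho * m + s by rewrite ltr_wpDl.
have gap := R2_in_le s0 m0 rho0 (le_lt_trans r0 rR).
exists (fun x y => score2 (rho * m + s) (m + s) s (cloud x) y), ((r + R2_in s m rho) / 2).
split.
- apply: (measurableT_comp (measurable_score2 (rho * m + s) (m + s) s)
    (g := fun q => (cloud q.1, q.2))).
  by apply: measurable_fun_pair => //; apply: (measurableT_comp (@measurable_cloud R)).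
- by move=> y; apply: integral_expR_score2 => //; rewrite lerD2r.
- by right; lra.
- move=> sigma sigmas; apply: near_miss2_kernel => //; lra.
Unshelve. all: by end_near. Qed.

Lemma achievable_pair_below (sigma1 sigma2 E m rho r1 r2 : R) :
  0 < sigma1 -> sigma1 <= sigma2 -> 0 < m -> m < E -> 0 <= rho <= 1 ->
  0 <= r1 -> r1 = 0 \/ r1 < R1_in sigma1 m rho ->
  0 <= r2 -> r2 = 0 \/ r2 < R2_in sigma2 m rho ->
  achievable_pair sigma1 sigma2 E (r1, r2).
Proof.
move=> s1 s12 m0 mE rho01 r10 r1R r20 r2R.
have s2 : 0 < sigma2 by exact: lt_le_trans s12.
have S_gt0 : 0 < m + sigma2 by rewrite addr_gt0.
have /andP[rho0 rho1] := rho01.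
have b0 : 0 <= rho * m by rewrite mulr_ge0// ltW.
have bm : rho * m <= m by rewrite ler_piMl// ltW.
have [l1 [gam1 [ml1 l1le r1gam H1]]] := exists_satellite_metric s1 m0 rho0 r10 r1R.
have [l2 [gam2 [ml2 l2le r2gam H2]]] := exists_cloud_metric S_gt0 s2 m0 rho01 r20 r2R.
have s11 : 0 < sigma1 <= sigma2 by rewrite s1.
have s22 : 0 < sigma2 <= sigma2 by rewrite s2 lexx.
have H21 := H2 _ s11; have H22 := H2 _ s22.
have H0 := near_power_kernel b0 bm s2 S_gt0 mE.
have PF : ProperFilter (0 : R)^'+ by exact: at_right_proper_filter.
(* One Chernoff parameter must serve all four bounds; each of them holds for every small enough
   positive value. *)
have [th] := @filter_ex _ _ PF _
  (filterI H0 (filterI H1 (filterI H21 (filterI H22 (nbhs_right_gt 0))))).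
move=> [[c0 c01 Hc0] [[d3 d31 Hd3] [[d1 d11 Hd1] [[d2 d21 Hd2] th_gt0]]]].
have E0 : 0 <= E by rewrite ltW// (lt_trans m0).
apply: (@achievable_of_exponents R _ _ _ _ (cloud_law ((rho * m + sigma2) / (m + sigma2)) S_gt0)
  (N 1) sigma1 sigma2 E th gam1 gam2 r1 r2 (@cloud R) (expvar (rho * m)) l2 l1 c0 d1 d2 d3
  E0 (ltW th_gt0) (@cloud_ge0 R) (fun g => expvar_ge0 g b0)).
- exact: measurable_cloud.
- exact: measurable_expvar.
- exact: ml2.
- exact: ml1.
- exact: l2le.
- exact: l1le.
- exact: Hc0.
- exact: Hd1.
- exact: Hd2.
- exact: Hd3.
all: by [].
Qed.

End coding_below_rates.

Section rate_continuity.
Context (R : realType).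

Let continuous_snr (k l : R) : continuous (fun m : R => 1 + k * m ^+ 2 / l).
Proof.
move=> m; apply: cvgD; first exact: cvg_cst.
apply: cvgM; last exact: cvg_cst.
by apply: cvgM; [exact: cvg_cst|exact: exprn_continuous].
Qed.

Let continuous_peak (k l rho : R) : continuous (fun m : R => k * (2 + rho * m / l) ^+ 2).
Proof.
move=> m; apply: cvgM; first exact: cvg_cst.
apply: (@continuous_comp _ _ _ (fun m : R => 2 + rho * m / l) (fun x : R => x ^+ 2)).
  apply: cvgD; first exact: cvg_cst.
  by apply: cvgM; [apply: cvgM; [exact: cvg_cst|exact: cvg_id]|exact: cvg_cst].
exact: exprn_continuous.
Qed.

Let continuous_half_ln (f : R -> R) (E : R) : continuous f -> 0 < f E ->
  {for E, continuous (fun m => 2^-1 * ln (f m))}.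
Proof.
move=> cf fE; apply: cvgM; first exact: cvg_cst.
by apply: (@continuous_comp _ _ _ f (@ln R)); [exact: cf|exact: continuous_ln].
Qed.

Lemma continuous_R1_in (sigma rho E : R) : {for E, continuous (fun m => R1_in sigma m rho)}.
Proof.
apply: (continuous_half_ln (@continuous_snr _ _)).
apply: ltr_wpDr => //; apply: divr_ge0; apply: mulr_ge0; rewrite ?sqr_ge0//.
- by apply: mulr_ge0; rewrite ?sqr_ge0 ?expR_ge0.
- by apply: mulr_ge0; rewrite ?pi_ge0.
Qed.

Lemma continuous_R2_in (sigma rho E : R) : 0 < sigma -> 0 <= rho -> 0 < E ->
  {for E, continuous (fun m => R2_in sigma m rho)}.
Proof.
move=> s0 rho0 E0; apply: cvgB.
- apply: (continuous_half_ln (@continuous_snr _ _)).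
  apply: ltr_wpDr => //; apply: divr_ge0; apply: mulr_ge0; rewrite ?sqr_ge0 ?expR_ge0//.
  by apply: mulr_ge0; rewrite ?pi_ge0.
- apply: (continuous_half_ln (@continuous_peak _ _ _)).
  apply: mulr_gt0; first by rewrite divr_gt0 ?expR_gt0// mulr_gt0// pi_gt0.
  by rewrite exprn_gt0// ltr_wpDr// divr_ge0 ?mulr_ge0// ltW.
Qed.

End rate_continuity.

Theorem theorem4 (R : realType) (sigma1 sigma2 E : R)
    (sigma1_gt0 : 0 < sigma1) (sigma12 : sigma1 <= sigma2) (E_gt0 : 0 < E)
    (rho : R) (rho_ge0 : 0 <= rho) (rho_le1 : rho <= 1) :
  achievable sigma1 sigma2 E (R1_in sigma1 E rho, R2_in sigma2 E rho).
Proof.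
have sigma2_gt0 : 0 < sigma2 by exact: lt_le_trans sigma12.
move=> B /nbhs_ballP[e /= e0 eB].
have e20 : 0 < e / 2 by rewrite divr_gt0.
have PF : ProperFilter E^'- by exact: at_left_proper_filter.
have c1 := cvg_at_left_filter (@continuous_R1_in R sigma1 rho E).
have c2 := cvg_at_left_filter (continuous_R2_in sigma2_gt0 rho_ge0 E_gt0).
have lt1 : R1_in sigma1 E rho - e / 2 < R1_in sigma1 E rho by rewrite ltrBlDr ltrDl.
have lt2 : R2_in sigma2 E rho - e / 2 < R2_in sigma2 E rho by rewrite ltrBlDr ltrDl.
have [m] := @filter_ex _ _ PF _ (filterI (cvgr_gt _ c1 _ lt1) (filterI (cvgr_gt _ c2 _ lt2)
  (filterI (nbhs_left_gt E_gt0) (nbhs_left_lt E)))).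
move=> [R1m [R2m [m0 mE]]].
(* Backing off by e / 2 absorbs the loss from replacing [E] by [m]. Clipping then gives either rate
   0 or a rate strictly below the one at [m], within distance [e] of the clipped target. *)
pose cut (r : R) : R := Num.max 0 (r - e / 2).
have cut_cases (r r' : R) : r - e / 2 < r' -> cut r = 0 \/ cut r < r'.
  by rewrite /cut => rr'; have [_|_] := leP 0 (r - e / 2); [right|left].
have cut_ball (r : R) : ball (Num.max 0 r : R) e (cut r : R).
  rewrite /ball/= /cut; have [h1|h1] := leP 0 r; have [h2|h2] := leP 0 (r - e / 2); rewrite ltr_norml; lra.
exists (cut (R1_in sigma1 E rho), cut (R2_in sigma2 E rho)); split.
- apply: (@achievable_pair_below R sigma1 sigma2 E m rho) => //.
  + by rewrite rho_ge0.
  + by rewrite le_max lexx.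
  + exact: cut_cases.
  + by rewrite le_max lexx.
  + exact: cut_cases.
- by apply: eB; split; exact: cut_ball.
Qed.
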